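(* Let $\Omega=\bigcup_{i=1}^n(\alpha_i,\beta_i)$ with $-\infty<\alpha_1<\beta_1<\alpha_2<\beta_2<\dots<\alpha_n<\beta_n<\infty$, and let $\mathsf D|_{C_c^\infty(\Omega)}$ be the operator $f\mapsto\frac1{2\pi i}f'$ in $L^2(\Omega)$ with domain $C_c^\infty(\Omega)$. Assume that $\Omega$ is spectral with spectrum $\Lambda$. Let $A=A_\Lambda$ be the self-adjoint extension of $\mathsf D|_{C_c^\infty(\Omega)}$ defined by $$A\left(\sum_{\lambda\in\Lambda}f_\lambda e_\lambda\right)=\sum_{\lambda\in\Lambda}\lambda f_\lambda e_\lambda,\qquad\mathscr D(A)=\left\{\sum_{\lambda\in\Lambda}f_\lambda e_\lambda\in L^2(\Omega):\sum_{\lambda\in\Lambda}|\lambda|^2|f_\lambda|^2<\infty\right\},$$ and let $B=B_\Lambda$ be the unitary boundary matrix associated to this extension. Then $B$ is a spectral boundary matrix and it is uniquely and well-defined by the conditions $$Be_\lambda(\vec\alpha)=e_\lambda(\vec\beta),\quad\text{for all }\lambda\in\Lambda.$$ Moreover $$\operatorname{span}\{e_\lambda(\vec\alpha):\lambda\in\Lambda\}=\operatorname{span}\{e_\lambda(\vec\beta):\lambda\in\Lambda\}=\mathbb C^n.$$ Conversely, if there exists a spectral boundary matrix $B$, then $\Omega$ is spectral with spectrum $$\Lambda=\{\lambda\in\mathbb R:Be_\lambda(\vec\alpha)=e_\lambda(\vec\beta)\}.$$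
   Context: For $\lambda\in\mathbb R$, $e_\lambda(x)=e^{2\pi i\lambda x}$. The set $\Omega$ is spectral with spectrum $\Lambda\subset\mathbb R$ if $\{e_\lambda:\lambda\in\Lambda\}$ is an orthogonal basis of $L^2(\Omega)$. The Lebesgue measure on $\Omega$ is renormalized to $\frac{1}{|\Omega|}dx$, so that the $e_\lambda$ have norm one. Let $J_i=(\alpha_i,\beta_i)$ and $\mathscr D_{\max}=\{f:\Omega\to\mathbb C: f$ is absolutely continuous on each $J_i$ and $f'\in L^2(\Omega)\}$; for $f\in\mathscr D_{\max}$ put $f(\alpha_i):=f(\alpha_i+)$, $f(\beta_i):=f(\beta_i-)$ (these limits exist), $f(\vec\alpha)=(f(\alpha_1),\dots,f(\alpha_n))$, $f(\vec\beta)=(f(\beta_1),\dots,f(\beta_n))$. The self-adjoint extensions $A$ of $\mathsf D|_{C_c^\infty(\Omega)}$ are exactly the operators with domain $\mathscr D_B=\{f\in\mathscr D_{\max}:Bf(\vec\alpha)=f(\vec\beta)\}$ and $Af=\frac1{2\pi i}f'$, where $B$ is a unitary $n\times n$ matrix; $B$ is called the boundary matrix associated to $A$. The operator $A_\Lambda$ of the claim is such a self-adjoint extension. For $\vec z\in\mathbb C^n$, $E(\vec z)$ is the diagonal matrix with diagonal entries $e^{2\pi iz_1},\dots,e^{2\pi iz_n}$. A unitary $n\times n$ (boundary) matrix $B$ is called spectral if, for every $\lambda\in\mathbb R$, the equation $BE(\lambda\vec\alpha)c=E(\lambda\vec\beta)c$, $c\in\mathbb C^n$, has either only the trivial solution $c=0$,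 or only constant solutions of the form $c=a(1,1,\dots,1)$, $a\in\mathbb C$. *)

(* Defs.v *)
From HB Require Import structures.
From mathcomp Require Import all_boot all_order all_algebra.
From mathcomp Require Import finmap complex spectral.
From mathcomp Require Import all_classical all_reals all_analysis.
Set Implicit Arguments.
Unset Strict Implicit.
Unset Printing Implicit Defensive.
Import Order.TTheory GRing.Theory Num.Theory.
Import numFieldNormedType.Exports.
Import ComplexField.Normc.

Local Open Scope classical_set_scope.
Local Open Scope ring_scope.
Local Open Scope complex_scope.

(* MathComp Analysis integrates and differentiates functions into R or \bar R,
   so measurability, integrals, limits and derivatives of functions R -> R[i]
   are taken on real and imaginary parts. *)

Definition cexp (R : realType) (z : R[i]) : R[i] :=
  (expR (complex.Re z))%:C * (cos (complex.Im z) +i* sin (complex.Im z)).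

Definition two_pi_i (R : realType) : R[i] := 0 +i* (2 * pi).

Definition e_ (R : realType) (lambda : R) (x : R) : R[i] :=
  cexp (two_pi_i R * (lambda * x)%:C).

Definition Omega (R : realType) (n : nat) (alpha beta : 'I_n -> R) : set R :=
  [set x | exists i, alpha i < x < beta i].

(* Elements of L^2(D) are represented by functions on R, of which only the
   values almost everywhere on D matter. *)
Definition in_L2 (R : realType) (D : set R) (f : R -> R[i]) : Prop :=
  [/\ measurable_fun D (fun x => complex.Re (f x)),
      measurable_fun D (fun x => complex.Im (f x)) &
      (\int[lebesgue_measure]_(x in D) ((normc (f x) ^+ 2)%:E) < +oo)%E].

Definition eq_on_ae (R : realType) (D : set R) (f g : R -> R[i]) : Prop :=
  {ae lebesgue_measure, forall x, D x -> f x = g x}.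

Definition length (R : realType) (D : set R) : R := fine (lebesgue_measure D).

Definition cintegral (R : realType) (D : set R) (f : R -> R[i]) : R[i] :=
  (\int[lebesgue_measure]_(x in D) complex.Re (f x)) +i*
  (\int[lebesgue_measure]_(x in D) complex.Im (f x)).

(* The Lebesgue measure on D is renormalized by 1 / |D|. *)
Definition inner (R : realType) (D : set R) (f g : R -> R[i]) : R[i] :=
  (length D)^-1%:C * cintegral D (fun x => f x * (g x)^*).

Definition L2norm (R : realType) (D : set R) (f : R -> R[i]) : R :=
  Num.sqrt ((length D)^-1 *
            \int[lebesgue_measure]_(x in D) (normc (f x) ^+ 2)).

(* f = \sum_(lambda in Lambda) c_lambda e_lambda in L^2(D): the finite partial
   sums converge in norm along the finite subsets of Lambda. *)
Definition exp_sum (R : realType) (D Lambda : set R) (c : R -> R[i])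
    (f : R -> R[i]) : Prop :=
  forall eps : R, 0 < eps ->
  exists2 F0 : {fset R}, [set` F0] `<=` Lambda &
  forall F : {fset R}, (F0 `<=` F)%fset -> [set` F] `<=` Lambda ->
    L2norm D (fun x => f x - \sum_(l <- F) c l * e_ l x) < eps.

Definition spectrum (R : realType) (D Lambda : set R) : Prop :=
  (forall l m : R, Lambda l -> Lambda m -> l != m ->
     inner D (e_ l) (e_ m) = 0) /\
  (forall f, in_L2 D f -> exists c, exp_sum D Lambda c f).

(* An unbounded operator in L^2(D) is given by its graph: A f g means that f is
   in the domain of A and A f = g (as classes modulo a.e. equality on D). *)
Definition operator (R : realType) := (R -> R[i]) -> (R -> R[i]) -> Prop.

Definition densely_defined (R : realType) (D : set R) (A : operator R) : Prop :=
  forall f, in_L2 D f -> forall eps : R, 0 < eps ->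
  exists h k, A h k /\ L2norm D (fun x => f x - h x) < eps.

Definition adjoint (R : realType) (D : set R) (A : operator R) : operator R :=
  fun f g => [/\ in_L2 D f, in_L2 D g &
    forall h k, A h k -> inner D k f = inner D h g].

Definition selfadjoint (R : realType) (D : set R) (A : operator R) : Prop :=
  densely_defined D A /\ forall f g, A f g <-> adjoint D A f g.

Definition smooth (R : realType) (u : R -> R) : Prop :=
  forall (k : nat) (x : R), derivable (derive1n k u) x 1.

(* Functions with compact support in D, extended by 0 outside D. *)
Definition Cc_infty (R : realType) (D : set R) (f : R -> R[i]) : Prop :=
  [/\ smooth (fun x => complex.Re (f x)),
      smooth (fun x => complex.Im (f x)) &
      exists K : set R, [/\ compact K, K `<=` D &
        forall x, ~ K x -> f x = 0]].

Definition cderive (R : realType) (f : R -> R[i]) (x : R) : R[i] :=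
  derive1 (fun y => complex.Re (f y)) x +i*
  derive1 (fun y => complex.Im (f y)) x.

Definition minimal_operator (R : realType) (D : set R) : operator R :=
  fun f g => Cc_infty D f /\ g = (fun x => (two_pi_i R)^-1 * cderive f x).

Definition selfadjoint_extension (R : realType) (D : set R)
    (A : operator R) : Prop :=
  selfadjoint D A /\ (forall f g, minimal_operator D f g -> A f g).

Definition A_ (R : realType) (D Lambda : set R) : operator R :=
  fun f g => [/\ in_L2 D f, in_L2 D g & exists c : R -> R[i],
    [/\ exp_sum D Lambda c f,
        (\esum_(l in Lambda) ((`|l| ^+ 2 * normc (c l) ^+ 2)%:E) < +oo)%E &
        exp_sum D Lambda (fun l => l%:C * c l) g]].

Definition abs_continuous (R : realType) (a b : R) (f : R -> R[i]) : Prop :=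
  forall eps : R, 0 < eps -> exists2 delta : R, 0 < delta &
  forall (k : nat) (s t : 'I_k -> R),
    (forall i, a < s i /\ s i <= t i /\ t i < b) ->
    (forall i j, i != j -> t i <= s j \/ t j <= s i) ->
    \sum_i (t i - s i) < delta ->
    \sum_i normc (f (t i) - f (s i)) < eps.

Definition is_derivative_ae (R : realType) (D : set R)
    (f df : R -> R[i]) : Prop :=
  {ae lebesgue_measure, forall x, D x ->
     is_derive x 1 (fun y => complex.Re (f y)) (complex.Re (df x)) /\
     is_derive x 1 (fun y => complex.Im (f y)) (complex.Im (df x))}.

(* f is in the maximal domain, with derivative df in L^2. *)
Definition in_Dmax (R : realType) (n : nat) (alpha beta : 'I_n -> R)
    (f df : R -> R[i]) : Prop :=
  [/\ forall i, abs_continuous (alpha i) (beta i) f,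
      is_derivative_ae (Omega alpha beta) f df &
      in_L2 (Omega alpha beta) df].

Definition right_limit (R : realType) (f : R -> R[i]) (a : R) : R[i] :=
  lim (complex.Re (f x) @[x --> a^'+]) +i* lim (complex.Im (f x) @[x --> a^'+]).

Definition left_limit (R : realType) (f : R -> R[i]) (a : R) : R[i] :=
  lim (complex.Re (f x) @[x --> a^'-]) +i* lim (complex.Im (f x) @[x --> a^'-]).

Definition operator_of_matrix (R : realType) (n : nat) (alpha beta : 'I_n -> R)
    (B : 'M[R[i]]_n) : operator R :=
  fun f g => [/\ in_L2 (Omega alpha beta) f, in_L2 (Omega alpha beta) g &
    exists h dh, [/\ in_Dmax alpha beta h dh,
      B *m (\col_i right_limit h (alpha i)) = \col_i left_limit h (beta i),
      eq_on_ae (Omega alpha beta) f h &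
      eq_on_ae (Omega alpha beta) g (fun x => (two_pi_i R)^-1 * dh x)]].

Definition boundary_matrix (R : realType) (n : nat) (alpha beta : 'I_n -> R)
    (A : operator R) (B : 'M[R[i]]_n) : Prop :=
  B \is unitarymx /\
  forall f g, A f g <-> operator_of_matrix alpha beta B f g.

Definition E_ (R : realType) (n : nat) (z : 'cV[R[i]]_n) : 'M[R[i]]_n :=
  diag_mx (\row_i cexp (two_pi_i R * z i 0)).

Definition cvec (R : realType) (n : nat) (u : 'I_n -> R) : 'cV[R[i]]_n :=
  \col_i (u i)%:C.

Definition spectral_matrix (R : realType) (n : nat) (alpha beta : 'I_n -> R)
    (B : 'M[R[i]]_n) : Prop :=
  B \is unitarymx /\
  forall lambda : R,
    let sol (c : 'cV[R[i]]_n) :=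
      B *m E_ (lambda%:C *: cvec alpha) *m c = E_ (lambda%:C *: cvec beta) *m c
    in
    (forall c, sol c -> c = 0) \/
    (forall c, sol c -> exists a : R[i], c = const_mx a).

Definition e_vec (R : realType) (n : nat) (lambda : R) (u : 'I_n -> R) :
  'cV[R[i]]_n := \col_i e_ lambda (u i).

Definition lin_span (R : realType) (n : nat) (S : set 'cV[R[i]]_n) :
    set 'cV[R[i]]_n :=
  [set v | exists (k : nat) (w : 'I_k -> 'cV[R[i]]_n) (c : 'I_k -> R[i]),
     (forall i, S (w i)) /\ v = \sum_i c i *: w i].

(* Main.v *)
(* If Omega has a spectrum Lambda, then A_Lambda acts on Fourier coefficients by
   multiplication by l, so it is symmetric and, by completeness, self-adjoint.
   Green's formula turns orthogonality of the e_l into equality of the Gram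
   matrices of the vectors e_l(alpha) and e_l(beta), and symmetry of A_Lambda
   shows that these vectors span; hence exactly one matrix sends e_l(alpha) to
   e_l(beta), and it is unitary. For m outside Lambda the equation h' = 2 pi i
   (g + m h) is solvable in the domain attached to this matrix, which identifies
   that domain with the domain of A_Lambda.

   Conversely, let B be spectral. Its exponentials are orthogonal by Green's
   formula, and for m outside Lambda the solution operator T : g |-> h of
   h' = 2 pi i (g + m h) is symmetric, and compact by Arzela-Ascoli. On the
   orthogonal complement of the e_l a nonzero T would have an eigenvector; it is
   a locally constant multiple of some e_l, and B being spectral forces this
   multiple to be constant, a contradiction. So the e_l are complete. *)

(* Functions are kept as representatives, and equality almost everywhere is upgraded only where
   boundary values are read. This works because an element of the maximal domain is continuous on
   each interval, so its one-sided limits depend only on its class. A real [m] outside [Lambda]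
   always exists: Omega is bounded, so [e_ l] tends to [e_ 0] uniformly as [l] tends to 0, while two
   orthonormal vectors stay at distance [sqrt 2]. For such an [m] the linear system for the initial
   values of [h] is invertible, and the solution operator is bounded. The two directions use it
   differently. From [Lambda] to [B] only solvability matters: the matrix operator is contained in
   [A_], and [A_ - m] is injective, so surjectivity of the smaller operator forces equality. From
   [B] to [Lambda] no expansion is available yet, and compactness must produce eigenfunctions: an
   eigenvalue [r] of [T] corresponds to the frequency [m + 1/r]. Completeness of L^2 enters there
   too, because a trivial orthogonal complement has to be turned into convergent Fourier sums. *)
Require Import Defs.
From mathcomp Require Import all_boot all_order all_algebra.
From mathcomp Require Import finmap complex spectral.
From mathcomp Require Import all_classical all_reals all_analysis.
From mathcomp Require Import measurable_realfun ring lra.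
Set Implicit Arguments.
Unset Strict Implicit.
Unset Printing Implicit Defensive.
Import Order.TTheory GRing.Theory Num.Theory.
Import numFieldNormedType.Exports.
Import ComplexField.Normc.

Local Open Scope classical_set_scope.
Local Open Scope ring_scope.
Local Open Scope complex_scope.
Local Open Scope ring_scope.

(** * Square-integrable complex functions *)

Section complex_parts.
Context {R : realType}.
Implicit Types z w : R[i].

Lemma ReD z w : complex.Re (z + w) = complex.Re z + complex.Re w.
Proof. by case: z; case: w. Qed.

Lemma ImD z w : complex.Im (z + w) = complex.Im z + complex.Im w.
Proof. by case: z; case: w. Qed.

Lemma ReN z : complex.Re (- z) = - complex.Re z.
Proof. by case: z. Qed.

Lemma ImN z : complex.Im (- z) = - complex.Im z.
Proof. by case: z. Qed.

Lemma ReM z w : complex.Re (z * w) =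
  complex.Re z * complex.Re w - complex.Im z * complex.Im w.
Proof. by case: z; case: w. Qed.

Lemma ImM z w : complex.Im (z * w) =
  complex.Re z * complex.Im w + complex.Im z * complex.Re w.
Proof. by case: z; case: w. Qed.

Lemma Re_conj z : complex.Re z^* = complex.Re z.
Proof. by case: z. Qed.

Lemma Im_conj z : complex.Im z^* = - complex.Im z.
Proof. by case: z. Qed.

Lemma conj_realC (x : R) : (x%:C)^* = x%:C :> R[i].
Proof. exact: conjc_real. Qed.

Lemma Re_mul_conj z w : complex.Re (z * w^*) = complex.Re (z^* * w).
Proof. by rewrite !ReM !Re_conj !Im_conj; ring. Qed.

Lemma realCM (x y : R) : (x * y)%:C = x%:C * y%:C.
Proof. exact: rmorphM. Qed.

Lemma conj_mul z w : (z * w)^* = z^* * w^*.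
Proof. exact: rmorphM. Qed.

Lemma conj_add z w : (z + w)^* = z^* + w^*.
Proof. exact: rmorphD. Qed.

Lemma conj_sub z w : (z - w)^* = z^* - w^*.
Proof. exact: rmorphB. Qed.

Lemma complex_eq z w :
  complex.Re z = complex.Re w -> complex.Im z = complex.Im w -> z = w.
Proof. by case: z; case: w => ? ? ? ? /= -> ->. Qed.

Lemma realCB_eq0 (x y : R) : (x%:C - y%:C == 0 :> R[i]) = (x == y).
Proof. by rewrite subr_eq0; apply/eqP/eqP => [[]|->]. Qed.

Lemma normc_ge0 z : 0 <= normc z.
Proof. by case: z => a b; exact: sqrtr_ge0. Qed.

Lemma normc_sqr z : normc z ^+ 2 = complex.Re z ^+ 2 + complex.Im z ^+ 2.
Proof. by case: z => a b /=; rewrite sqr_sqrtr// addr_ge0// sqr_ge0. Qed.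

Lemma normc_sqrE z : (normc z ^+ 2)%:C = z * z^*.
Proof.
apply: complex_eq; rewrite ?ReM ?ImM ?Re_conj ?Im_conj ?normc_sqr /=; ring.
Qed.

Lemma normc_Re z : `|complex.Re z| <= normc z.
Proof.
rewrite -(@ler_pXn2r _ 2)// ?nnegrE ?normc_ge0//.
by rewrite normc_sqr real_normK ?num_real// lerDl sqr_ge0.
Qed.

Lemma normc_Im z : `|complex.Im z| <= normc z.
Proof.
rewrite -(@ler_pXn2r _ 2)// ?nnegrE ?normc_ge0//.
by rewrite normc_sqr real_normK ?num_real// lerDr sqr_ge0.
Qed.

Lemma normc_le_ReIm z : normc z <= `|complex.Re z| + `|complex.Im z|.
Proof.
rewrite -(@ler_pXn2r _ 2)// ?nnegrE ?normc_ge0 ?addr_ge0//.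
rewrite normc_sqr sqrrD !real_normK ?num_real//.
by rewrite lerD2r lerDl mulrn_wge0// mulr_ge0.
Qed.

Lemma normc_eq0 z : (normc z == 0) = (z == 0).
Proof. by apply/eqP/eqP => [/eq0_normc|->]//; rewrite normc0. Qed.

Lemma normc_real (x : R) : normc x%:C = `|x|.
Proof. by rewrite /= expr0n addr0 sqrtr_sqr. Qed.

End complex_parts.

Section square_integrable.
Context {d} {T : measurableType d} {R : realType}.
Variable mu : {measure set T -> \bar R}.
Variable D : set T.
Hypothesis mD : measurable D.

Definition sqint (u : T -> R) : Prop :=
  measurable_fun D u /\ mu.-integrable D (EFin \o (fun x => u x ^+ 2)).

Lemma integrable_le (u v : T -> R) : measurable_fun D u ->
  (forall x, D x -> `|u x| <= v x) ->
  mu.-integrable D (EFin \o v) -> mu.-integrable D (EFin \o u).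
Proof.
move=> mu_ uv; apply: le_integrable => //; first exact/measurable_EFinP.
by move=> x Dx /=; rewrite lee_fin (le_trans (uv _ Dx))// ler_norm.
Qed.

Lemma integrable_ge0P (u : T -> R) : measurable_fun D u ->
  (forall x, D x -> 0 <= u x) ->
  mu.-integrable D (EFin \o u) <-> (\int[mu]_(x in D) (u x)%:E < +oo)%E.
Proof.
move=> mu_ u0.
have E : (\int[mu]_(x in D) `|(EFin \o u) x| = \int[mu]_(x in D) (u x)%:E)%E.
  by apply: eq_integral => x /set_mem Dx /=; rewrite ger0_norm// u0.
split; first by move=> /integrableP[_]; rewrite E.
by move=> iu; apply/integrableP; split; [exact/measurable_EFinP|rewrite E].
Qed.

Lemma integrable_add (u v : T -> R) : mu.-integrable D (EFin \o u) ->
  mu.-integrable D (EFin \o v) -> mu.-integrable D (EFin \o (fun x => u x + v x)).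
Proof. by move=> iu iv; exact: (integrableD mD iu iv). Qed.

Lemma integrable_scale k (u : T -> R) : mu.-integrable D (EFin \o u) ->
  mu.-integrable D (EFin \o (fun x => k * u x)).
Proof. by move=> iu; exact: (integrableZl mD k iu). Qed.

Lemma integrable_sub (u v : T -> R) : mu.-integrable D (EFin \o u) ->
  mu.-integrable D (EFin \o v) -> mu.-integrable D (EFin \o (fun x => u x - v x)).
Proof. by move=> iu iv; exact: (integrableB mD iu iv). Qed.

Lemma sqintD u v : sqint u -> sqint v -> sqint (fun x => u x + v x).
Proof.
move=> [mu_ iu] [mv iv]; split; first exact: measurable_funD.
apply: (@integrable_le _ (fun x => 2 * (u x ^+ 2) + 2 * (v x ^+ 2))).
- by apply: measurable_funX; exact: measurable_funD.
- move=> x Dx; rewrite ger0_norm ?sqr_ge0//.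
  by have := sqr_ge0 (u x - v x); nra.
- by apply: integrable_add; apply: integrable_scale.
Qed.

Lemma sqintZ k u : sqint u -> sqint (fun x => k * u x).
Proof.
move=> [mu_ iu]; split; first exact: measurable_funM.
apply: (eq_integrable mD _ _ _ (integrable_scale (k ^+ 2) iu)) => x _ /=.
by rewrite exprMn.
Qed.

Lemma sqintM u v : sqint u -> sqint v ->
  mu.-integrable D (EFin \o (fun x => u x * v x)).
Proof.
move=> [mu_ iu] [mv iv].
apply: (@integrable_le _ (fun x => (u x ^+ 2) + (v x ^+ 2))).
- exact: measurable_funM.
- move=> x Dx; rewrite ler_norml.
  by have := sqr_ge0 (u x - v x); have := sqr_ge0 (u x + v x); nra.
- exact: integrable_add.
Qed.

Lemma sqint_mul_le1 (b u : T -> R) : measurable_fun D b ->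
  (forall x, D x -> `|b x| <= 1) -> sqint u -> sqint (fun x => b x * u x).
Proof.
move=> mb b1 [mu_ iu]; split; first exact: measurable_funM.
apply: integrable_le iu; first by apply: measurable_funX; exact: measurable_funM.
move=> x Dx; rewrite normrX normrM exprMn -[leRHS]mul1r.
rewrite (@real_normK _ (u x)) ?num_real// ler_wpM2r ?sqr_ge0//.
by rewrite expr_le1//; exact: b1.
Qed.

Lemma ae_eq_Rintegral (u v : T -> R) : measurable_fun D u ->
  measurable_fun D v -> {ae mu, forall x, D x -> u x = v x} ->
  \int[mu]_(x in D) u x = \int[mu]_(x in D) v x.
Proof.
move=> mu_ mv uv; congr fine; apply: ae_eq_integral => //.
- exact/measurable_EFinP.
- exact/measurable_EFinP.
- by apply: filterS uv => x /[apply] ->.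
Qed.

End square_integrable.

Section lebesgue_ae.
Context {R : realType}.
Notation mu := (@lebesgue_measure R).
Implicit Types P Q : R -> Prop.

Lemma ae_mono P Q : (forall x, P x -> Q x) ->
  {ae mu, forall x, P x} -> {ae mu, forall x, Q x}.
Proof. exact: (@filterS _ _ (ae_filter_ringOfSetsType mu)). Qed.

Lemma ae_and P Q : {ae mu, forall x, P x} -> {ae mu, forall x, Q x} ->
  {ae mu, forall x, P x /\ Q x}.
Proof. exact: (@filterI _ _ (ae_filter_ringOfSetsType mu)). Qed.

Lemma ae_all P : (forall x, P x) -> {ae mu, forall x, P x}.
Proof. by move=> allP; apply: (ae_mono _ (@aeW _ _ _ mu _ (fun=> I))) => x _. Qed.

End lebesgue_ae.

Section complex_L2.
Context {R : realType}.
Notation mu := (@lebesgue_measure R).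
Variable D : set R.
Hypothesis mD : measurable D.
Local Notation sqint := (sqint mu D).

(** The same fact typed at [measurableTypeR R], the carrier at which the lemmas about a general
    measure are applied to [mu]. *)
Let mD' : @measurable _ (measurableTypeR R) D := mD.

Lemma in_L2P f : in_L2 D f <->
  sqint (fun x => complex.Re (f x)) /\ sqint (fun x => complex.Im (f x)).
Proof.
have mn : measurable_fun D (fun x => complex.Re (f x)) ->
    measurable_fun D (fun x => complex.Im (f x)) ->
    measurable_fun D (fun x => normc (f x) ^+ 2).
  move=> mr mi; under eq_fun do rewrite normc_sqr.
  by apply: measurable_funD; apply: measurable_funX.
split=> [[mr mi fi]|[[mr ir] [mi ii]]].
- have ni : mu.-integrable D (EFin \o (fun x => normc (f x) ^+ 2)).
    by refine ((@integrable_ge0P _ _ _ mu _ _ (mn mr mi) _).2 fi) => x _; rewrite sqr_ge0.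
  split; split => //; apply: (integrable_le mD' _ _ ni).
  - exact: measurable_funX.
  - by move=> x Dx; rewrite ger0_norm ?sqr_ge0// normc_sqr lerDl sqr_ge0.
  - exact: measurable_funX.
  - by move=> x Dx; rewrite ger0_norm ?sqr_ge0// normc_sqr lerDr sqr_ge0.
- split => //; refine ((@integrable_ge0P _ _ _ mu _ _ (mn mr mi) _).1 _).
    by move=> x _; rewrite sqr_ge0.
  under [X in EFin \o X]eq_fun do rewrite normc_sqr.
  exact: (integrable_add mD' ir ii).
Qed.

Lemma in_L2D f g : in_L2 D f -> in_L2 D g -> in_L2 D (fun x => f x + g x).
Proof.
move=> /in_L2P[fr fi] /in_L2P[gr gi]; apply/in_L2P; split.
  by under eq_fun do rewrite ReD; exact: (sqintD mD').
by under eq_fun do rewrite ImD; exact: (sqintD mD').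
Qed.

Lemma in_L2Z c f : in_L2 D f -> in_L2 D (fun x => c * f x).
Proof.
move=> /in_L2P[fr fi]; apply/in_L2P; split.
  under eq_fun do rewrite ReM -mulNr.
  by apply: (sqintD mD'); exact: (sqintZ mD').
under eq_fun do rewrite ImM.
by apply: (sqintD mD'); exact: (sqintZ mD').
Qed.

Lemma in_L2B f g : in_L2 D f -> in_L2 D g -> in_L2 D (fun x => f x - g x).
Proof.
move=> hf /(in_L2Z (-1)) hg.
by under eq_fun do rewrite -mulN1r; exact: in_L2D.
Qed.

Lemma in_L20 : in_L2 D (fun=> 0).
Proof.
have s0 : sqint (fun=> 0).
  by split=> //; rewrite expr0n; exact: (@integrable0 _ _ _ mu D).
by apply/in_L2P.
Qed.

Lemma in_L2_sum (I : Type) (s : seq I) (f : I -> R -> R[i]) :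
  (forall i, in_L2 D (f i)) -> in_L2 D (fun x => \sum_(i <- s) f i x).
Proof.
move=> hf; elim: s => [|i s IH].
  by under eq_fun do rewrite big_nil; exact: in_L20.
by under eq_fun do rewrite big_cons; exact: in_L2D.
Qed.

Lemma in_L2_conj f : in_L2 D f -> in_L2 D (fun x => (f x)^*).
Proof.
move=> /in_L2P[fr fi]; apply/in_L2P; split.
  by under eq_fun do rewrite Re_conj.
by under eq_fun do rewrite Im_conj -mulN1r; exact: (sqintZ mD').
Qed.

(** Meant for unimodular [b]: the twist by an exponential, which reduces [h' = 2 pi i (g + l h)] to
    a plain integration, stays in L^2. *)
Lemma in_L2_mul_le1 (b f : R -> R[i]) :
  measurable_fun D (fun x => complex.Re (b x)) ->
  measurable_fun D (fun x => complex.Im (b x)) ->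
  (forall x, D x -> normc (b x) <= 1) -> in_L2 D f ->
  in_L2 D (fun x => b x * f x).
Proof.
move=> mbr mbi b1 /in_L2P[fr fi]; apply/in_L2P.
have br x : D x -> `|complex.Re (b x)| <= 1.
  by move=> Dx; rewrite (le_trans (normc_Re _))// b1.
have bi x : D x -> `|complex.Im (b x)| <= 1.
  by move=> Dx; rewrite (le_trans (normc_Im _))// b1.
split.
  under eq_fun do rewrite ReM -mulN1r.
  by apply: (sqintD mD'); [|apply: (sqintZ mD')]; exact: (sqint_mul_le1 mD').
under eq_fun do rewrite ImM.
by apply: (sqintD mD'); exact: (sqint_mul_le1 mD').
Qed.

Definition cintegrable (f : R -> R[i]) : Prop :=
  mu.-integrable D (EFin \o (fun x => complex.Re (f x))) /\
  mu.-integrable D (EFin \o (fun x => complex.Im (f x))).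

Lemma cintegrableM f g : in_L2 D f -> in_L2 D g ->
  cintegrable (fun x => f x * g x).
Proof.
move=> /in_L2P[fr fi] /in_L2P[gr gi]; split.
  under [X in EFin \o X]eq_fun do rewrite ReM.
  by apply: (integrable_sub mD'); exact: (sqintM mD').
under [X in EFin \o X]eq_fun do rewrite ImM.
by apply: (integrable_add mD'); exact: (sqintM mD').
Qed.

Lemma cintegrableJ f g : in_L2 D f -> in_L2 D g ->
  cintegrable (fun x => f x * (g x)^*).
Proof. by move=> hf /in_L2_conj; exact: cintegrableM. Qed.

Lemma cintegrableD f g : cintegrable f -> cintegrable g ->
  cintegrable (fun x => f x + g x).
Proof.
move=> [fr fi] [gr gi]; split.
  by under [X in EFin \o X]eq_fun do rewrite ReD; exact: (integrable_add mD').
by under [X in EFin \o X]eq_fun do rewrite ImD; exact: (integrable_add mD').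
Qed.

Lemma cintegralD f g : cintegrable f -> cintegrable g ->
  cintegral D (fun x => f x + g x) = cintegral D f + cintegral D g.
Proof.
move=> [fr fi] [gr gi]; apply: complex_eq; rewrite ?ReD ?ImD /=.
  by under eq_Rintegral do rewrite ReD; exact: RintegralD.
by under eq_Rintegral do rewrite ImD; exact: RintegralD.
Qed.

Lemma cintegralZ c f : cintegrable f ->
  cintegral D (fun x => c * f x) = c * cintegral D f.
Proof.
move=> [fr fi]; apply: complex_eq; rewrite ?ReM ?ImM /=.
  under eq_Rintegral do rewrite ReM.
  by rewrite RintegralB ?RintegralZl//; exact: (integrable_scale mD').
under eq_Rintegral do rewrite ImM.
by rewrite RintegralD ?RintegralZl//; exact: (integrable_scale mD').
Qed.

Lemma eq_cintegral f g : (forall x, D x -> f x = g x) ->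
  cintegral D f = cintegral D g.
Proof.
move=> fg; apply: complex_eq => /=; apply: eq_Rintegral => x.
  by rewrite inE => /fg->.
by rewrite inE => /fg->.
Qed.

Lemma conj_cintegral f : cintegrable f ->
  (cintegral D f)^* = cintegral D (fun x => (f x)^*).
Proof.
move=> [fr fi]; apply: complex_eq; rewrite ?Re_conj ?Im_conj /=.
  by under [RHS]eq_Rintegral do rewrite Re_conj.
under [RHS]eq_Rintegral do rewrite Im_conj -mulN1r.
by rewrite RintegralZl// mulN1r.
Qed.

(** The factor 2 is the price of bounding the real and the imaginary part separately by [v];
    [normc_cintegral_AMGM] absorbs it in the 1/2 of the AM-GM inequality. *)
Lemma normc_cintegral_le f (v : R -> R) : cintegrable f ->
  mu.-integrable D (EFin \o v) -> (forall x, D x -> normc (f x) <= v x) ->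
  normc (cintegral D f) <= 2 * \int[mu]_(x in D) v x.
Proof.
move=> [fr fi] iv fv; apply: le_trans (normc_le_ReIm _) _ => /=.
rewrite mulr_natl mulr2n; apply: lerD.
  apply: (le_trans (le_normr_Rintegral _ _)) => //.
  apply: le_Rintegral => //; first exact: (integrable_abse fr).
  by move=> x Dx; rewrite (le_trans (normc_Re _))// fv.
apply: (le_trans (le_normr_Rintegral _ _)) => //.
apply: le_Rintegral => //; first exact: (integrable_abse fi).
by move=> x Dx; rewrite (le_trans (normc_Im _))// fv.
Qed.

End complex_L2.

(** * The exponentials [e_ l]: modulus, products, derivatives, measurability *)

Section exponentials.
Context {R : realType}.
Implicit Types l m x : R.

Lemma e_E l x : e_ l x = cos (2 * pi * l * x) +i* sin (2 * pi * l * x).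
Proof.
have -> : e_ l x = cexp (0 +i* (2 * pi * l * x)).
  congr cexp; apply: complex_eq; rewrite ?ReM ?ImM /=; ring.
by rewrite /cexp /= expR0 mul1r.
Qed.

Lemma normc_e l x : normc (e_ l x) = 1.
Proof. by rewrite e_E /= cos2Dsin2 sqrtr1. Qed.

Lemma e_Bl l m x : e_ l x * (e_ m x)^* = e_ (l - m) x.
Proof.
have E : 2 * pi * (l - m) * x = 2 * pi * l * x - 2 * pi * m * x by ring.
rewrite !e_E E cosB sinB; apply: complex_eq; rewrite ?ReM ?ImM /=; ring.
Qed.

Lemma e_0 x : e_ 0 x = 1.
Proof. by rewrite e_E mulr0 mul0r cos0 sin0. Qed.

Lemma e_conj_e l x : e_ l x * (e_ l x)^* = 1.
Proof. by rewrite e_Bl subrr e_0. Qed.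

Lemma e_neq0 l x : e_ l x != 0.
Proof. by rewrite -normc_eq0 normc_e oner_eq0. Qed.

Lemma e_N l x : e_ (- l) x = (e_ l x)^*.
Proof. by rewrite -[- l]add0r -e_Bl e_0 mul1r. Qed.

Lemma is_derive_Re_e l x : is_derive x 1 (fun y => complex.Re (e_ l y))
  (- (2 * pi * l) * complex.Im (e_ l x)).
Proof.
under eq_fun do rewrite e_E /=; rewrite e_E /=.
apply: is_derive_eq; rewrite /GRing.scale /=; ring.
Qed.

Lemma is_derive_Im_e l x : is_derive x 1 (fun y => complex.Im (e_ l y))
  (2 * pi * l * complex.Re (e_ l x)).
Proof.
under eq_fun do rewrite e_E /=; rewrite e_E /=.
apply: is_derive_eq; rewrite /GRing.scale /=; ring.
Qed.

Lemma continuous_Re_e l : continuous (fun x => complex.Re (e_ l x)).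
Proof.
move=> x; apply/differentiable_continuous/derivable1_diffP.
exact: (@ex_derive _ _ _ _ _ _ _ (is_derive_Re_e l x)).
Qed.

Lemma continuous_Im_e l : continuous (fun x => complex.Im (e_ l x)).
Proof.
move=> x; apply/differentiable_continuous/derivable1_diffP.
exact: (@ex_derive _ _ _ _ _ _ _ (is_derive_Im_e l x)).
Qed.

Lemma measurable_Re_e l (D : set R) :
  measurable_fun D (fun x => complex.Re (e_ l x)).
Proof.
apply: measurable_funTS; apply: continuous_measurable_fun.
exact: continuous_Re_e.
Qed.

Lemma measurable_Im_e l (D : set R) :
  measurable_fun D (fun x => complex.Im (e_ l x)).
Proof.
apply: measurable_funTS; apply: continuous_measurable_fun.
exact: continuous_Im_e.
Qed.

End exponentials.

(** * Inner product and norm of L^2(D) for the normalized measure *)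

Section hilbert.
Context {R : realType}.
Notation mu := (@lebesgue_measure R).
Variable D : set R.
Hypothesis mD : measurable D.
Hypothesis Dfin : (mu D < +oo)%E.
Hypothesis Dpos : 0 < length D.
Implicit Types f g h : R -> R[i].

Let mD' : @measurable _ (measurableTypeR R) D := mD.

Lemma length_gt0C : (length D)^-1%:C != 0.
Proof. by rewrite -normc_eq0 normc_real normr_eq0 invr_eq0 gt_eqF. Qed.

Lemma innerDl f g h : in_L2 D f -> in_L2 D g -> in_L2 D h ->
  inner D (fun x => f x + g x) h = inner D f h + inner D g h.
Proof.
move=> hf hg hh; rewrite /inner -mulrDr -cintegralD//; try exact: cintegrableJ.
by congr (_ * cintegral _ _); apply: funext => x; rewrite mulrDl.
Qed.

Lemma innerZl c f h : in_L2 D f -> in_L2 D h ->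
  inner D (fun x => c * f x) h = c * inner D f h.
Proof.
move=> hf hh; rewrite /inner mulrCA -(cintegralZ mD c)//; last exact: cintegrableJ.
by congr (_ * cintegral _ _); apply: funext => x; rewrite mulrA.
Qed.

Lemma innerC f g : in_L2 D f -> in_L2 D g -> inner D g f = (inner D f g)^*.
Proof.
move=> hf hg; rewrite /inner conj_mul conj_cintegral//; last exact: cintegrableJ.
rewrite conj_realC; congr (_ * cintegral _ _); apply: funext => x.
by rewrite conj_mul conjCK mulrC.
Qed.

Lemma innerDr f g h : in_L2 D f -> in_L2 D g -> in_L2 D h ->
  inner D h (fun x => f x + g x) = inner D h f + inner D h g.
Proof.
move=> hf hg hh; rewrite (innerC hf hh) (innerC hg hh).
by rewrite (innerC (in_L2D mD hf hg) hh) innerDl// conj_add.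
Qed.

Lemma innerZr c f h : in_L2 D f -> in_L2 D h ->
  inner D h (fun x => c * f x) = c^* * inner D h f.
Proof.
move=> hf hh; rewrite (innerC hf hh) (innerC (in_L2Z mD c hf) hh).
by rewrite innerZl// conj_mul.
Qed.

Lemma innerBl f g h : in_L2 D f -> in_L2 D g -> in_L2 D h ->
  inner D (fun x => f x - g x) h = inner D f h - inner D g h.
Proof.
move=> hf hg hh; under [X in inner _ X _]eq_fun do rewrite -mulN1r.
by rewrite innerDl ?innerZl ?mulN1r//; exact: in_L2Z.
Qed.

Lemma innerBr f g h : in_L2 D f -> in_L2 D g -> in_L2 D h ->
  inner D h (fun x => f x - g x) = inner D h f - inner D h g.
Proof.
move=> hf hg hh; rewrite (innerC hf hh) (innerC hg hh).
by rewrite (innerC (in_L2B mD hf hg) hh) innerBl// conj_sub.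
Qed.

Lemma inner0l h : inner D (fun=> 0) h = 0.
Proof.
rewrite /inner (_ : (fun x => _) = fun=> 0); last first.
  by apply: funext => x; rewrite mul0r.
by rewrite /cintegral /= /Rintegral integral0 mulr0.
Qed.

Lemma inner_suml (I : Type) (s : seq I) (f : I -> R -> R[i]) h :
  (forall i, in_L2 D (f i)) -> in_L2 D h ->
  inner D (fun x => \sum_(i <- s) f i x) h = \sum_(i <- s) inner D (f i) h.
Proof.
move=> hf hh; elim: s => [|i s IH].
  rewrite big_nil -[RHS](inner0l h); congr inner.
  by apply: funext => x; rewrite big_nil.
rewrite big_cons -IH -innerDl//; last exact: in_L2_sum.
by congr inner; apply: funext => x; rewrite big_cons.
Qed.

Lemma L2norm_ge0 f : 0 <= L2norm D f.
Proof. exact: sqrtr_ge0. Qed.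

Lemma L2norm_sqrE f : L2norm D f ^+ 2 =
  (length D)^-1 * \int[mu]_(x in D) (normc (f x) ^+ 2).
Proof.
rewrite sqr_sqrtr// mulr_ge0 ?invr_ge0 ?(ltW Dpos)//.
by apply: Rintegral_ge0 => x _; exact: sqr_ge0.
Qed.

Lemma L2norm_sqr f : (L2norm D f ^+ 2)%:C = inner D f f.
Proof.
rewrite L2norm_sqrE realCM; congr (_ * _).
apply: complex_eq => /=.
  by apply: eq_Rintegral => x _; rewrite -normc_sqrE.
rewrite (@eq_Rintegral _ _ _ mu D (cst 0)); first by rewrite /Rintegral integral0.
by move=> x _; rewrite -normc_sqrE.
Qed.

Lemma L2norm_Re f : L2norm D f ^+ 2 = complex.Re (inner D f f).
Proof. by rewrite -L2norm_sqr. Qed.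

(** One expansion for several uses: Cauchy-Schwarz, the triangle inequality ([t = -1]), Bessel's
    identity (one exponential at a time) and the defect [T (T f) - m^2 f] in the search for an
    eigenvector. *)
Lemma L2norm_sub_sqr t f g : in_L2 D f -> in_L2 D g ->
  L2norm D (fun x => f x - t * g x) ^+ 2 =
  L2norm D f ^+ 2 - 2 * complex.Re (t^* * inner D f g)
  + normc t ^+ 2 * L2norm D g ^+ 2.
Proof.
move=> hf hg; have htg := in_L2Z mD t hg; have hd := in_L2B mD hf htg.
rewrite L2norm_Re innerBl// !innerBr// !innerZl// !innerZr//.
rewrite -!L2norm_sqr (innerC hf hg).
have E2 : complex.Re (t * (t^* * (L2norm D g ^+ 2)%:C)) =
    normc t ^+ 2 * L2norm D g ^+ 2.
  by rewrite mulrA -normc_sqrE -realCM.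
by rewrite !(ReD, ReN) Re_mul_conj E2 /=; ring.
Qed.

Lemma L2normZ c f : in_L2 D f -> L2norm D (fun x => c * f x) = normc c * L2norm D f.
Proof.
move=> hf; apply/eqP; rewrite -(@eqrXn2 _ 2)// ?mulr_ge0 ?normc_ge0 ?L2norm_ge0//.
rewrite exprMn L2norm_Re innerZl ?innerZr//; last exact: in_L2Z.
by rewrite mulrA -normc_sqrE -L2norm_sqr -realCM.
Qed.

Lemma CauchySchwarz f g : in_L2 D f -> in_L2 D g ->
  normc (inner D f g) <= L2norm D f * L2norm D g.
Proof.
move=> hf hg; set p := inner D f g.
rewrite -(@ler_pXn2r _ 2)// ?nnegrE ?mulr_ge0 ?normc_ge0 ?L2norm_ge0//.
rewrite exprMn; set F := L2norm D f ^+ 2; set G := L2norm D g ^+ 2.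
have F0 : 0 <= F by exact: sqr_ge0.
have G0 : 0 <= G by exact: sqr_ge0.
have P0 : 0 <= normc p ^+ 2 by exact: sqr_ge0.
(* Taking the coefficient [s * p] with [s] real turns the cross term into the real number
   [s * |p|^2]. *)
have H (s : R) : 0 <= F - 2 * (s * normc p ^+ 2) + s ^+ 2 * normc p ^+ 2 * G.
  have := sqr_ge0 (L2norm D (fun x => f x - (s%:C * p) * g x)).
  rewrite L2norm_sub_sqr// normcM normc_real exprMn real_normK ?num_real//.
  rewrite conj_mul conj_realC -mulrA [_ * inner D f g]mulrC -/p -normc_sqrE.
  by rewrite -realCM.
have [G1|G1] := ltP 0 G.
  have := mulr_ge0 (H G^-1) (ltW G1); set e := (X in 0 <= X).
  have -> : e = F * G - normc p ^+ 2 by rewrite /e; field; rewrite gt_eqF.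
  by rewrite subr_ge0.
have G2 : G = 0 by apply/le_anti; rewrite G0 G1.
have [P1|P1] := ltP 0 (normc p ^+ 2); last by rewrite G2 mulr0.
(* For [G = 0] the form is affine in [s]; this value of [s] makes it [F - (F + 1)], which is
   negative. *)
have := H ((F + 1) / (2 * normc p ^+ 2)).
rewrite (_ : 2 * _ = F + 1) ?G2; first by lra.
by field; rewrite -sqrf_eq0 gt_eqF.
Qed.

Lemma L2norm_le_add f g : in_L2 D f -> in_L2 D g ->
  L2norm D (fun x => f x + g x) <= L2norm D f + L2norm D g.
Proof.
move=> hf hg.
rewrite -(@ler_pXn2r _ 2)// ?nnegrE ?addr_ge0 ?L2norm_ge0//.
have -> : (fun x => f x + g x) = (fun x => f x - (-1) * g x).
  by apply: funext => x; rewrite mulN1r opprK.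
rewrite L2norm_sub_sqr// normcN normc1 expr1n mul1r.
rewrite (_ : (-1)^* = -1) ?mulN1r ?ReN; last by rewrite rmorphN1.
have : complex.Re (inner D f g) <= L2norm D f * L2norm D g.
  apply: le_trans (CauchySchwarz hf hg).
  exact: le_trans (ler_norm _) (normc_Re _).
nra.
Qed.

Lemma L2normBC f g : L2norm D (fun x => f x - g x) = L2norm D (fun x => g x - f x).
Proof.
congr (Num.sqrt (_ * _)); apply: eq_Rintegral => x _.
by rewrite -opprB normcN.
Qed.

Lemma L2norm_le_sub f g h : in_L2 D f -> in_L2 D g -> in_L2 D h ->
  L2norm D (fun x => f x - h x) <=
  L2norm D (fun x => f x - g x) + L2norm D (fun x => g x - h x).
Proof.
move=> hf hg hh; apply: le_trans (L2norm_le_add _ _); try exact: in_L2B.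
by rewrite le_eqVlt; under [in X in _ == X]eq_fun do rewrite addrA subrK; rewrite eqxx.
Qed.

Lemma L2norm_eq0 f : in_L2 D f -> L2norm D f = 0 -> eq_on_ae D f (fun=> 0).
Proof.
move=> hf f0; have /(congr1 (fun z => z ^+ 2)) := f0.
rewrite L2norm_sqrE expr0n/= => /eqP; rewrite mulf_eq0 invr_eq0 gt_eqF//= => /eqP I0.
have [mr mi fin] := hf.
have mn : measurable_fun D (EFin \o (fun x => normc (f x) ^+ 2)).
  apply/measurable_EFinP; under eq_fun do rewrite normc_sqr.
  by apply: measurable_funD; apply: measurable_funX.
have /(ae_eq_integral_abs mu mD' mn) : (\int[mu]_(x in D)
    `|(EFin \o (fun x => (normc (f x) ^+ 2)%R)) x| = 0)%E.
  under eq_integral do rewrite /= ger0_norm ?sqr_ge0//.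
  (* [fine] also sends [+oo] to 0, so a zero real integral gives a zero integral only through the
     finiteness contained in [in_L2]. *)
  rewrite -[LHS]fineK; first exact: (congr1 EFin I0).
  by rewrite ge0_fin_numE//; apply: integral_ge0 => x _; rewrite lee_fin sqr_ge0.
apply: ae_mono => x /[apply] -[] /eqP.
by rewrite sqrf_eq0 normc_eq0 => /eqP.
Qed.

Lemma ae_eq_inner f g h : in_L2 D f -> in_L2 D g -> in_L2 D h ->
  eq_on_ae D f g -> inner D f h = inner D g h.
Proof.
move=> hf hg hh fg.
have [[fr fi] [gr gi]] := (cintegrableJ mD hf hh, cintegrableJ mD hg hh).
congr (_ * _); apply: complex_eq => /=; apply: ae_eq_Rintegral => //.
- by move/measurable_int/measurable_EFinP : fr.
- by move/measurable_int/measurable_EFinP : gr.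
- by apply: ae_mono fg => x /[apply] ->.
- by move/measurable_int/measurable_EFinP : fi.
- by move/measurable_int/measurable_EFinP : gi.
- by apply: ae_mono fg => x /[apply] ->.
Qed.

Lemma ae_eq_L2normB f g : in_L2 D f -> in_L2 D g -> eq_on_ae D f g ->
  L2norm D (fun x => f x - g x) = 0.
Proof.
move=> hf hg fg; apply/eqP; rewrite -sqrf_eq0 L2norm_Re.
rewrite (ae_eq_inner (g := fun=> 0)) ?inner0l//; try exact: in_L2B.
  exact: in_L20.
by apply: ae_mono fg => x /[apply] ->; rewrite subrr.
Qed.

Lemma in_L2_bounded M f : measurable_fun D (fun x => complex.Re (f x)) ->
  measurable_fun D (fun x => complex.Im (f x)) ->
  (forall x, D x -> normc (f x) <= M) -> in_L2 D f.
Proof.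
move=> mr mi fM; split => //.
apply: (@le_lt_trans _ _ (\int[mu]_(x in D) (M ^+ 2)%:E)%E).
  apply: ge0_le_integral => //.
  - by move=> x _; rewrite lee_fin sqr_ge0.
  - apply/measurable_EFinP; under eq_fun do rewrite normc_sqr.
    by apply: measurable_funD; apply: measurable_funX.
  - move=> x Dx; rewrite lee_fin lerXn2r ?nnegrE ?normc_ge0 ?fM//.
    exact: le_trans (normc_ge0 _) (fM _ Dx).
by rewrite integral_cst// lte_mul_pinfty// lee_fin sqr_ge0.
Qed.

(** The bound is [M] itself because the normalized measure has total mass 1. *)
Lemma L2norm_le_bound M f : 0 <= M -> in_L2 D f ->
  (forall x, D x -> normc (f x) <= M) -> L2norm D f <= M.
Proof.
move=> M0 hf fM; rewrite -(@ler_pXn2r _ 2)// ?nnegrE ?L2norm_ge0//.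
have [mr mi fin] := hf.
have I : mu.-integrable D (EFin \o (fun x => normc (f x) ^+ 2)).
  apply/integrable_ge0P => //; last by move=> x _; exact: sqr_ge0.
  under eq_fun do rewrite normc_sqr.
  by apply: measurable_funD; apply: measurable_funX.
rewrite L2norm_sqrE ler_pdivrMl// mulrC -(@Rintegral_cst _ _ _ mu D)//.
apply: le_Rintegral => //.
  apply: measurable_bounded_integrable => //.
  by exists (M ^+ 2); split; [exact: num_real|move=> N MN x _ /=];
    rewrite (le_trans _ (ltW MN))// ger0_norm// sqr_ge0.
by move=> x Dx; rewrite lerXn2r ?nnegrE ?normc_ge0// fM.
Qed.

Lemma in_L2_e l : in_L2 D (e_ l).
Proof.
apply: (@in_L2_bounded 1); [exact: measurable_Re_e|exact: measurable_Im_e|].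
by move=> x _; rewrite normc_e.
Qed.

Lemma inner_e_e l : inner D (e_ l) (e_ l) = 1.
Proof.
rewrite /inner (_ : (fun x => _) = fun=> 1); last first.
  by apply: funext => x; rewrite e_conj_e.
rewrite /cintegral /= !(@Rintegral_cst _ _ _ mu D mD') mul0r mul1r.
by apply: complex_eq; rewrite ?ReM ?ImM /= ?mulr0 ?mul0r ?subr0 ?addr0// mulVf ?gt_eqF.
Qed.

End hilbert.

(** * Fourier coefficients, Bessel's identity and the operator defined by a spectrum *)

Section expansions.
Context {R : realType}.
Notation mu := (@lebesgue_measure R).
Variable D : set R.
Hypothesis mD : measurable D.
Hypothesis Dfin : (mu D < +oo)%E.
Hypothesis Dpos : 0 < length D.
Implicit Types (f g h : R -> R[i]) (c d : R -> R[i]) (Lambda : set R).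

Definition orthogonal_exponentials Lambda : Prop :=
  forall l m : R, Lambda l -> Lambda m -> l != m -> inner D (e_ l) (e_ m) = 0.

Definition coef f l : R[i] := inner D f (e_ l).

Local Notation psum s d := (fun x => \sum_(l <- s) d l * e_ l x).

Lemma in_L2_psum (s : seq R) d : in_L2 D (psum s d).
Proof. by apply: in_L2_sum => // l; apply: in_L2Z => //; exact: in_L2_e. Qed.

Lemma coef_psum Lambda (s : seq R) d l : orthogonal_exponentials Lambda ->
  uniq s -> [set` s] `<=` Lambda -> Lambda l ->
  coef (psum s d) l = if l \in s then d l else 0.
Proof.
move=> oL us sL Ll; rewrite /coef inner_suml//; first last.
- exact: in_L2_e.
- by move=> m; apply: in_L2Z => //; exact: in_L2_e.
rewrite (eq_bigr (fun m => d m * inner D (e_ m) (e_ l))); last first.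
  by move=> m _; rewrite innerZl//; exact: in_L2_e.
case: ifPn => ls.
  rewrite (bigD1_seq l)//= inner_e_e// mulr1 big_seq_cond big1 ?addr0//.
  by move=> m /andP[ms ml]; rewrite oL ?mulr0//; exact: sL.
rewrite big_seq big1// => m ms; rewrite oL ?mulr0//; first exact: sL.
by apply: contraNneq ls => <-.
Qed.

(** By induction on [s]: a new exponential is orthogonal to the previous partial sum, so it only
    sees [coef f l]. The last sum is the loss caused by using [d] instead of the Fourier
    coefficients; [d = coef f] gives Bessel's inequality. *)
Lemma bessel_identity Lambda (s : seq R) f d : orthogonal_exponentials Lambda ->
  uniq s -> [set` s] `<=` Lambda -> in_L2 D f ->
  L2norm D (fun x => f x - psum s d x) ^+ 2 =
  L2norm D f ^+ 2 - \sum_(l <- s) normc (coef f l) ^+ 2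
  + \sum_(l <- s) normc (coef f l - d l) ^+ 2.
Proof.
move=> oL + + hf; elim: s => [_ _|l s IH]; last rewrite cons_uniq => /andP[ls us] sL.
  rewrite !big_nil subr0 addr0; congr (L2norm _ _ ^+ 2).
  by apply: funext => x; rewrite big_nil subr0.
have sL' : [set` s] `<=` Lambda by move=> m ms; apply: sL; rewrite /= inE ms orbT.
have Ll : Lambda l by apply: sL; rewrite /= inE eqxx.
have -> : (fun x => f x - \sum_(m <- l :: s) d m * e_ m x) =
    (fun x => (f x - psum s d x) - d l * e_ l x).
  by apply: funext => x; rewrite big_cons; ring.
have hs := in_L2_psum s d.
have hel := in_L2_e mD Dfin l.
rewrite L2norm_sub_sqr//; last exact: in_L2B.
rewrite innerBl// -/(coef f l) -/(coef (psum s d) l) (coef_psum _ oL)//.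
rewrite (negPf ls) subr0 IH// !big_cons (_ : L2norm D (e_ l) ^+ 2 = 1); last first.
  by rewrite L2norm_Re// inner_e_e.
move: (coef f l) (d l) => p q.
by rewrite !normc_sqr ReM Re_conj Im_conj ReD ImD ReN ImN; ring.
Qed.

Lemma bessel_inequality Lambda (s : seq R) f : orthogonal_exponentials Lambda ->
  uniq s -> [set` s] `<=` Lambda -> in_L2 D f ->
  \sum_(l <- s) normc (coef f l) ^+ 2 <= L2norm D f ^+ 2.
Proof.
move=> oL us sL hf; have := bessel_identity (coef f) oL us sL hf.
rewrite [X in _ + X]big1 ?addr0; last first.
  by move=> l _; rewrite subrr normc0 expr0n.
by move=> E; rewrite -subr_ge0 -E sqr_ge0.
Qed.

Lemma eq_psum (s : seq R) c d x : {in s, c =1 d} -> psum s c x = psum s d x.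
Proof.
by move=> cd /=; rewrite big_seq [RHS]big_seq; apply: eq_bigr => l /cd ->.
Qed.

(** If [c l] differed from [coef f l], every partial sum that contains [l] would stay at distance at
    least [|coef f l - c l|] from [f]. *)
Lemma exp_sum_coef Lambda f c l : orthogonal_exponentials Lambda ->
  in_L2 D f -> exp_sum D Lambda c f -> Lambda l -> c l = coef f l.
Proof.
move=> oL hf fc Ll; apply/eqP; apply: contrapT => /negP cl.
have e0 : 0 < normc (coef f l - c l).
  by rewrite lt_neqAle normc_ge0 andbT eq_sym normc_eq0 subr_eq0 eq_sym.
have [F0 F0L /(_ (l |` F0)%fset)] := fc _ e0.
have FL : [set` (l |` F0)%fset] `<=` Lambda.
  by move=> m /=; rewrite in_fset1U => /orP[/eqP->//|]; exact: F0L.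
move=> /(_ (fsubsetU1 _ _) FL); apply/negP; rewrite -leNgt.
rewrite -(@ler_pXn2r _ 2)// ?nnegrE ?normc_ge0 ?L2norm_ge0//.
have uF := fset_uniq (l |` F0)%fset; set F := (l |` F0)%fset in FL uF *.
have lF : l \in F by exact: fset1U1.
rewrite (bessel_identity _ oL)// [X in _ <= _ + X](bigD1_seq l lF uF)/=.
rewrite addrCA lerDl addr_ge0//; first by rewrite subr_ge0 (bessel_inequality oL).
by apply: sumr_ge0 => m _; exact: sqr_ge0.
Qed.

Lemma eq_exp_sum Lambda f c d : (forall l, Lambda l -> c l = d l) ->
  exp_sum D Lambda c f -> exp_sum D Lambda d f.
Proof.
move=> cd fc e /fc[F0 F0L H]; exists F0 => // F F0F FL.
rewrite (_ : (fun x => _) = (fun x => f x - psum F c x)); first exact: H.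
by apply: funext => x; rewrite -(@eq_psum F c d)// => l lF; exact/cd/FL.
Qed.

Lemma spectrum_exp_sum Lambda f : spectrum D Lambda -> in_L2 D f ->
  exp_sum D Lambda (coef f) f.
Proof.
move=> [oL cL] hf; have [c fc] := cL _ hf.
by apply: (eq_exp_sum _ fc) => l Ll; exact: (exp_sum_coef oL hf fc Ll).
Qed.

(** The Fourier partial sums converge to [f] and are all identically zero. *)
Lemma spectrum_coef0 Lambda f : spectrum D Lambda -> in_L2 D f ->
  (forall l, Lambda l -> coef f l = 0) -> L2norm D f = 0.
Proof.
move=> sL hf f0; apply/le_anti; rewrite L2norm_ge0 andbT.
apply/ler_addgt0Pl => e e0; rewrite addr0.
have [F0 F0L /(_ F0 (fsubset_refl _) F0L)/ltW] :=
  spectrum_exp_sum sL hf e0.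
apply: le_trans; rewrite le_eqVlt; apply/orP; left; apply/eqP; congr (L2norm _ _).
apply: funext => x; rewrite big_seq big1 ?subr0// => l lF.
by rewrite f0 ?mul0r//; exact: F0L.
Qed.

(** The weight [w] is left free so that it can be [|l|^2 |c l|^2]: Bessel's inequality for the image
    under [A_] then yields the summability that its domain requires. *)
Lemma esum_coef_lty Lambda f (w : R -> R) : orthogonal_exponentials Lambda ->
  in_L2 D f -> (forall l, Lambda l -> w l = normc (coef f l) ^+ 2) ->
  (\esum_(l in Lambda) (w l)%:E < +oo)%E.
Proof.
move=> oL hf wE; apply: (@le_lt_trans _ _ (L2norm D f ^+ 2)%:E); last exact: ltry.
apply: ge_ereal_sup => _ [A [finA AL] <-]; rewrite fsbig_finite//= sumEFin lee_fin.
have AL' : [set` fset_set A] `<=` Lambda.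
  by move=> l /=; rewrite in_fset_set// inE; exact: AL.
rewrite big_seq (eq_bigr (fun l => normc (coef f l) ^+ 2)); last first.
  by move=> l lA; rewrite wE//; exact: AL'.
by rewrite -big_seq (bessel_inequality oL) ?fset_uniq.
Qed.

(** Bessel's inequality for [g] supplies the summability, so the domain condition reduces to the
    existence of an L^2 function with coefficients [l * coef f l]. *)
Lemma A_P Lambda f g : spectrum D Lambda ->
  A_ D Lambda f g <-> [/\ in_L2 D f, in_L2 D g &
    forall l, Lambda l -> coef g l = l%:C * coef f l].
Proof.
move=> sL; have oL := sL.1; split => [[hf hg [c [fc _ gc]]]|[hf hg H]]; split => //.
  move=> l Ll; rewrite -(exp_sum_coef oL hg gc Ll).
  by rewrite -(exp_sum_coef oL hf fc Ll).
exists (coef f); split.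
- exact: spectrum_exp_sum.
- apply: (esum_coef_lty oL hg) => l Ll.
  by rewrite H// (normcM l%:C) normc_real exprMn.
- by apply: eq_exp_sum (spectrum_exp_sum sL hg) => l /H.
Qed.

Lemma inner_psum_r (s : seq R) d f : in_L2 D f ->
  inner D f (psum s d) = \sum_(l <- s) (d l)^* * coef f l.
Proof.
move=> hf; rewrite (innerC mD (in_L2_psum s d) hf) inner_suml//; last first.
  by move=> m; apply: in_L2Z => //; exact: in_L2_e.
rewrite rmorph_sum/=; apply: eq_bigr => l _.
have hl := in_L2_e mD Dfin l.
by rewrite innerZl// conj_mul -innerC.
Qed.

(** A substitute for Parseval's series: [f] and [g] are replaced by partial sums over one common
    finite set, where both sides agree by hypothesis, and Cauchy-Schwarz controls the two
    remainders. *)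
Lemma spectrum_inner_eq Lambda f g h k : spectrum D Lambda ->
  in_L2 D f -> in_L2 D g -> in_L2 D h -> in_L2 D k ->
  (forall l, Lambda l -> (coef f l)^* * coef k l = (coef g l)^* * coef h l) ->
  inner D k f = inner D h g.
Proof.
move=> sL hf hg hh hk H; apply/eqP; rewrite -subr_eq0 -normc_eq0.
apply/eqP/le_anti; rewrite normc_ge0 andbT; apply/ler_addgt0Pl => e e0.
(* The added 1 keeps [M] positive when both norms vanish. *)
rewrite addr0; set M := L2norm D k + L2norm D h + 1.
have M0 : 0 < M by rewrite /M ltr_wpDl// addr_ge0// L2norm_ge0.
have eM : 0 < e / M by rewrite divr_gt0.
have [F1 F1L H1] := spectrum_exp_sum sL hf eM.
have [F2 F2L H2] := spectrum_exp_sum sL hg eM.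
pose F := (F1 `|` F2)%fset.
have FL : [set` F] `<=` Lambda.
  by move=> l /=; rewrite in_fsetU => /orP[/F1L|/F2L].
have K1 := H1 F (fsubsetUl _ _) FL; have K2 := H2 F (fsubsetUr _ _) FL.
have hF d : in_L2 D (psum F d) by exact: in_L2_psum.
have E : inner D k f - inner D h g =
    inner D k (fun x => f x - psum F (coef f) x)
    - inner D h (fun x => g x - psum F (coef g) x).
  rewrite !innerBr// !inner_psum_r//.
  rewrite (_ : \sum_(l <- F) (coef f l)^* * coef k l =
               \sum_(l <- F) (coef g l)^* * coef h l); first by ring.
  by rewrite big_seq [RHS]big_seq; apply: eq_bigr => l /FL/H.
rewrite E; apply: le_trans (le_normcD _ _) _; rewrite normcN.
apply: (@le_trans _ _ (L2norm D k * (e / M) + L2norm D h * (e / M))).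
  have CS1 := CauchySchwarz mD Dpos hk (in_L2B mD hf (hF (coef f))).
  have CS2 := CauchySchwarz mD Dpos hh (in_L2B mD hg (hF (coef g))).
  have X1 := ler_wpM2l (L2norm_ge0 D k) (ltW K1).
  have X2 := ler_wpM2l (L2norm_ge0 D h) (ltW K2).
  apply: lerD.
    exact: (le_trans CS1 X1).
  exact: (le_trans CS2 X2).
by rewrite -mulrDl mulrA ler_pdivrMr// mulrC ler_pM2l// /M lerDl.
Qed.

Lemma A_symmetric Lambda f g h k : spectrum D Lambda ->
  A_ D Lambda f g -> A_ D Lambda h k -> inner D k f = inner D h g.
Proof.
move=> sL /(A_P _ _ sL)[hf hg fg] /(A_P _ _ sL)[hh hk hk'].
apply: (spectrum_inner_eq sL) => // l Ll.
by rewrite fg// hk'// conj_mul conj_realC; ring.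
Qed.

Lemma A_e Lambda l : spectrum D Lambda -> Lambda l ->
  A_ D Lambda (e_ l) (fun x => l%:C * e_ l x).
Proof.
move=> sL Ll; have hl := in_L2_e mD Dfin l.
apply/(A_P _ _ sL); split => //; first exact: in_L2Z.
move=> m Lm; rewrite /coef innerZl//; last exact: in_L2_e.
have [->//|lm] := eqVneq l m.
by rewrite sL.1// !mulr0.
Qed.

(** Finite partial sums lie in the domain, which gives density. For the adjoint, testing against the
    single functions [e_ l] already forces [coef g l = l * coef f l], and this is membership by
    [A_P]. *)
Lemma A_selfadjoint Lambda : spectrum D Lambda ->
  selfadjoint D (A_ D Lambda).
Proof.
move=> sL; split.
  move=> f hf e e0.
  have [F FL /(_ F (fsubset_refl _) FL) He] := spectrum_exp_sum sL hf e0.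
  exists (psum F (coef f)), (psum F (fun l => l%:C * coef f l)); split => //.
  apply/(A_P _ _ sL); split; [exact: in_L2_psum|exact: in_L2_psum|].
  move=> l Ll; rewrite !(coef_psum _ sL.1 (fset_uniq F))//.
  by case: ifP; rewrite ?mulr0.
move=> f g; split => [Afg|[hf hg H]].
  by have [hf hg _] := Afg; split => // h k Ahk; exact: A_symmetric Afg Ahk.
apply/(A_P _ _ sL); split => // l Ll.
have hl := in_L2_e mD Dfin l.
have := H _ _ (A_e sL Ll); rewrite innerZl// /coef => E.
by rewrite (innerC mD hl hg) -E conj_mul conj_realC -innerC.
Qed.

End expansions.

(** * Absolutely continuous functions *)

Section absolute_continuity.
Context {R : realType}.
Notation mu := (@lebesgue_measure R).
Implicit Types (a b c x y : R) (u v : R -> R).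

Definition real_abs_continuous a b u : Prop :=
  forall eps : R, 0 < eps -> exists2 delta : R, 0 < delta &
  forall (k : nat) (s t : 'I_k -> R),
    (forall i, a < s i /\ s i <= t i /\ t i < b) ->
    (forall i j, i != j -> t i <= s j \/ t j <= s i) ->
    \sum_i (t i - s i) < delta ->
    \sum_i `|u (t i) - u (s i)| < eps.

Lemma le_lebesgue (A B : set R) : measurable A -> measurable B ->
  A `<=` B -> (mu A <= mu B)%E.
Proof. by move=> mA mB AB; apply: le_measure; rewrite ?inE. Qed.

Lemma is_derive0_near u x (e : R) : 0 < e -> is_derive x 1 u 0 ->
  exists2 r, 0 < r & forall y, `|y - x| < r -> `|u y - u x| <= e * `|y - x|.
Proof.
move=> e0 [du Du].
have : (h^-1 * (u (h + x) - u x)) @[h --> 0^'] --> (0 : R).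
  have := du; rewrite /derivable => /cvgP; have := Du; rewrite /derive => ->.
  apply: cvg_trans; apply: near_eq_cvg; near=> h.
  by rewrite /= /GRing.scale /= mulr1.
move/cvgrPdist_le => /(_ _ e0); rewrite near_withinE => /nbhs_ballP[r /= r0 H].
exists r => // y yx; have [->|yx0] := eqVneq y x.
  by rewrite !subrr normr0 mulr0.
have := H (y - x); rewrite /ball/= sub0r normrN => /(_ yx).
rewrite subr_eq0 => /(_ yx0); rewrite sub0r normrN subrK normrM normfV.
by rewrite mulrC ler_pdivrMr// normr_gt0 subr_eq0.
Unshelve. all: by end_near. Qed.

(* Continuous induction along [c, d]: near a point where the derivative
   vanishes u moves at most at rate e, near any other point one stays inside an
   open set U of small measure, where absolute continuity applies. *)
Lemma real_abs_continuous_const a b u : real_abs_continuous a b u ->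
  {ae mu, forall x, a < x < b -> is_derive x 1 u 0} ->
  forall c d, a < c -> c <= d -> d < b -> u d = u c.
Proof.
move=> acu [N [mN N0 subN]] c d ac cd db.
suff H e : 0 < e -> `|u d - u c| <= e * (d - c) + e.
  apply/eqP; rewrite -subr_eq0 -normr_eq0 eq_le normr_ge0 andbT.
  apply/ler_addgt0Pl => e e0; rewrite addr0.
  have d1 : 0 < d - c + 1 by rewrite ltr_wpDl ?subr_ge0.
  have := H (e / (d - c + 1)); rewrite divr_gt0// => /(_ isT).
  suff -> : e / (d - c + 1) * (d - c) + e / (d - c + 1) = e by [].
  by field; rewrite gt_eqF.
move=> e0; have [delta delta0 acd] := acu _ e0.
have [U [oU NU]] : exists U, [/\ open U, N `<=` U & (mu U < delta%:E)%E].
  have Nfin : (mu N < +oo)%E by rewrite N0 ltry.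
  have [U [oU NU UN]] := @lebesgue_regularity_outer R N delta mN Nfin delta0.
  exists U; split => //; rewrite -(setDUK NU); apply: le_lt_trans UN.
  have mUN : measurable (U `\` N).
    by apply: measurableD => //; exact: open_measurable.
  have : (mu (N `|` (U `\` N)) <= mu N + mu (U `\` N))%E by exact: measureU2.
  by rewrite N0 add0e.
have mU : measurable U by exact: open_measurable.
(* [m x] is the budget of bad length available up to [x]: it grows by at least [y - x] whenever
   [[x, y]] lies in [U], and it never reaches [delta]. *)
move=> Udelta; pose m x := fine (mu (U `&` `[c, x])).
have mUc x : measurable (U `&` `[c, x]) by exact: measurableI.
have mfin x : mu (U `&` `[c, x]) \is a fin_num.
  rewrite ge0_fin_numE//; apply: (@le_lt_trans _ _ (mu U)).
    by apply: le_lebesgue => //; exact: subIsetl.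
  by rewrite (lt_trans Udelta)// ltry.
have m_le x y : x <= y -> m x <= m y.
  move=> xy; apply: fine_le => //; apply: le_lebesgue => //.
  by apply: setIS; apply: subset_itvl; rewrite bnd_simp.
have m_add x y : c <= x -> x <= y -> `[x, y] `<=` U -> m x + (y - x) <= m y.
  move=> cx xy xyU; rewrite -lee_fin EFinD !fineK//.
  have Ixy : mu `]x, y] = (y - x)%:E.
    rewrite lebesgue_measure_itv/= lte_fin; case: ltP => // yx.
    by rewrite (@le_anti _ _ x y) ?subrr// xy yx.
  have dis : (U `&` `[c, x]) `&` `]x, y] = set0.
    apply/seteqP; split => // z [[_ /=]]; rewrite !in_itv/= => /andP[_ zx].
    by move=> /andP[xz _]; move: (lt_le_trans xz zx); rewrite ltxx.
  have -> : (mu (U `&` `[c, x]) + (y - x)%:E = mu ((U `&` `[c, x]) `|` `]x, y]))%E.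
    rewrite -Ixy; apply/esym; apply: measureU.
    - exact: mUc.
    - exact: measurable_itv.
    - exact: dis.
  apply: le_lebesgue => //; first exact: measurableU.
  move=> z [[Uz]|]; rewrite /= !in_itv/=.
    by move=> /andP[-> zx]; split => //; exact: le_trans zx xy.
  move=> /andP[xz zy]; split; last by rewrite zy (le_trans cx)// ltW.
  by apply: xyU; rewrite /= in_itv/= (ltW xz).
have m_lt x : m x < delta.
  rewrite -lte_fin fineK//; apply: le_lt_trans Udelta.
  by apply: le_lebesgue => //; exact: subIsetl.
(* [P x] records the bad intervals used up to [x], non-overlapping and with total length charged to
   the budget. At [x = d] this total is below [delta], so absolute continuity bounds their
   increments by [e]. *)
pose P x := exists k (s t : 'I_k -> R),
  [/\ forall i, c <= s i /\ s i <= t i /\ t i <= x,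
      forall i j, i != j -> t i <= s j \/ t j <= s i,
      \sum_i (t i - s i) <= m x &
      `|u x - u c| <= e * (x - c) + \sum_i `|u (t i) - u (s i)| ].
have Pc : P c.
  exists 0%N, (fun=> 0), (fun=> 0); split; [by case|by case| |].
    by rewrite big_ord0 fine_ge0.
  by rewrite big_ord0 !subrr normr0 mulr0 addr0.
have step_good x y : c <= x -> x <= y -> `|u y - u x| <= e * (y - x) -> P x -> P y.
  move=> cx xy uxy [k [s [t [H1 H2 H3 H4]]]]; exists k, s, t; split => //.
  - by move=> i; have [? [? ?]] := H1 i; split => //; split => //; exact: le_trans xy.
  - exact: le_trans (m_le _ _ xy).
  - by have := ler_normD (u y - u x) (u x - u c); rewrite addrA subrK; lra.
have step_bad x y : c <= x -> x <= y -> `[x, y] `<=` U -> P x -> P y.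
  move=> cx xy xyU [k [s [t [H1 H2 H3 H4]]]].
  exists k.+1, (fun i => oapp s x (unlift ord0 i)), (fun i => oapp t y (unlift ord0 i)).
  split.
  - move=> i; case: unliftP => [j _|_]/=; last by split => //; split.
    by have [? [? ?]] := H1 j; split => //; split => //; exact: le_trans xy.
  - move=> i j; case: (unliftP ord0 i) => [i' ->|->];
      case: (unliftP ord0 j) => [j' ->|->]//=.
    + by rewrite (inj_eq lift_inj); exact: H2.
    + by move=> _; left; have [_ []] := H1 i'.
    + by move=> _; right; have [_ []] := H1 j'.
  - rewrite big_ord_recl unlift_none/=.
    under eq_bigr do rewrite liftK /=.
    by have := m_add _ _ cx xy xyU; lra.
  - rewrite big_ord_recl unlift_none/=.
    under eq_bigr do rewrite liftK /=.
    have := ler_normD (u y - u x) (u x - u c); rewrite addrA subrK.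
    have : 0 <= e * (y - x) by rewrite mulr_ge0 ?subr_ge0// ltW.
    lra.
(* The step jumps across [x], from any [x'] before it to any [y] after it: at a supremum, [P] is
   known only at nearby smaller points. *)
have gauge x : c <= x <= d -> exists2 r, 0 < r &
    forall x' y, x - r < x' -> x' <= x -> x <= y -> y < x + r ->
    c <= x' -> P x' -> P y.
  move=> /andP[cx xd]; have [Nx|Nx] := pselect (N x).
    have /nbhs_ballP[r /= r0 rU] : nbhs x U by apply: open_nbhs_nbhs; split => //; exact: NU.
    exists r => // x' y rx' x'x xy yr cx'; apply: step_bad => //; first exact: le_trans xy.
    move=> z; rewrite /= in_itv/= => /andP[x'z zy]; apply: rU.
    by rewrite /ball/= ltr_norml; apply/andP; split; lra.
  have dux : is_derive x 1 u 0.
    apply: contrapT => ndu; apply: Nx; apply: subN => /= /(_ _)/ndu; apply.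
    by rewrite (lt_le_trans ac)// (le_lt_trans xd).
  have [r r0 Hr] := is_derive0_near e0 dux.
  exists r => // x' y rx' x'x xy yr cx'; apply: step_good => //; first exact: le_trans xy.
  have := Hr x'; have := Hr y; rewrite !ltr_norml => Hy Hx'.
  have /Hy{Hy} : - r < y - x < r by apply/andP; split; lra.
  have /Hx'{Hx'} : - r < x' - x < r by apply/andP; split; lra.
  rewrite (ger0_norm (_ : 0 <= y - x)) ?subr_ge0//.
  rewrite (ler0_norm (_ : x' - x <= 0)) ?subr_le0//.
  have := ler_normB (u y - u x) (u x' - u x).
  rewrite (_ : _ - _ - (_ - _) = u y - u x'); last by ring.
  lra.
pose S := [set x | c <= x <= d /\ P x].
have Sc : S c by split => //; rewrite lexx.
have hS : has_sup S by split; [exists c|exists d => x [/andP[]]].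
have cs : c <= sup S by apply: ub_le_sup => //; exact: hS.2.
have sd : sup S <= d by apply: ge_sup; [exists c|move=> x [/andP[]]].
have [|r r0 G] := gauge (sup S); first by rewrite cs.
have [x' [/andP[cx' x'd] Px'] rx'] := sup_adherent r0 hS.
have x's : x' <= sup S.
  by apply: ub_le_sup; [exact: hS.2|split => //; rewrite cx'].
pose y := Num.min (sup S + r / 2) d.
have r20 : 0 < r / 2 by rewrite divr_gt0.
have sy : sup S <= y by rewrite le_min sd andbT lerDl ltW.
have Py : P y.
  by apply: G Px' => //; rewrite gt_min; apply/orP; left; lra.
have : y <= sup S.
  apply: ub_le_sup; [exact: hS.2|split => //].
  by rewrite (le_trans cs sy) ge_min lexx orbT.
rewrite ge_min => /orP[|ds]; first by lra.
have yd : y = d by apply/min_idPr; lra.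
have [k [s [t [H1 H2 H3 H4]]]] := Py; rewrite yd in H1 H3 H4.
apply: (le_trans H4); rewrite lerD2l ltW// acd//.
  move=> i; have [? [? ?]] := H1 i; split; first exact: lt_le_trans ac _.
  by split => //; exact: le_lt_trans db.
exact: le_lt_trans (m_lt d).
Qed.

Section primitive.
Variable f : R -> R.
Hypothesis intf : mu.-integrable setT (EFin \o f).

Let prim x := \int[mu]_(t in `]-oo, x]) f t.

Let intfS (A : set R) : measurable A -> mu.-integrable A (EFin \o f).
Proof. by move=> mA; apply: integrableS intf. Qed.

Lemma primitiveB x y : x <= y -> prim y - prim x = \int[mu]_(t in `]x, y]) f t.
Proof.
move=> xy; apply: Rintegral_itvB; first exact: intfS.
  by rewrite bnd_simp.
by rewrite bnd_simp.
Qed.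

Lemma primitive_abs_continuous a b : real_abs_continuous a b prim.
Proof.
move=> e e0; have [d [d0 Hd]] := integral_normr_continuous intf e0.
exists d => // k s t st dis sd.
pose A i := `]s i, t i]%classic.
have mA i : measurable (A i) by exact: measurable_itv.
have muA i : mu (A i) = (t i - s i)%:E.
  rewrite /A lebesgue_measure_itv/= lte_fin; case: ltP => // ts.
  by have [_ [st' _]] := st i; rewrite (@le_anti _ _ (s i) (t i)) ?subrr// st' ts.
have tA : trivIset setT A.
  apply/trivIsetP => i j _ _ ij; apply/seteqP; split => // z []; rewrite /A /= !in_itv/=.
  move=> /andP[sz zt] /andP[sz' zt'].
  by have [] := dis i j ij; lra.
pose B := \big[setU/set0]_(i < k) A i.
have mB : measurable B by exact: bigsetU_measurable.
have muB : (mu B < d%:E)%E.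
  rewrite (_ : mu B = (\sum_i (t i - s i))%:E) ?lte_fin//.
  rewrite -sumEFin -(eq_bigr _ (fun i _ => muA i)).
  exact: (@measure_bigsetU_ord _ _ _ mu k xpredT A mA tA).
apply: le_lt_trans (Hd B mB muB).
have fA i : mu.-integrable (A i) (EFin \o (fun x => `|f x|)).
  exact: (integrable_abse (intfS (mA i))).
have fB : mu.-integrable B (EFin \o (fun x => `|f x|)).
  exact: (integrable_abse (intfS mB)).
rewrite -lee_fin -sumEFin [leRHS]fineK; last exact: integrable_fin_num fB.
have -> : (\int[mu]_(x in B) `|f x|%:E = \sum_(i < k) \int[mu]_(x in A i) `|f x|%:E)%E.
  apply: (@integral_bigsetU_EFin _ _ _ mu _ A (fun x => `|f x|)) => //.
  - exact: index_enum_uniq.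
  - exact: sub_trivIset tA.
  - exact: (measurable_int _ fB).
apply: lee_sum => i _; have [_ [st' _]] := st i.
rewrite primitiveB// -[leRHS]fineK; last exact: (@integrable_fin_num _ _ _ mu _ (mA i) _ (fA i)).
by rewrite lee_fin; apply: le_normr_Rintegral => //; exact: intfS.
Qed.

Lemma primitive_is_derive : {ae mu, forall x, is_derive x 1 prim (f x)}.
Proof.
have loc : locally_integrable setT f.
  have := integrable_locally (@measurableT _ R) intf.
  by rewrite patch_setT.
have := FTC1Ny (fun y => intfS (measurable_itv `]-oo, y])) loc.
apply: ae_mono => x [dx Dx]; apply: DeriveDef => //.
by rewrite -derive1E Dx.
Qed.

End primitive.

Lemma real_abs_continuousB a b u v : real_abs_continuous a b u ->
  real_abs_continuous a b v -> real_abs_continuous a b (fun x => u x - v x).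
Proof.
move=> hu hv e e0; have e20 : 0 < e / 2 by rewrite divr_gt0.
have [d1 d10 H1] := hu _ e20; have [d2 d20 H2] := hv _ e20.
exists (Num.min d1 d2); first by rewrite lt_min d10.
move=> k s t st dis; rewrite lt_min => /andP[sd1 sd2].
rewrite (splitr e); apply: le_lt_trans (ltrD (H1 _ _ _ st dis sd1) (H2 _ _ _ st dis sd2)).
rewrite -big_split/=; apply: ler_sum => i _.
have -> : u (t i) - v (t i) - (u (s i) - v (s i)) =
  (u (t i) - u (s i)) - (v (t i) - v (s i)) by ring.
exact: ler_normB.
Qed.

(** Subtracting the primitive of the zero extension of [v] leaves an absolutely continuous function
    with derivative 0 almost everywhere, which is constant. *)
Lemma real_abs_continuous_FTC a b u v : real_abs_continuous a b u ->
  mu.-integrable `]a, b[ (EFin \o v) ->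
  {ae mu, forall x, a < x < b -> is_derive x 1 u (v x)} ->
  forall c d, a < c -> c <= d -> d < b ->
  u d - u c = \int[mu]_(t in `]c, d]) v t.
Proof.
move=> acu iv du c d ac cd db.
pose w := v \_ `]a, b[.
have iw : mu.-integrable setT (EFin \o w).
  by rewrite -restrict_EFin; apply/integrable_restrict => //; rewrite setTI.
pose F x := \int[mu]_(t in `]-oo, x]) w t.
have acH : real_abs_continuous a b (fun x => u x - F x).
  by apply: real_abs_continuousB => //; exact: primitive_abs_continuous.
have dH : {ae mu, forall x, a < x < b -> is_derive x 1 (fun x => u x - F x) 0}.
  have := ae_and du (primitive_is_derive iw).
  apply: ae_mono => x [] /[swap] dF /[swap] axb /(_ axb) dux.
  have -> : 0 = v x - w x.
    by rewrite /w patchE mem_set ?subrr//= in_itv.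
  exact: is_deriveB.
have /= H := real_abs_continuous_const acH dH ac cd db.
have : u d - u c = F d - F c by lra.
move=> ->; rewrite primitiveB//; apply: eq_Rintegral => x.
rewrite inE/= in_itv/= => /andP[cx xd].
by rewrite /w patchE mem_set//= in_itv/= (lt_trans ac cx) (le_lt_trans xd db).
Qed.

End absolute_continuity.

(** * Limits at the endpoints, and closure properties of absolute continuity *)

Section absolute_continuity_interval.
Context {R : realType}.
Notation mu := (@lebesgue_measure R).
Implicit Types (a b c x y : R) (u v : R -> R).

Lemma real_abs_continuous_uniform a b u : real_abs_continuous a b u ->
  forall e, 0 < e -> exists2 d, 0 < d & forall x y, a < x -> x <= y -> y < b ->
  y - x < d -> `|u y - u x| < e.
Proof.
move=> acu e /acu[d d0 H]; exists d => // x y ax xy yb xyd.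
have := H 1%N (fun=> x) (fun=> y); rewrite !big_ord1; apply => //.
by move=> i j; rewrite !ord1 eqxx.
Qed.

Lemma real_abs_continuous_continuous a b u : real_abs_continuous a b u ->
  {in `]a, b[, continuous u}.
Proof.
move=> /real_abs_continuous_uniform acu x; rewrite in_itv/= => /andP[ax xb].
apply/cvgrPdist_lt => e /acu[d d0 H]; near=> y.
have ay : a < y by near: y; exact: lt_nbhsr.
have yb : y < b by near: y; exact: lt_nbhsl.
have yx : `|x - y| < d by near: y; apply: cvgr_dist_lt => //; exact: cvg_id.
have [xy|yx'] := leP x y.
  by rewrite distrC; apply: H => //; move: yx; rewrite ltr_norml; lra.
by apply: H => //; [exact: ltW|move: yx; rewrite ltr_norml; lra].
Unshelve. all: by end_near. Qed.

Lemma primitive_continuous u : mu.-integrable setT (EFin \o u) ->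
  continuous (fun x => \int[mu]_(t in `]-oo, x]) u t).
Proof.
move=> iu x; apply: (real_abs_continuous_continuous
  (@primitive_abs_continuous _ _ iu (x - 1) (x + 1))).
by rewrite in_itv/=; apply/andP; split; lra.
Qed.

(** On []a, b[] the function differs by a constant from the primitive of the zero extension of [v],
    which is continuous on the whole line; the end limits are its values there. The midpoint [m]
    only fixes the constant. *)
Lemma real_abs_continuous_ends a b u v : a < b -> real_abs_continuous a b u ->
  mu.-integrable `]a, b[ (EFin \o v) ->
  {ae mu, forall x, a < x < b -> is_derive x 1 u (v x)} ->
  exists la lb, [/\ u x @[x --> a^'+] --> la, u x @[x --> b^'-] --> lb,
    lb - la = \int[mu]_(t in `]a, b[) v t &
    forall x, a < x < b -> u x - la = \int[mu]_(t in `]a, x]) v t].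
Proof.
move=> ab acu iv du; pose w := v \_ `]a, b[.
have iw : mu.-integrable setT (EFin \o w).
  by rewrite -restrict_EFin; apply/integrable_restrict => //; rewrite setTI.
pose F x := \int[mu]_(t in `]-oo, x]) w t.
have cF : continuous F by exact: primitive_continuous.
have FE x y : a <= x -> x <= y -> y <= b -> F y - F x = \int[mu]_(t in `]x, y[) v t.
  move=> ax xy yb; rewrite primitiveB//.
  rewrite -Rintegral_itv_bndo_bndc; last exact: integrableS iw.
  apply: eq_Rintegral => t; rewrite inE/= in_itv/= => /andP[xt ty].
  by rewrite /w patchE mem_set//= in_itv/= (le_lt_trans ax xt) (lt_le_trans ty yb).
have oc x y : a <= x -> x <= y -> y < b ->
    \int[mu]_(t in `]x, y[) v t = \int[mu]_(t in `]x, y]) v t.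
  move=> ax xy yb; rewrite Rintegral_itv_bndo_bndc//.
  apply: integrableS iv => // t; rewrite /= !in_itv/= => /andP[xt ty].
  by rewrite (le_lt_trans ax xt) (lt_trans ty yb).
pose m := (a + b) / 2; have [am mb] : a < m /\ m < b by rewrite /m; split; lra.
have uE x : a < x < b -> u x = F x + (u m - F m).
  move=> /andP[ax xb]; have [xm|/ltW mx] := leP x m.
    have := real_abs_continuous_FTC acu iv du ax xm mb.
    by rewrite -oc ?(ltW ax)// -FE ?(ltW ax) ?(ltW mb)//; lra.
  have := real_abs_continuous_FTC acu iv du am mx xb.
  by rewrite -oc ?(ltW am)// -FE ?(ltW am) ?(ltW xb)//; lra.
exists (F a + (u m - F m)), (F b + (u m - F m)); split.
- have : F x + (u m - F m) @[x --> a^'+] --> F a + (u m - F m).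
    by apply: cvgD; [exact/cvg_at_right_filter/cF|exact: cvg_cst].
  apply: cvg_trans; apply: near_eq_cvg; near=> x; rewrite /= (uE x)//.
  by apply/andP; split => //; near: x; exact: nbhs_right_lt.
- have : F x + (u m - F m) @[x --> b^'-] --> F b + (u m - F m).
    by apply: cvgD; [exact/cvg_at_left_filter/cF|exact: cvg_cst].
  apply: cvg_trans; apply: near_eq_cvg; near=> x; rewrite /= (uE x)//.
  by apply/andP; split => //; near: x; exact: nbhs_left_gt.
- by rewrite -FE ?(ltW ab)//; lra.
- move=> x /andP[ax xb]; rewrite -oc ?(ltW ax)// -FE ?(ltW ax) ?(ltW xb)//.
  by rewrite uE ?ax//; lra.
Unshelve. all: by end_near. Qed.

Lemma real_abs_continuous_cst a b c : real_abs_continuous a b (fun=> c).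
Proof.
move=> e e0; exists 1 => // k s t _ _ _.
by under eq_bigr do rewrite subrr normr0; rewrite big1_eq.
Qed.

Lemma real_abs_continuousM a b u v (M : R) : 0 < M ->
  (forall x, a < x < b -> `|u x| <= M) -> (forall x, a < x < b -> `|v x| <= M) ->
  real_abs_continuous a b u -> real_abs_continuous a b v ->
  real_abs_continuous a b (fun x => u x * v x).
Proof.
move=> M0 uM vM hu hv e e0.
have e20 : 0 < e / 2 / M by rewrite !divr_gt0.
have [d1 d10 H1] := hu _ e20; have [d2 d20 H2] := hv _ e20.
exists (Num.min d1 d2); first by rewrite lt_min d10.
move=> k s t st dis; rewrite lt_min => /andP[sd1 sd2].
have -> : e = M * (e / 2 / M + e / 2 / M) by field; rewrite gt_eqF.
apply: (@le_lt_trans _ _ (M * (\sum_i `|u (t i) - u (s i)| +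
    \sum_i `|v (t i) - v (s i)|))); last first.
  by rewrite ltr_pM2l// ltrD ?H1 ?H2.
rewrite -big_split/= mulr_sumr; apply: ler_sum => i _.
have [as_ [st' tb]] := st i.
have -> : u (t i) * v (t i) - u (s i) * v (s i) =
    (u (t i) - u (s i)) * v (t i) + u (s i) * (v (t i) - v (s i)) by ring.
apply: (le_trans (ler_normD _ _)); rewrite !normrM mulrDr.
rewrite [X in X + _ <= _]mulrC lerD// ler_wpM2r//; [apply: vM|apply: uM].
  by rewrite tb (lt_le_trans as_).
by rewrite as_ (le_lt_trans st').
Qed.

Lemma real_abs_continuousD a b u v : real_abs_continuous a b u ->
  real_abs_continuous a b v -> real_abs_continuous a b (fun x => u x + v x).
Proof.
move=> hu hv; have := real_abs_continuousB (real_abs_continuous_cst a b 0) hv.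
move=> /(real_abs_continuousB hu).
by under [X in real_abs_continuous _ _ X]eq_fun do rewrite sub0r opprK.
Qed.

Lemma real_abs_continuous_lipschitz a b u v (M : R) : 0 < M ->
  (forall x, a < x < b -> is_derive x 1 u (v x)) ->
  (forall x, a < x < b -> `|v x| <= M) -> real_abs_continuous a b u.
Proof.
move=> M0 du vM e e0; exists (e / M); first by rewrite divr_gt0.
move=> k s t st dis; rewrite ltr_pdivlMr// => /(le_lt_trans _); apply.
rewrite mulr_suml; apply: ler_sum => i _; have [as_ [st' tb]] := st i.
move: st'; rewrite le_eqVlt => /predU1P[->|st']; first by rewrite !subrr normr0 mul0r.
have inab x : s i <= x <= t i -> a < x < b.
  by move=> /andP[sx xt]; rewrite (lt_le_trans as_ sx) (le_lt_trans xt tb).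
have [x| |x sxt ->] := @MVT R u v (s i) (t i) st'.
- by rewrite in_itv/= => /andP[sx xt]; apply/du/inab; rewrite !ltW.
- apply: continuous_in_subspaceT => x; rewrite inE/= in_itv/= => sxt.
  apply/differentiable_continuous/derivable1_diffP.
  exact: (@ex_derive _ _ _ _ _ _ _ (du _ (inab _ sxt))).
- rewrite normrM (gtr0_norm (_ : 0 < t i - s i)) ?subr_gt0// mulrC ler_wpM2l//.
    by rewrite subr_ge0 ltW.
  by apply/vM/inab; move: sxt; rewrite in_itv/= => /andP[? ?]; rewrite !ltW.
Qed.

Lemma eq_real_abs_continuous a b u v : (forall x, a < x < b -> u x = v x) ->
  real_abs_continuous a b u -> real_abs_continuous a b v.
Proof.
move=> uv acu e /acu[d d0 H]; exists d => // k s t st dis sd.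
rewrite (eq_bigr (fun i => `|u (t i) - u (s i)|)); first exact: H.
move=> i _; have [as_ [st' tb]] := st i.
by rewrite !uv// ?as_ ?tb ?(lt_le_trans as_ st') ?(le_lt_trans st' tb).
Qed.

Lemma abs_continuousP a b (f : R -> R[i]) : abs_continuous a b f <->
  real_abs_continuous a b (fun x => complex.Re (f x)) /\
  real_abs_continuous a b (fun x => complex.Im (f x)).
Proof.
split=> [acf|[acr aci]].
  split=> e /acf[d d0 H]; exists d => // k s t st dis sd;
    apply: le_lt_trans (H k s t st dis sd); apply: ler_sum => i _.
    by rewrite -ReN -ReD normc_Re.
  by rewrite -ImN -ImD normc_Im.
move=> e e0; have e20 : 0 < e / 2 by rewrite divr_gt0.
have [d1 d10 H1] := acr _ e20; have [d2 d20 H2] := aci _ e20.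
exists (Num.min d1 d2); first by rewrite lt_min d10.
move=> k s t st dis; rewrite lt_min => /andP[sd1 sd2].
rewrite (splitr e); apply: le_lt_trans (ltrD (H1 _ _ _ st dis sd1) (H2 _ _ _ st dis sd2)).
rewrite -big_split/=; apply: ler_sum => i _.
by rewrite (le_trans (normc_le_ReIm _))// ReD ImD ReN ImN.
Qed.

End absolute_continuity_interval.

(** * Complex functions on one interval: boundary limits and Green's formula *)

Section complex_interval.
Context {R : realType}.
Notation mu := (@lebesgue_measure R).
Implicit Types (a b x y : R) (f g h k dh dk : R -> R[i]) (l m : R[i]).

(** [right_limit] is built from [lim], which has a value even without convergence; this predicate,
    like its left counterpart, carries the convergence needed to compute with it. *)
Definition cvg_right h a l : Prop :=
  complex.Re (h x) @[x --> a^'+] --> complex.Re l /\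
  complex.Im (h x) @[x --> a^'+] --> complex.Im l.

Definition cvg_left h a l : Prop :=
  complex.Re (h x) @[x --> a^'-] --> complex.Re l /\
  complex.Im (h x) @[x --> a^'-] --> complex.Im l.

Lemma cvg_rightE h a l : cvg_right h a l -> right_limit h a = l.
Proof.
by move=> [hr hi]; rewrite /right_limit; apply: complex_eq => /=; exact/cvg_lim.
Qed.

Lemma cvg_leftE h a l : cvg_left h a l -> left_limit h a = l.
Proof.
by move=> [hr hi]; rewrite /left_limit; apply: complex_eq => /=; exact/cvg_lim.
Qed.

Lemma cvg_rightMJ h k a l m : cvg_right h a l -> cvg_right k a m ->
  cvg_right (fun x => h x * (k x)^*) a (l * m^*).
Proof.
move=> [hr hi] [kr ki]; split.
  rewrite ReM Re_conj Im_conj; under eq_fun do rewrite ReM Re_conj Im_conj.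
  by apply: cvgB; apply: cvgM => //; exact: cvgN.
rewrite ImM Re_conj Im_conj; under eq_fun do rewrite ImM Re_conj Im_conj.
by apply: cvgD; apply: cvgM => //; exact: cvgN.
Qed.

Lemma cvg_leftMJ h k a l m : cvg_left h a l -> cvg_left k a m ->
  cvg_left (fun x => h x * (k x)^*) a (l * m^*).
Proof.
move=> [hr hi] [kr ki]; split.
  rewrite ReM Re_conj Im_conj; under eq_fun do rewrite ReM Re_conj Im_conj.
  by apply: cvgB; apply: cvgM => //; exact: cvgN.
rewrite ImM Re_conj Im_conj; under eq_fun do rewrite ImM Re_conj Im_conj.
by apply: cvgD; apply: cvgM => //; exact: cvgN.
Qed.

Lemma eq_cvg_right a b h k l : a < b -> (forall x, a < x < b -> h x = k x) ->
  cvg_right h a l -> cvg_right k a l.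
Proof.
move=> ab hk [hr hi]; split; [move: hr|move: hi];
  apply: cvg_trans; apply: near_eq_cvg; near=> x; rewrite /= hk//;
  by apply/andP; split; near: x; [exact: nbhs_right_gt|exact: nbhs_right_lt].
Unshelve. all: by end_near. Qed.

Lemma eq_cvg_left a b h k l : a < b -> (forall x, a < x < b -> h x = k x) ->
  cvg_left h b l -> cvg_left k b l.
Proof.
move=> ab hk [hr hi]; split; [move: hr|move: hi];
  apply: cvg_trans; apply: near_eq_cvg; near=> x; rewrite /= hk//;
  by apply/andP; split; near: x; [exact: nbhs_left_gt|exact: nbhs_left_lt].
Unshelve. all: by end_near. Qed.

Lemma interval_FTC a b h dh : a < b -> abs_continuous a b h ->
  is_derivative_ae `]a, b[ h dh -> cintegrable `]a, b[ dh ->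
  [/\ cvg_right h a (right_limit h a), cvg_left h b (left_limit h b),
    left_limit h b - right_limit h a = cintegral `]a, b[ dh &
    forall x, a < x < b -> h x - right_limit h a = cintegral `]a, x] dh].
Proof.
move=> ab /abs_continuousP[acr aci] dhP [ir ii].
have dr : {ae mu, forall x, a < x < b ->
    is_derive x 1 (fun y => complex.Re (h y)) (complex.Re (dh x))}.
  by apply: ae_mono dhP => x /= + axb; rewrite in_itv/= axb => -[].
have di : {ae mu, forall x, a < x < b ->
    is_derive x 1 (fun y => complex.Im (h y)) (complex.Im (dh x))}.
  by apply: ae_mono dhP => x /= + axb; rewrite in_itv/= axb => -[].
have [ra [rb [r1 r2 r3 r4]]] := real_abs_continuous_ends ab acr ir dr.
have [ia [ib [i1 i2 i3 i4]]] := real_abs_continuous_ends ab aci ii di.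
have hr : cvg_right h a (ra +i* ia) by [].
have hl : cvg_left h b (rb +i* ib) by [].
rewrite (cvg_rightE hr) (cvg_leftE hl); split => //.
  by rewrite /cintegral -r3 -i3.
move=> x axb; rewrite /cintegral -r4// -i4//.
by apply: complex_eq; rewrite ?ReD ?ReN ?ImD ?ImN.
Qed.

Lemma Rintegral_subset (A B : set R) (u : R -> R) : measurable A -> measurable B ->
  A `<=` B -> (forall x, B x -> 0 <= u x) -> mu.-integrable B (EFin \o u) ->
  \int[mu]_(x in A) u x <= \int[mu]_(x in B) u x.
Proof.
move=> mA mB AB u0 iB; have iA : mu.-integrable A (EFin \o u) by exact: integrableS iB.
apply: fine_le; [exact: (@integrable_fin_num _ _ _ mu _ mA _ iA)|
  exact: (@integrable_fin_num _ _ _ mu _ mB _ iB)|].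
by apply: ge0_subset_integral => //; exact: (measurable_int _ iB).
Qed.

Lemma interval_bounded a b h dh : a < b -> abs_continuous a b h ->
  is_derivative_ae `]a, b[ h dh -> cintegrable `]a, b[ dh ->
  exists2 M : R, 0 < M & forall x, a < x < b -> normc (h x) <= M.
Proof.
move=> ab ach dhP idh; have [_ _ _ H] := interval_FTC ab ach dhP idh.
pose v x := `|complex.Re (dh x)| + `|complex.Im (dh x)|.
have iv : mu.-integrable `]a, b[ (EFin \o v).
  have [ir ii] := idh.
  have ir' : mu.-integrable `]a, b[ (EFin \o (fun x => `|complex.Re (dh x)|)).
    exact: (integrable_abse ir).
  have ii' : mu.-integrable `]a, b[ (EFin \o (fun x => `|complex.Im (dh x)|)).
    exact: (integrable_abse ii).
  exact: (@integrable_add _ _ _ mu _ (measurable_itv _) _ _ ir' ii').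
have v0 x : 0 <= v x by exact: addr_ge0.
have I0 : 0 <= \int[mu]_(x in `]a, b[) v x by apply: Rintegral_ge0.
exists (normc (right_limit h a) + 2 * \int[mu]_(x in `]a, b[) v x + 1).
  by rewrite ltr_wpDl// addr_ge0 ?normc_ge0// mulr_ge0.
move=> x axb; have /andP[ax xb] := axb.
have sub : `]a, x] `<=` `]a, b[.
  by move=> y; rewrite /= !in_itv/= => /andP[-> /le_lt_trans ->].
have ivx : mu.-integrable `]a, x] (EFin \o v) by exact: integrableS iv.
have idx : cintegrable `]a, x] dh.
  by have [ir ii] := idh; split; [exact: integrableS ir|exact: integrableS ii].
have := normc_cintegral_le (measurable_itv _) idx ivx (fun x _ => normc_le_ReIm _).
rewrite -H// => B1.
have B2 := Rintegral_subset (measurable_itv _) (measurable_itv _) sub (fun x _ => v0 x) iv.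
have := le_normcD (h x - right_limit h a) (right_limit h a); rewrite subrK.
move=> /le_trans; apply; rewrite addrC -addrA lerD2l (le_trans B1)//.
by rewrite -[leLHS]addr0 lerD// ler_pM2l.
Qed.

Lemma abs_continuous_measurable a b h : abs_continuous a b h ->
  measurable_fun `]a, b[ (fun x => complex.Re (h x)) /\
  measurable_fun `]a, b[ (fun x => complex.Im (h x)).
Proof.
move=> /abs_continuousP[/real_abs_continuous_continuous cr
  /real_abs_continuous_continuous ci].
split; apply: open_continuous_measurable_fun.
- exact: interval_open.
- by move=> x; rewrite inE; exact: cr.
- exact: interval_open.
- by move=> x; rewrite inE; exact: ci.
Qed.

Lemma itvoo_finite a b : (mu `]a, b[ < +oo)%E.
Proof.
by rewrite lebesgue_measure_itv/=; case: ifP => _; rewrite ?ltry// -EFinB ltry.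
Qed.

Lemma in_L2_cintegrable (D : set R) f : measurable D -> (mu D < +oo)%E ->
  in_L2 D f -> cintegrable D f.
Proof.
move=> mD Dfin hf.
have h1 : in_L2 D (fun=> 1).
  by apply: (in_L2_bounded mD Dfin (M := 1)) => // x _; rewrite normc1.
have := cintegrableM mD hf h1.
by under [X in cintegrable _ X]eq_fun do rewrite mulr1.
Qed.

Lemma interval_in_L2 a b h dh : a < b -> abs_continuous a b h ->
  is_derivative_ae `]a, b[ h dh -> in_L2 `]a, b[ dh -> in_L2 `]a, b[ h.
Proof.
move=> ab ach dhP L2dh.
have idh := in_L2_cintegrable (measurable_itv _) (itvoo_finite _ _) L2dh.
have [M M0 hM] := interval_bounded ab ach dhP idh.
have [mr mi] := abs_continuous_measurable ach.
apply: (in_L2_bounded _ (itvoo_finite _ _) mr mi); first exact: measurable_itv.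
by move=> x; rewrite /= in_itv/=; exact: hM.
Qed.

Lemma abs_continuousMJ a b h k (M : R) : 0 < M ->
  (forall x, a < x < b -> normc (h x) <= M) ->
  (forall x, a < x < b -> normc (k x) <= M) ->
  abs_continuous a b h -> abs_continuous a b k ->
  abs_continuous a b (fun x => h x * (k x)^*).
Proof.
move=> M0 hM kM /abs_continuousP[hr hi] /abs_continuousP[kr ki].
have hrM x : a < x < b -> `|complex.Re (h x)| <= M.
  by move=> /hM; apply: le_trans; exact: normc_Re.
have hiM x : a < x < b -> `|complex.Im (h x)| <= M.
  by move=> /hM; apply: le_trans; exact: normc_Im.
have krM x : a < x < b -> `|complex.Re (k x)| <= M.
  by move=> /kM; apply: le_trans; exact: normc_Re.
have kiM x : a < x < b -> `|complex.Im (k x)| <= M.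
  by move=> /kM; apply: le_trans; exact: normc_Im.
apply/abs_continuousP; split.
  under eq_fun do rewrite ReM Re_conj Im_conj mulrN opprK.
  exact: real_abs_continuousD (real_abs_continuousM M0 hrM krM hr kr)
    (real_abs_continuousM M0 hiM kiM hi ki).
under eq_fun do rewrite ImM Re_conj Im_conj mulrN addrC.
exact: real_abs_continuousB (real_abs_continuousM M0 hiM krM hi kr)
  (real_abs_continuousM M0 hrM kiM hr ki).
Qed.

Lemma is_derivative_aeMJ (D : set R) h k dh dk : is_derivative_ae D h dh ->
  is_derivative_ae D k dk ->
  is_derivative_ae D (fun x => h x * (k x)^*)
    (fun x => dh x * (k x)^* + h x * (dk x)^*).
Proof.
move=> dhP dkP; have := ae_and dhP dkP; apply: ae_mono => x [hh kk] Dx.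
have [hr hi] := hh Dx; have [kr ki] := kk Dx; split.
  under eq_fun do rewrite ReM Re_conj Im_conj.
  apply: is_derive_eq; rewrite !(ReD, ReM, Re_conj, Im_conj) /GRing.scale/=; ring.
under eq_fun do rewrite ImM Re_conj Im_conj.
apply: is_derive_eq; rewrite !(ImD, ImM, Re_conj, Im_conj) /GRing.scale/=; ring.
Qed.

(** The fundamental theorem applied to [h * k^*], which is absolutely continuous because both
    factors are bounded on the interval. *)
Lemma interval_Green a b h k dh dk : a < b ->
  abs_continuous a b h -> is_derivative_ae `]a, b[ h dh -> in_L2 `]a, b[ dh ->
  abs_continuous a b k -> is_derivative_ae `]a, b[ k dk -> in_L2 `]a, b[ dk ->
  cintegral `]a, b[ (fun x => dh x * (k x)^* + h x * (dk x)^*) =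
  left_limit h b * (left_limit k b)^* - right_limit h a * (right_limit k a)^*.
Proof.
move=> ab ach dhP L2dh ack dkP L2dk; have mJ := measurable_itv (`]a, b[ : interval R).
have idh := in_L2_cintegrable mJ (itvoo_finite _ _) L2dh.
have idk := in_L2_cintegrable mJ (itvoo_finite _ _) L2dk.
have [Mh Mh0 hM] := interval_bounded ab ach dhP idh.
have [Mk Mk0 kM] := interval_bounded ab ack dkP idk.
have [hra hlb _ _] := interval_FTC ab ach dhP idh.
have [kra klb _ _] := interval_FTC ab ack dkP idk.
have acp : abs_continuous a b (fun x => h x * (k x)^*).
  apply: (@abs_continuousMJ _ _ _ _ (Mh + Mk)) => //; first exact: addr_gt0.
    by move=> x /hM /le_trans; apply; rewrite lerDl ltW.
  by move=> x /kM /le_trans; apply; rewrite lerDr ltW.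
have L2h := interval_in_L2 ab ach dhP L2dh.
have L2k := interval_in_L2 ab ack dkP L2dk.
have ip : cintegrable `]a, b[ (fun x => dh x * (k x)^* + h x * (dk x)^*).
  by apply: cintegrableD => //; exact: cintegrableJ.
have [_ _ <- _] := interval_FTC ab acp (is_derivative_aeMJ dhP dkP) ip.
by rewrite (cvg_leftE (cvg_leftMJ hlb klb)) (cvg_rightE (cvg_rightMJ hra kra)).
Qed.

End complex_interval.

(** * The maximal domain *)

Section omega.
Context {R : realType} {n : nat}.
Notation mu := (@lebesgue_measure R).
Variables alpha beta : 'I_n -> R.
Hypothesis n_gt0 : (0 < n)%N.
Hypothesis lt_alpha_beta : forall i : 'I_n, alpha i < beta i.
Hypothesis lt_beta_alpha : forall i j : 'I_n, (i < j)%N -> beta i < alpha j.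
Implicit Types (f g h k dh dk : R -> R[i]) (c v : 'I_n -> R[i]).
Local Notation Om := (Omega alpha beta).
Local Notation J i := `]alpha i, beta i[%classic.

Lemma OmegaE : Om = \big[setU/set0]_(i < n) J i.
Proof.
rewrite -(bigcup_seq (index_enum 'I_n)); apply/seteqP; split => x.
  by move=> [i axb]; exists i; rewrite /= ?mem_index_enum ?in_itv.
by move=> [i _]; rewrite /= in_itv/= => axb; exists i.
Qed.

Lemma itv_sub_Omega i : J i `<=` Om.
Proof. by move=> x; rewrite /= in_itv/= => axb; exists i. Qed.

Lemma Omega_itv_inj i j x : alpha i < x < beta i -> alpha j < x < beta j -> i = j.
Proof.
move=> /andP[aix xbi] /andP[ajx xbj]; apply/val_inj/eqP => /=.
rewrite eqn_leq; apply/andP; split; rewrite leqNgt; apply/negP => /lt_beta_alpha; lra.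
Qed.

Lemma trivIset_itv : trivIset setT (fun i => J i).
Proof.
apply/trivIsetP => i j _ _ ij; apply/seteqP; split => // x [] /=.
rewrite !in_itv/= => xi xj; move: ij.
by rewrite (Omega_itv_inj xi xj) eqxx.
Qed.

Lemma open_Omega : open Om.
Proof.
rewrite OmegaE -(bigcup_seq (index_enum 'I_n)).
by apply: bigcup_open => i _; exact: interval_open.
Qed.

Lemma measurable_Omega : measurable Om.
Proof. apply: open_measurable; exact: open_Omega. Qed.

Let mOm := measurable_Omega.

Lemma lebesgue_Omega : mu Om = (\sum_(i < n) (beta i - alpha i))%:E.
Proof.
have muJ i : mu (J i) = (beta i - alpha i)%:E.
  by rewrite lebesgue_measure_itv/= lte_fin lt_alpha_beta.
rewrite OmegaE (@measure_bigsetU_ord _ _ _ mu n xpredT (fun i => J i))//; last exact: trivIset_itv.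
by rewrite -sumEFin; apply: eq_bigr => i _; exact: muJ.
Qed.

Lemma Omega_finite : (mu Om < +oo)%E.
Proof. by rewrite lebesgue_Omega ltry. Qed.

Lemma length_Omega_gt0 : 0 < length Om.
Proof.
rewrite /length lebesgue_Omega/= (bigD1 (Ordinal n_gt0))//= ltr_wpDr//.
  by apply: sumr_ge0 => i _; rewrite subr_ge0 ltW.
by rewrite subr_gt0.
Qed.

Lemma Rintegral_Omega (u : R -> R) : mu.-integrable Om (EFin \o u) ->
  \int[mu]_(x in Om) u x = \sum_(i < n) \int[mu]_(x in J i) u x.
Proof.
move=> iu; have iuJ i : mu.-integrable (J i) (EFin \o u).
  by apply: integrableS iu => //; exact: itv_sub_Omega.
apply/EFin_inj; rewrite -sumEFin fineK; last first.
  exact: (@integrable_fin_num _ _ _ mu _ mOm _ iu).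
have -> : (\int[mu]_(x in Om) (u x)%:E = \sum_(i < n) \int[mu]_(x in J i) (u x)%:E)%E.
  move: iu; rewrite OmegaE => iu.
  apply: (@integral_bigsetU_EFin _ _ _ mu _ (fun i => J i) u) => //.
  - exact: index_enum_uniq.
  - by apply: sub_trivIset trivIset_itv.
  - exact: (measurable_int _ iu).
apply: eq_bigr => i _; rewrite fineK//.
exact: (@integrable_fin_num _ _ _ mu _ (measurable_itv _) _ (iuJ i)).
Qed.

Lemma cintegral_Omega f : cintegrable Om f ->
  cintegral Om f = \sum_(i < n) cintegral (J i) f.
Proof.
move=> [ir ii]; rewrite /cintegral !Rintegral_Omega//.
have E (p q : 'I_n -> R) (s : seq 'I_n) :
    (\sum_(i <- s) p i) +i* (\sum_(i <- s) q i) = \sum_(i <- s) (p i +i* q i).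
  by elim: s => [|i s IH]; rewrite ?big_nil// !big_cons -IH.
exact: E.
Qed.

Lemma in_L2_sub (A B : set R) f : measurable A -> measurable B -> A `<=` B ->
  in_L2 B f -> in_L2 A f.
Proof.
move=> mA mB AB /in_L2P-/(_ mB)[[mr ir] [mi ii]]; apply/in_L2P => //; split; split.
- exact: measurable_funS mr.
- exact: integrableS ir.
- exact: measurable_funS mi.
- exact: integrableS ii.
Qed.

Lemma in_L2_itv f i : in_L2 Om f -> in_L2 (J i) f.
Proof. by apply: in_L2_sub => //; exact: itv_sub_Omega. Qed.

Lemma is_derivative_ae_itv f df i : is_derivative_ae Om f df ->
  is_derivative_ae (J i) f df.
Proof. by apply: ae_mono => x H /itv_sub_Omega. Qed.

Lemma is_derivative_ae_Omega f df : (forall i, is_derivative_ae (J i) f df) ->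
  is_derivative_ae Om f df.
Proof.
(* Restated for finite lists of intervals, so that the exceptional null sets are united one at a
   time. *)
move=> H; have {}H (s : seq 'I_n) : {ae mu, forall x, forall i, i \in s -> J i x ->
    is_derive x 1 (fun y => complex.Re (f y)) (complex.Re (df x)) /\
    is_derive x 1 (fun y => complex.Im (f y)) (complex.Im (df x))}.
  elim: s => [|i s IH]; first by apply: ae_all.
  apply: ae_mono (ae_and (H i) IH) => x [Hi Hs] j.
  by rewrite inE => /predU1P[->//|js]; exact: Hs.
apply: ae_mono (H (enum 'I_n)) => x Hx [i axb].
by apply: (Hx i); rewrite ?mem_enum//= in_itv.
Qed.

Lemma measurable_fun_Omega (u : R -> R) : (forall i, measurable_fun (J i) u) ->
  measurable_fun Om u.
Proof.
move=> mu_; rewrite OmegaE.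
have H (s : seq 'I_n) : measurable_fun (\big[setU/set0]_(i <- s) J i) u.
  elim: s => [|i s IH]; first by rewrite big_nil; exact: measurable_fun_set0.
  rewrite big_cons; apply/measurable_funU => //.
  by apply: bigsetU_measurable => j _; exact: measurable_itv.
exact: H.
Qed.

Lemma in_Dmax_itv h dh i : in_Dmax alpha beta h dh ->
  [/\ abs_continuous (alpha i) (beta i) h, is_derivative_ae (J i) h dh,
    in_L2 (J i) dh & cintegrable (J i) dh].
Proof.
move=> [ach dhP L2dh]; have L2i := in_L2_itv i L2dh.
split => //; first exact: is_derivative_ae_itv.
exact: in_L2_cintegrable (itvoo_finite _ _) L2i.
Qed.

Lemma in_Dmax_limits h dh i : in_Dmax alpha beta h dh ->
  [/\ cvg_right h (alpha i) (right_limit h (alpha i)),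
    cvg_left h (beta i) (left_limit h (beta i)),
    left_limit h (beta i) - right_limit h (alpha i) = cintegral (J i) dh &
    forall x, alpha i < x < beta i ->
      h x - right_limit h (alpha i) = cintegral `]alpha i, x] dh].
Proof.
by move=> /in_Dmax_itv-/(_ i)[ach dhP _ idh]; exact: interval_FTC.
Qed.

Lemma in_Dmax_bounded h dh : in_Dmax alpha beta h dh ->
  exists2 M : R, 0 < M & forall x, Om x -> normc (h x) <= M.
Proof.
move=> hD; have H i : exists M : R, 0 < M /\
    forall x, alpha i < x < beta i -> normc (h x) <= M.
  have [ach dhP _ idh] := in_Dmax_itv i hD.
  by have [M M0 hM] := interval_bounded (lt_alpha_beta i) ach dhP idh; exists M.
have [M HM] := choice H.
have M0 i : 0 <= M i by have [/ltW] := HM i.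
exists (1 + \sum_i M i); first by rewrite ltr_wpDr// sumr_ge0.
move=> x [i /(HM i).2 /le_trans]; apply.
by rewrite (bigD1 i)//= addrCA lerDl addr_ge0// sumr_ge0.
Qed.

Lemma in_Dmax_in_L2 h dh : in_Dmax alpha beta h dh -> in_L2 Om h.
Proof.
move=> hD; have [M M0 hM] := in_Dmax_bounded hD.
apply: (in_L2_bounded mOm Omega_finite (M := M)) => //; apply: measurable_fun_Omega => i;
  by have [/abs_continuous_measurable[mr mi] _ _ _] := in_Dmax_itv i hD.
Qed.

Lemma Green h k dh dk : in_Dmax alpha beta h dh -> in_Dmax alpha beta k dk ->
  inner Om dh k + inner Om h dk = (length Om)^-1%:C *
  \sum_i (left_limit h (beta i) * (left_limit k (beta i))^* -
          right_limit h (alpha i) * (right_limit k (alpha i))^*).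
Proof.
move=> hD kD; have L2h := in_Dmax_in_L2 hD; have L2k := in_Dmax_in_L2 kD.
have [_ _ L2dh] := hD; have [_ _ L2dk] := kD.
have i1 := cintegrableJ mOm L2dh L2k; have i2 := cintegrableJ mOm L2h L2dk.
rewrite /inner -mulrDr -cintegralD// cintegral_Omega; last exact: cintegrableD.
congr (_ * _); apply: eq_bigr => i _.
have [ach dhP L2dhi _] := in_Dmax_itv i hD.
have [ack dkP L2dki _] := in_Dmax_itv i kD.
exact: interval_Green.
Qed.

(** The picked index is unambiguous because the intervals are disjoint. *)
Definition step c (x : R) : R[i] :=
  if [pick i | alpha i < x < beta i] is Some i then c i else 0.

Lemma stepE c i x : alpha i < x < beta i -> step c x = c i.
Proof.
move=> axb; rewrite /step; case: pickP => [j axb'|/(_ i)]; last by rewrite axb.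
by rewrite (Omega_itv_inj axb axb').
Qed.

Lemma in_Dmax_glue (f : 'I_n -> R -> R[i]) h dh :
  (forall i, abs_continuous (alpha i) (beta i) (f i)) ->
  (forall i, is_derivative_ae (J i) (f i) dh) -> in_L2 Om dh ->
  (forall i x, alpha i < x < beta i -> h x = f i x) ->
  in_Dmax alpha beta h dh.
Proof.
move=> acf df L2dh hf; split => //.
  move=> i; have /abs_continuousP[cr ci] := acf i; apply/abs_continuousP; split.
    by apply: eq_real_abs_continuous cr => x /hf ->.
  by apply: eq_real_abs_continuous ci => x /hf ->.
apply: is_derivative_ae_Omega => i; apply: ae_mono (df i) => x + axb.
move=> /(_ axb)[dr di].
have nE : \near x, f i x = h x.
  move: axb; rewrite /= in_itv/= => /andP[ax xb]; near=> y; apply/esym/hf.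
  by apply/andP; split; near: y; [exact: lt_nbhsr|exact: lt_nbhsl].
split; [apply: near_eq_is_derive dr|apply: near_eq_is_derive di];
  by apply: filterS nE => y ->.
Unshelve. all: by end_near. Qed.

Lemma in_Dmax_e l :
  in_Dmax alpha beta (e_ l) (fun x => two_pi_i R * l%:C * e_ l x).
Proof.
have Re_e x : complex.Re (two_pi_i R * l%:C * e_ l x) = - (2 * pi * l) * complex.Im (e_ l x).
  by rewrite !(ReM, ImM)/=; ring.
have Im_e x : complex.Im (two_pi_i R * l%:C * e_ l x) = 2 * pi * l * complex.Re (e_ l x).
  by rewrite !(ReM, ImM)/=; ring.
have M0 : 0 < `|2 * pi * l| + 1 by rewrite ltr_wpDl.
split; last by apply: in_L2Z => //; apply: in_L2_e => //; exact: Omega_finite.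
- move=> i; apply/abs_continuousP; split.
    apply: (real_abs_continuous_lipschitz M0 (fun x _ => is_derive_Re_e l x)) => x _.
    rewrite normrM normrN -[leRHS]mulr1 ler_pM// ?lerDl//.
    by rewrite (le_trans (normc_Im _))// normc_e.
  apply: (real_abs_continuous_lipschitz M0 (fun x _ => is_derive_Im_e l x)) => x _.
  rewrite normrM -[leRHS]mulr1 ler_pM// ?lerDl//.
  by rewrite (le_trans (normc_Re _))// normc_e.
- apply: ae_all => x _; rewrite Re_e Im_e; split.
    exact: is_derive_Re_e.
  exact: is_derive_Im_e.
Qed.

Lemma cvg_right_e l (a : R) : cvg_right (e_ l) a (e_ l a).
Proof.
by split; apply: cvg_at_right_filter; [exact: continuous_Re_e|exact: continuous_Im_e].
Qed.

Lemma cvg_left_e l (a : R) : cvg_left (e_ l) a (e_ l a).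
Proof.
by split; apply: cvg_at_left_filter; [exact: continuous_Re_e|exact: continuous_Im_e].
Qed.

(** [(e_ l x)^*] is the integrating factor of [h' = 2 pi i (g + l h)]: after the multiplication only
    the part of [dh] that deviates from [2 pi i l h] remains. *)
Lemma in_Dmax_mulJe l h dh : in_Dmax alpha beta h dh ->
  in_Dmax alpha beta (fun x => h x * (e_ l x)^*)
    (fun x => (dh x - two_pi_i R * l%:C * h x) * (e_ l x)^*).
Proof.
move=> hD; have eD := in_Dmax_e l; have L2h := in_Dmax_in_L2 hD.
have [M M0 hM] := in_Dmax_bounded hD.
split.
- move=> i; have [ach _ _ _] := in_Dmax_itv i hD; have [ace _ _ _] := in_Dmax_itv i eD.
  apply: (@abs_continuousMJ _ _ _ _ _ (M + 1)) => //; first by rewrite addr_gt0.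
    by move=> x axb; rewrite (le_trans (hM _ _)) ?lerDl//; exists i.
  by move=> x _; rewrite normc_e lerDr ltW.
- have [_ dhP _] := hD; have [_ deP _] := eD.
  apply: ae_mono (is_derivative_aeMJ dhP deP) => x + Ox => /(_ Ox).
  suff -> : dh x * (e_ l x)^* + h x * (two_pi_i R * l%:C * e_ l x)^* =
    (dh x - two_pi_i R * l%:C * h x) * (e_ l x)^* by [].
  have -> : (two_pi_i R * l%:C * e_ l x)^* = - (two_pi_i R * l%:C) * (e_ l x)^*.
    rewrite conj_mul; congr (_ * _); apply: complex_eq;
    by rewrite !(ReN, ImN, ReM, ImM, Re_conj, Im_conj)/=; ring.
  by ring.
- have [_ _ L2dh] := hD.
  under eq_fun do rewrite mulrC -e_N.
  apply: in_L2_mul_le1 => //; [exact: measurable_Re_e|exact: measurable_Im_e| |].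
    by move=> x _; rewrite normc_e.
  by apply: in_L2B => //; exact: in_L2Z.
Qed.

Lemma cvg_rightDZ h k (z : R[i]) (a : R) p q : cvg_right h a p -> cvg_right k a q ->
  cvg_right (fun x => h x + z * k x) a (p + z * q).
Proof.
move=> [hr hi] [kr ki]; split.
  rewrite ReD ReM; under eq_fun do rewrite ReD ReM.
  by apply: cvgD => //; apply: cvgB; apply: cvgM => //; exact: cvg_cst.
rewrite ImD ImM; under eq_fun do rewrite ImD ImM.
by apply: cvgD => //; apply: cvgD; apply: cvgM => //; exact: cvg_cst.
Qed.

Lemma cvg_leftDZ h k (z : R[i]) (a : R) p q : cvg_left h a p -> cvg_left k a q ->
  cvg_left (fun x => h x + z * k x) a (p + z * q).
Proof.
move=> [hr hi] [kr ki]; split.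
  rewrite ReD ReM; under eq_fun do rewrite ReD ReM.
  by apply: cvgD => //; apply: cvgB; apply: cvgM => //; exact: cvg_cst.
rewrite ImD ImM; under eq_fun do rewrite ImD ImM.
by apply: cvgD => //; apply: cvgD; apply: cvgM => //; exact: cvg_cst.
Qed.

Lemma in_DmaxDZ h k dh dk (z : R[i]) : in_Dmax alpha beta h dh ->
  in_Dmax alpha beta k dk ->
  in_Dmax alpha beta (fun x => h x + z * k x) (fun x => dh x + z * dk x).
Proof.
move=> [ach dhP L2dh] [ack dkP L2dk]; split.
- move=> i; have /abs_continuousP[hr hi] := ach i.
  have /abs_continuousP[kr ki] := ack i.
  have zM (u : R -> R) (c : R) : real_abs_continuous (alpha i) (beta i) u ->
      real_abs_continuous (alpha i) (beta i) (fun x => c * u x).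
    move=> acu e e0; have [d d0 H] := acu (e / (`|c| + 1))
      (divr_gt0 e0 (ltr_wpDl (normr_ge0 c) ltr01)).
    exists d => // m s t st dis sd; have := H m s t st dis sd.
    rewrite ltr_pdivlMr ?ltr_wpDl// => /(le_lt_trans _); apply.
    rewrite mulr_suml; apply: ler_sum => j _.
    by rewrite -mulrBr normrM mulrC ler_wpM2l// lerDl.
  apply/abs_continuousP; split.
    under eq_fun do rewrite ReD ReM.
    exact: real_abs_continuousD hr (real_abs_continuousB (zM _ _ kr) (zM _ _ ki)).
  under eq_fun do rewrite ImD ImM.
  exact: real_abs_continuousD hi (real_abs_continuousD (zM _ _ ki) (zM _ _ kr)).
- apply: ae_mono (ae_and dhP dkP) => x [hh kk] Ox.
  have [hr hi] := hh Ox; have [kr ki] := kk Ox; split.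
    under eq_fun do rewrite ReD ReM.
    by apply: is_derive_eq; rewrite !(ReD, ReM, ImM) /GRing.scale/=; ring.
  under eq_fun do rewrite ImD ImM.
  by apply: is_derive_eq; rewrite !(ImD, ReM, ImM) /GRing.scale/=; ring.
- by apply: in_L2D => //; exact: in_L2Z.
Qed.

Lemma in_Dmax_step c : in_Dmax alpha beta (step c) (fun=> 0).
Proof.
apply: (@in_Dmax_glue (fun i => fun=> c i)) => //.
- by move=> i; apply/abs_continuousP; split; exact: real_abs_continuous_cst.
- move=> i; apply: ae_all => x _; split; exact: is_derive_cst.
- exact: in_L20.
- by move=> i x /stepE ->.
Qed.

Lemma cvg_right_cst (z : R[i]) (a : R) : cvg_right (fun=> z) a z.
Proof. by split; exact: cvg_cst. Qed.

Lemma cvg_left_cst (z : R[i]) (a : R) : cvg_left (fun=> z) a z.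
Proof. by split; exact: cvg_cst. Qed.

Lemma cvg_right_step c i : cvg_right (step c) (alpha i) (c i).
Proof.
by apply: eq_cvg_right (lt_alpha_beta i) _ (cvg_right_cst (c i) _) => x /stepE ->.
Qed.

Lemma cvg_left_step c i : cvg_left (step c) (beta i) (c i).
Proof.
by apply: eq_cvg_left (lt_alpha_beta i) _ (cvg_left_cst (c i) _) => x /stepE ->.
Qed.

(** A global primitive of [g] has its own values at the left endpoints; a locally constant
    correction resets each of them to [v i]. *)
Lemma in_Dmax_primitive g v : in_L2 Om g -> exists2 h, in_Dmax alpha beta h g &
  forall i, right_limit h (alpha i) = v i.
Proof.
move=> L2g; have [ir ii] := in_L2_cintegrable mOm Omega_finite L2g.
have ext (u : R -> R) : mu.-integrable Om (EFin \o u) ->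
    mu.-integrable setT (EFin \o (u \_ Om)).
  move=> iu; rewrite -restrict_EFin; apply/integrable_restrict => //.
  by rewrite setTI.
have {}ir := ext _ ir; have {}ii := ext _ ii.
set gr := (fun x => complex.Re (g x)) \_ Om in ir.
set gi := (fun x => complex.Im (g x)) \_ Om in ii.
pose H x := (\int[mu]_(t in `]-oo, x]) gr t) +i* (\int[mu]_(t in `]-oo, x]) gi t).
pose c i := v i - H (alpha i).
have acH i : abs_continuous (alpha i) (beta i) (fun x => H x + c i).
  apply/abs_continuousP; split.
    under eq_fun do rewrite ReD.
    exact: real_abs_continuousD (@primitive_abs_continuous _ _ ir _ _)
      (real_abs_continuous_cst _ _ _).
  under eq_fun do rewrite ImD.
  exact: real_abs_continuousD (@primitive_abs_continuous _ _ ii _ _)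
    (real_abs_continuous_cst _ _ _).
have hD : in_Dmax alpha beta (fun x => H x + step c x) g.
  apply: (@in_Dmax_glue (fun i x => H x + c i)) => //; last first.
    by move=> i x /stepE ->.
  move=> i; apply: ae_mono (ae_and (primitive_is_derive ir) (primitive_is_derive ii)).
  move=> x [dr di] /itv_sub_Omega Ox; split.
    under eq_fun do rewrite ReD; apply: is_derive_eq; rewrite addr0.
    by rewrite /gr patchE mem_set.
  under eq_fun do rewrite ImD; apply: is_derive_eq; rewrite addr0.
  by rewrite /gi patchE mem_set.
exists (fun x => H x + step c x) => // i; apply: cvg_rightE.
apply: (eq_cvg_right (lt_alpha_beta i) (h := fun x => H x + c i)).
  by move=> x /stepE ->.
have -> : v i = H (alpha i) + c i by rewrite /c addrC subrK.
split.
  rewrite ReD; under eq_fun do rewrite ReD; apply: cvgD; last exact: cvg_cst.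
  exact/cvg_at_right_filter/(primitive_continuous ir).
rewrite ImD; under eq_fun do rewrite ImD; apply: cvgD; last exact: cvg_cst.
exact/cvg_at_right_filter/(primitive_continuous ii).
Qed.

Lemma cintegral_cst (a b : R) (z : R[i]) : a <= b ->
  cintegral `]a, b[ (fun=> z) = z * (b - a)%:C.
Proof.
move=> ab; have L : fine (mu `]a, b[) = b - a.
  rewrite lebesgue_measure_itv/= lte_fin; case: ltP => //= ba.
  by rewrite (@le_anti _ _ a b) ?subrr// ab ba.
have mJ := measurable_itv (`]a, b[ : interval R).
rewrite /cintegral !(@Rintegral_cst _ _ _ mu _ mJ) L.
by apply: complex_eq; rewrite ?ReM ?ImM/=; ring.
Qed.

(** Affine interpolation on each interval, with the slope as derivative. Since boundary values can
    be prescribed freely, boundary pairings can be tested against arbitrary vectors. *)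
Lemma in_Dmax_interpolate v w : exists h dh, [/\ in_Dmax alpha beta h dh,
  forall i, right_limit h (alpha i) = v i & forall i, left_limit h (beta i) = w i].
Proof.
pose g := step (fun i => (w i - v i) / (beta i - alpha i)%:C).
have L2g : in_L2 Om g by apply: in_Dmax_in_L2; exact: in_Dmax_step.
have [h hD hv] := in_Dmax_primitive v L2g; exists h, g; split => // i.
have [_ _ + _] := in_Dmax_limits i hD; rewrite hv => /eqP; rewrite subr_eq => /eqP ->.
rewrite (@eq_cintegral _ _ _ (fun=> (w i - v i) / (beta i - alpha i)%:C)); last first.
  by move=> x; rewrite /= in_itv/= => /stepE; exact.
rewrite cintegral_cst ?(ltW (lt_alpha_beta i))// divfK ?subrK//.
by rewrite -normc_eq0 normc_real normr_eq0 subr_eq0 gt_eqF.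
Qed.

End omega.

(** * Hermitian products of boundary vectors, and bases extracted from total sets *)

Section hermitian_algebra.
Context {R : realType} {n : nat}.
Implicit Types (v w : 'cV[R[i]]_n) (S : set 'cV[R[i]]_n) (B : 'M[R[i]]_n).

Definition cdot v w : R[i] := \sum_i v i 0 * (w i 0)^*.

Lemma cdotE v w : cdot v w = (map_mx Num.conj w^T *m v) 0 0.
Proof. by rewrite mxE; apply: eq_bigr => i _; rewrite !mxE mulrC. Qed.

Lemma cdot_self_eq0 v : cdot v v = 0 -> v = 0.
Proof.
move=> v0; have : \sum_i normc (v i 0) ^+ 2 = 0.
  apply: complexI; rewrite -[RHS]v0 rmorph_sum; apply: eq_bigr => i _.
  exact: normc_sqrE.
move/eqP; rewrite psumr_eq0; last by move=> i _; exact: sqr_ge0.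
move/allP => H; apply/matrixP => i j; rewrite ord1 mxE; apply/eqP.
by have := H i (mem_index_enum _); rewrite sqrf_eq0 normc_eq0.
Qed.

Lemma unitary_mulJ B : B \is unitarymx -> map_mx Num.conj B^T *m B = 1%:M.
Proof. by move=> /unitarymxP/mulmx1C. Qed.

Lemma unitary_cdot B v w : B \is unitarymx -> cdot (B *m v) (B *m w) = cdot v w.
Proof.
move=> uB; rewrite !cdotE trmx_mul map_mxM -mulmxA (mulmxA _ B).
by rewrite unitary_mulJ// mul1mx.
Qed.

(** Among the finite families from [S] take one, as rows of [W], of maximal rank; by maximality its
    row space contains every [s]. If the rank were below [n], a nonzero vector of the kernel,
    conjugated, would be orthogonal to all of [S]. Then [n] of the rows form a basis. *)
Lemma exists_unit_columns S : (forall v, (forall s, S s -> cdot v s = 0) -> v = 0) ->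
  exists w : 'I_n -> 'cV[R[i]]_n,
    (forall j, S (w j)) /\ (\matrix_(i, j) w j i 0) \in unitmx.
Proof.
move=> S0.
pose Q r := `[< exists k (W : 'M[R[i]]_(k, n)),
  (forall j, S (row j W)^T) /\ \rank W = r >].
have exQ : exists r, Q r.
  exists 0%N; apply/asboolP; exists 0%N, 0; split; first by case.
  by rewrite mxrank0.
have Qn r : Q r -> (r <= n)%N.
  by move=> /asboolP[k [W [_ <-]]]; exact: rank_leq_col.
case: (ex_maxnP exQ Qn) => r /asboolP[k [W [SW rW]]] rmax.
have SsubW s : S s -> (s^T <= W)%MS.
  move=> Ss; apply/negPn/negP => sW.
  have lt : (W < col_mx W s^T)%MS.
    rewrite ltmxE; apply/andP; split; first by rewrite -addsmxE addsmxSl.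
    by apply: contra sW => H; apply: submx_trans H; rewrite -addsmxE addsmxSr.
  have := rmax (\rank (col_mx W s^T)); rewrite leqNgt -rW (rank_ltmx lt).
  suff -> : Q (\rank (col_mx W s^T)) by move=> /(_ isT).
  apply/asboolP; exists (k + 1)%N, (col_mx W s^T); split => // j.
  by rewrite -(splitK j); case: (fintype.split j) => j' /=;
    rewrite ?rowKu ?rowKd ?row_id ?trmxK.
have fullW : row_full W.
  apply/negPn/negP => nfull.
  have /rowV0Pn[u uk u0] : kermx W^T != 0.
    rewrite kermx_eq0 /row_free mxrank_tr; exact: nfull.
  have uW : u *m W^T = 0 by apply/sub_kermxP.
  have : map_mx Num.conj u^T = 0.
    apply: S0 => s /SsubW/submxP[c sc]; rewrite cdotE.
    have -> : map_mx Num.conj s^T *m map_mx Num.conj u^T =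
        map_mx Num.conj (u *m s)^T by rewrite trmx_mul map_mxM.
    have -> : s = W^T *m c^T by rewrite -trmx_mul -sc trmxK.
    by rewrite mulmxA uW mul0mx trmx0 map_mx0 mxE.
  move=> H; case/eqP: u0; apply/matrixP => i j.
  have := congr1 (fun M : 'cV_n => M j i) H; rewrite !mxE => /eqP.
  by rewrite conjC_eq0 => /eqP.
exists (fun j => (row (fullrankfun fullW j) W)^T); split => //.
have := fullrowsub_unit fullW; rewrite -unitmx_tr; congr (_ \in unitmx).
by apply/matrixP => i j; rewrite !mxE.
Qed.

Lemma lin_span_full S (w : 'I_n -> 'cV[R[i]]_n) : (forall j, S (w j)) ->
  (\matrix_(i, j) w j i 0) \in unitmx -> lin_span S = setT.
Proof.
move=> Sw uP; apply/seteqP; split => // v _; set P := (\matrix_(i, j) _) in uP.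
exists n, w, (fun j => (invmx P *m v) j 0); split => //.
rewrite -[LHS](mulKVmx uP); apply/matrixP => i j; rewrite ord1 mxE summxE.
by apply: eq_bigr => k _; rewrite !mxE mulrC.
Qed.

End hermitian_algebra.

(** * Pointwise values of domain functions, and frequencies outside the spectrum *)

Section omega_spectral.
Context {R : realType} {n : nat}.
Notation mu := (@lebesgue_measure R).
Variables alpha beta : 'I_n -> R.
Hypothesis n_gt0 : (0 < n)%N.
Hypothesis lt_alpha_beta : forall i : 'I_n, alpha i < beta i.
Hypothesis lt_beta_alpha : forall i j : 'I_n, (i < j)%N -> beta i < alpha j.
Implicit Types (f g h k dh dk : R -> R[i]).
Local Notation Om := (Omega alpha beta).

Let mOm : measurable Om := measurable_Omega alpha beta.
Let Ofin : (mu Om < +oo)%E := Omega_finite lt_alpha_beta lt_beta_alpha.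
Let Opos : 0 < length Om := length_Omega_gt0 n_gt0 lt_alpha_beta lt_beta_alpha.

Lemma ae_itv_dense (P : R -> Prop) (a b : R) : a < b ->
  {ae mu, forall x, P x} -> exists2 x, a < x < b & P x.
Proof.
move=> ab [N [mN N0 subN]]; apply: contrapT => H.
have sub : `]a, b[ `<=` N.
  move=> x; rewrite /= in_itv/= => axb; apply: subN => /= Px; apply: H.
  by exists x.
have := le_lebesgue (measurable_itv _) mN sub.
by rewrite [X in (_ <= X)%E]N0 lebesgue_measure_itv/= lte_fin ab lee_fin; lra.
Qed.

(** To the right of any [x] there are zeros of [h] arbitrarily close, and [h] is uniformly
    continuous on the interval. Hence boundary values depend only on the class of [h]. *)
Lemma in_Dmax_ae0 h dh : in_Dmax alpha beta h dh -> eq_on_ae Om h (fun=> 0) ->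
  forall x, Om x -> h x = 0.
Proof.
move=> hD h0 x [i axb]; have [ach _ _ _] := in_Dmax_itv i hD.
have /abs_continuousP[acr aci] := ach.
have key (u : R -> R) : real_abs_continuous (alpha i) (beta i) u ->
    {ae mu, forall x, Om x -> u x = 0} -> u x = 0.
  move=> acu u0; apply/eqP; rewrite -normr_eq0 eq_le normr_ge0 andbT.
  apply/ler_addgt0Pl => e e0; rewrite addr0.
  have [d d0 H] := real_abs_continuous_uniform acu e0.
  have /andP[ax xb] := axb.
  have [|y] := @ae_itv_dense _ x (Num.min (x + d) (beta i)) _ u0.
    by rewrite lt_min xb ltrDl d0.
  rewrite lt_min => /andP[xy /andP[yd yb]] uy.
  have := H x y ax (ltW xy) yb; rewrite uy ?sub0r ?normrN; last first.
    by exists i; rewrite (lt_trans ax xy).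
  by rewrite ltrBlDl => /(_ yd)/ltW.
by apply: complex_eq; [apply: (key (fun y => complex.Re (h y)))|
  apply: (key (fun y => complex.Im (h y)))] => //; apply: ae_mono h0 => y /[apply] ->.
Qed.

Lemma Omega0_limits h i : (forall x, Om x -> h x = 0) ->
  cvg_right h (alpha i) 0 /\ cvg_left h (beta i) 0.
Proof.
move=> h0; have E x : alpha i < x < beta i -> (fun=> 0) x = h x.
  by move=> axb; rewrite h0//; exists i.
by split; [apply: eq_cvg_right (lt_alpha_beta i) E _; exact: cvg_right_cst|
  apply: eq_cvg_left (lt_alpha_beta i) E _; exact: cvg_left_cst].
Qed.

(** The mean value theorem for the real and the imaginary part, whence the factor 2. *)
Lemma normc_e_sub1 (l x : R) : normc (e_ l x - 1) <= 2 * (2 * pi * `|l| * `|x|).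
Proof.
have bound (u v : R -> R) : (forall y : R, is_derive y 1 u (v y)) ->
    (forall y, `|v y| <= 2 * pi * `|l|) -> `|u x - u 0| <= 2 * pi * `|l| * `|x|.
  move=> du vb.
  have cu (y z : R) : {within `[y, z], continuous u}.
    apply: continuous_subspaceT => t; apply/differentiable_continuous/derivable1_diffP.
    exact: (@ex_derive _ _ _ _ _ _ _ (du t)).
  have [x0|x0] := leP 0 x.
    have [c _ ->] := MVT_segment x0 (fun y _ => du y) (@cu 0 x).
    by rewrite subr0 normrM ler_wpM2r.
  have [c _ E] := MVT_segment (ltW x0) (fun y _ => du y) (@cu x 0).
  by rewrite distrC E sub0r normrM normrN ler_wpM2r.
have p0 : 0 <= 2 * pi :> R by rewrite mulr_ge0 ?pi_ge0.
have := bound _ _ (is_derive_Re_e l); have := bound _ _ (is_derive_Im_e l).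
rewrite (_ : e_ l 0 = 1); last by rewrite e_E mulr0 cos0 sin0.
move=> B1 B2; apply: le_trans (normc_le_ReIm _) _.
rewrite ReD ImD ReN ImN [leRHS]mulr_natl mulr2n lerD//.
  apply: B2 => y; rewrite normrM normrN normrM (ger0_norm p0) -[leRHS]mulr1.
  by rewrite ler_wpM2l ?mulr_ge0 ?pi_ge0// (le_trans (normc_Im _))// normc_e.
apply: B1 => y; rewrite normrM normrM (ger0_norm p0) -[leRHS]mulr1.
by rewrite ler_wpM2l ?mulr_ge0 ?pi_ge0// (le_trans (normc_Re _))// normc_e.
Qed.

Lemma Omega_bounded : exists2 M : R, 0 < M & forall x, Om x -> `|x| <= M.
Proof.
exists (1 + \sum_i (`|alpha i| + `|beta i|)).
  by rewrite ltr_wpDr// sumr_ge0// => i _; rewrite addr_ge0.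
move=> x [i /andP[ax xb]].
have H : `|x| <= `|alpha i| + `|beta i|.
  have := ler_norm (beta i); have := ler_norm (- alpha i); rewrite normrN.
  have := normr_ge0 (alpha i); have := normr_ge0 (beta i).
  by rewrite ler_norml; lra.
apply: (le_trans H); rewrite (bigD1 i)//= addrCA lerDl addr_ge0// sumr_ge0// => j _.
Qed.

Lemma exists_notin_spectrum (Lambda : set R) :
  orthogonal_exponentials Om Lambda -> exists m, ~ Lambda m.
Proof.
move=> oL; apply: contrapT => /forallNP/(_ _)/contrapT allL.
have [M M0 HM] := Omega_bounded.
(* This [l] makes the bound [2 * (2 * pi * l * M)] equal to 1, below the squared distance 2 that
   orthogonality of [e_ l] and [e_ 0] would force. *)
pose l : R := (2 * (2 * pi * M))^-1.
have p0 : 0 < pi :> R by exact: pi_gt0.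
have l0 : 0 < l by rewrite invr_gt0 !mulr_gt0.
have L2l := in_L2_e mOm Ofin l; have L20 := in_L2_e mOm Ofin 0.
have lb : L2norm Om (fun x => e_ l x - 1 * e_ 0 x) <= 1.
  apply: L2norm_le_bound => //; first by apply: in_L2B => //; exact: in_L2Z.
  move=> x /HM xM; rewrite e_0 mulr1 (le_trans (normc_e_sub1 _ _))//.
  apply: (@le_trans _ _ (2 * (2 * pi * l * M))).
    rewrite (gtr0_norm l0) ler_pM2l// ler_wpM2l// ltW// !mulr_gt0//.
  have -> : 2 * (2 * pi * l * M) = (2 * (2 * pi * M)) * l by ring.
  by rewrite divff// gt_eqF// !mulr_gt0.
have := L2norm_sub_sqr mOm Opos 1 L2l L20.
have eN m : L2norm Om (e_ m) ^+ 2 = 1 by rewrite L2norm_Re// inner_e_e.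
rewrite (oL _ _ (allL l) (allL 0)) ?gt_eqF// mulr0 (_ : complex.Re 0 = 0)//.
rewrite mulr0 subr0 (eN l) (eN 0) normc1 expr1n mulr1 => E.
have : L2norm Om (fun x => e_ l x - 1 * e_ 0 x) ^+ 2 <= 1.
  by rewrite expr_le1// L2norm_ge0.
by rewrite E; lra.
Qed.

End omega_spectral.

Lemma normc_sum_le (R : rcfType) (I : Type) (s : seq I) (z : I -> R[i]) :
  normc (\sum_(i <- s) z i) <= \sum_(i <- s) normc (z i).
Proof.
elim/big_ind2: _ => [|x a y b xa yb|//]; first by rewrite normc0.
by apply: le_trans (lerD xa yb); exact: le_normcD.
Qed.

(** * Integrals over subsets, bounded through the L^2 norm *)

Section integral_bound.
Context {R : realType}.
Notation mu := (@lebesgue_measure R).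
Variables A D : set R.
Hypothesis mA : measurable A.
Hypothesis mD : measurable D.
Hypothesis sAD : A `<=` D.
Hypothesis Dfin : (mu D < +oo)%E.
Hypothesis Dpos : 0 < length D.

(** Integrates [|q| <= (t + |q|^2 / t) / 2]. The parameter is free: [t] near the norm of [q] gives
    the L^2 bound below, while a large [t] on a short set gives equicontinuity. *)
Lemma normc_cintegral_AMGM t q : in_L2 D q -> 0 < t ->
  normc (cintegral A q) <= t * length A + t^-1 * (length D * L2norm D q ^+ 2).
Proof.
move=> L2q t0; have L2qA := in_L2_sub mA mD sAD L2q.
have mA' : @measurable _ (measurableTypeR R) A := mA.
have Afin : (mu A < +oo)%E by apply: le_lt_trans Dfin; exact: le_lebesgue.
have i1 : mu.-integrable A (EFin \o fun=> 1).
  have h1 : in_L2 A (fun=> 1 : R[i]).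
    by apply: (in_L2_bounded mA Afin (M := 1)) => // x _; rewrite normc1.
  by have [] := in_L2_cintegrable mA Afin h1.
have iq (X : set R) : measurable X -> in_L2 X q ->
    mu.-integrable X (EFin \o (fun x => normc (q x) ^+ 2)).
  move=> mX [mr mi fi]; apply/integrable_ge0P => //; last by move=> x _; exact: sqr_ge0.
  by under eq_fun do rewrite normc_sqr; apply: measurable_funD; apply: measurable_funX.
have iqA := iq A mA L2qA.
have it : mu.-integrable A (EFin \o (fun x => t * 1)) by exact: integrable_scale.
have iqt : mu.-integrable A (EFin \o (fun x => t^-1 * normc (q x) ^+ 2)).
  exact: (@integrable_scale _ _ _ mu _ mA').
have itq := @integrable_add _ _ _ mu _ mA' _ _ it iqt.
apply: (@le_trans _ _ (2 * \int[mu]_(x in A)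
    (2^-1 * (t * 1 + t^-1 * normc (q x) ^+ 2)))).
  apply: normc_cintegral_le => //.
  - exact: in_L2_cintegrable.
  - exact: (@integrable_scale _ _ _ mu _ mA').
  - move=> x Ax; rewrite mulr1.
    have tn : t * t^-1 = 1 by rewrite divff// gt_eqF.
    have ti : 0 < t^-1 by rewrite invr_gt0.
    have : 0 <= t^-1 * (t - normc (q x)) ^+ 2 by rewrite mulr_ge0 ?sqr_ge0// ltW.
    have -> : t^-1 * (t - normc (q x)) ^+ 2 =
      (t * t^-1) * t - 2 * (t * t^-1) * normc (q x) + t^-1 * normc (q x) ^+ 2 by ring.
    by rewrite tn; set p := t^-1 * _; lra.
rewrite RintegralZl// mulrA divff ?pnatr_eq0// mul1r.
rewrite (RintegralD mA' it iqt) RintegralZl// RintegralZl//.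
rewrite Rintegral_cst// mul1r lerD2l ler_wpM2l ?invr_ge0 ?(ltW t0)//.
rewrite L2norm_sqrE// mulrA divff ?mul1r ?gt_eqF//.
apply: (Rintegral_subset mA mD sAD _ (iq D mD L2q)) => x _; exact: sqr_ge0.
Qed.

Lemma normc_cintegral_le_L2norm q : in_L2 D q ->
  normc (cintegral A q) <= 2 * length D * L2norm D q.
Proof.
move=> L2q; have N0 := L2norm_ge0 D q.
have lAD : length A <= length D.
  apply: fine_le; rewrite ?ge0_fin_numE//; last exact: le_lebesgue.
  by apply: le_lt_trans Dfin; exact: le_lebesgue.
apply/ler_addgt0Pr => e e0; set N := L2norm D q in N0 *.
(* The choice [t = N + d] is positive even when [N = 0], and this [d] makes the surplus over
   [2 * length D * N] exactly [e]. *)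
pose d := e / (2 * length D); have d0 : 0 < d by rewrite divr_gt0// mulr_gt0.
have Nd : 0 < N + d by rewrite ltr_wpDl.
apply: (le_trans (normc_cintegral_AMGM L2q Nd)); rewrite -/N.
have -> : 2 * length D * N + e = (N + d) * length D + (N + d) * length D.
  by rewrite /d; field; rewrite gt_eqF.
apply: lerD; first by rewrite ler_wpM2l// ltW.
rewrite ler_pdivrMl// [leRHS]mulrA -expr2 [leRHS]mulrC ler_wpM2l ?(ltW Dpos)//.
rewrite lerXn2r ?nnegrE ?(ltW Nd)// lerDl ltW//.
Qed.

End integral_bound.

(** * Boundary conditions *)

Section boundary_conditions.
Context {R : realType} {n : nat}.
Notation mu := (@lebesgue_measure R).
Variables alpha beta : 'I_n -> R.
Hypothesis n_gt0 : (0 < n)%N.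
Hypothesis lt_alpha_beta : forall i : 'I_n, alpha i < beta i.
Hypothesis lt_beta_alpha : forall i j : 'I_n, (i < j)%N -> beta i < alpha j.
Implicit Types (f g h k dh dk : R -> R[i]).
Local Notation Om := (Omega alpha beta).
Local Notation J i := `]alpha i, beta i[%classic.
Local Notation twopii := (two_pi_i R).

Let mOm : measurable Om := measurable_Omega alpha beta.
Let Ofin : (mu Om < +oo)%E := Omega_finite lt_alpha_beta lt_beta_alpha.
Let Opos : 0 < length Om := length_Omega_gt0 n_gt0 lt_alpha_beta lt_beta_alpha.

Definition right_vec h : 'cV[R[i]]_n := \col_i right_limit h (alpha i).
Definition left_vec h : 'cV[R[i]]_n := \col_i left_limit h (beta i).

Lemma two_pi_i_neq0 : twopii != 0.
Proof.
by rewrite eq_complex /= negb_and orbC mulf_neq0// gt_eqF// pi_gt0.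
Qed.

Lemma conj_two_pi_i : twopii^* = - twopii.
Proof. by apply: complex_eq; rewrite ?Re_conj ?Im_conj ?ReN ?ImN/= ?oppr0. Qed.

Lemma E_mulE (l : R) (u : 'I_n -> R) (c : 'cV[R[i]]_n) i :
  (E_ (l%:C *: cvec u) *m c) i 0 = e_ l (u i) * c i 0.
Proof. by rewrite mul_diag_mx !mxE /e_ -realCM. Qed.

Lemma right_vec_e l : right_vec (e_ l) = e_vec l alpha.
Proof.
by apply/matrixP => i j; rewrite !mxE (cvg_rightE (cvg_right_e l (alpha i))).
Qed.

Lemma left_vec_e l : left_vec (e_ l) = e_vec l beta.
Proof.
by apply/matrixP => i j; rewrite !mxE (cvg_leftE (cvg_left_e l (beta i))).
Qed.

Lemma Green_cdot h k dh dk : in_Dmax alpha beta h dh -> in_Dmax alpha beta k dk ->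
  inner Om dh k + inner Om h dk = (length Om)^-1%:C *
  (cdot (left_vec h) (left_vec k) - cdot (right_vec h) (right_vec k)).
Proof.
move=> hD kD; rewrite (Green lt_alpha_beta lt_beta_alpha hD kD) -sumrB.
by congr (_ * _); apply: eq_bigr => i _; rewrite !mxE.
Qed.

Lemma Dmax_limitsDZ h k dh dk (z : R[i]) : in_Dmax alpha beta h dh ->
  in_Dmax alpha beta k dk ->
  right_vec (fun x => h x + z * k x) = right_vec h + z *: right_vec k /\
  left_vec (fun x => h x + z * k x) = left_vec h + z *: left_vec k.
Proof.
move=> hD kD; split; apply/matrixP => i j; rewrite !mxE;
  have [hr hl _ _] := in_Dmax_limits lt_alpha_beta i hD;
  have [kr kl _ _] := in_Dmax_limits lt_alpha_beta i kD.
  by rewrite (cvg_rightE (cvg_rightDZ z hr kr)).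
by rewrite (cvg_leftE (cvg_leftDZ z hl kl)).
Qed.

Lemma in_Dmax_ae_eq h dh dk : in_Dmax alpha beta h dh -> in_L2 Om dk ->
  eq_on_ae Om dh dk -> in_Dmax alpha beta h dk.
Proof.
move=> [ach dhP _] L2dk E; split => //.
by apply: ae_mono (ae_and dhP E) => x [Hd Hk] Ox; rewrite -Hk//; exact: Hd.
Qed.

Lemma ae_eq_limits h k dh dk : in_Dmax alpha beta h dh -> in_Dmax alpha beta k dk ->
  eq_on_ae Om h k -> [/\ right_vec h = right_vec k, left_vec h = left_vec k &
    forall x, Om x -> h x = k x].
Proof.
move=> hD kD hk.
have E x : Om x -> h x + -1 * k x = 0.
  apply: (in_Dmax_ae0 (in_DmaxDZ (-1) hD kD)).
  by apply: ae_mono hk => y /[apply] ->; rewrite mulN1r subrr.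
have [Er El] := Dmax_limitsDZ (-1) hD kD.
split.
- apply/eqP; rewrite -subr_eq0 -scaleN1r -Er; apply/eqP/matrixP => i j.
  by rewrite !mxE (cvg_rightE (Omega0_limits lt_alpha_beta i E).1).
- apply/eqP; rewrite -subr_eq0 -scaleN1r -El; apply/eqP/matrixP => i j.
  by rewrite !mxE (cvg_leftE (Omega0_limits lt_alpha_beta i E).2).
- by move=> x /E/eqP; rewrite mulN1r subr_eq0 => /eqP.
Qed.

Variable B : 'M[R[i]]_n.
Hypothesis uB : B \is unitarymx.

(** Speaks of an actual function [h] and its derivative [dh], where [operator_of_matrix] speaks of
    classes and of [dh / (2 pi i)]. *)
Definition in_domain h dh : Prop :=
  in_Dmax alpha beta h dh /\ B *m right_vec h = left_vec h.

(** A unitary [B] preserves [cdot], so Green's boundary term cancels. Since [2 pi i] is imaginary,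
    the vanishing of this sum is the symmetry of [dh / (2 pi i)]. *)
Lemma in_domain_symmetric h k dh dk : in_domain h dh -> in_domain k dk ->
  inner Om dh k + inner Om h dk = 0.
Proof.
move=> [hD hB] [kD kB]; rewrite (Green_cdot hD kD) -hB -kB.
by rewrite unitary_cdot// subrr mulr0.
Qed.

Lemma in_domainDZ h k dh dk (z : R[i]) : in_domain h dh -> in_domain k dk ->
  in_domain (fun x => h x + z * k x) (fun x => dh x + z * dk x).
Proof.
move=> [hD hB] [kD kB]; split; first exact: in_DmaxDZ.
have [-> ->] := Dmax_limitsDZ z hD kD.
by rewrite mulmxDr -scalemxAr hB kB.
Qed.

(** [c] lists the amplitudes of a function equal to [c i * e_ l] on the i-th interval, and the
    equation is its boundary condition. By [in_domain_step_e] and [in_domain_eigen] these functions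
    are the eigenfunctions at frequency [l]. *)
Definition boundary_solution (l : R) (c : 'cV[R[i]]_n) : Prop :=
  B *m E_ (l%:C *: cvec alpha) *m c = E_ (l%:C *: cvec beta) *m c.

Lemma boundary_solutionE l c : boundary_solution l c =
  (B *m (E_ (l%:C *: cvec alpha) *m c) = E_ (l%:C *: cvec beta) *m c).
Proof. by rewrite /boundary_solution mulmxA. Qed.

Lemma in_domain_step_e l c : boundary_solution l c ->
  in_domain (fun x => step alpha beta (fun i => c i 0) x * e_ l x)
    (fun x => twopii * l%:C * (step alpha beta (fun i => c i 0) x * e_ l x)).
Proof.
set s := step alpha beta _ => cB.
have sD := in_Dmax_step lt_beta_alpha (fun i => c i 0).
(* The product lemmas multiply by a conjugate, hence the detour through [- l]. *)
have eE x : e_ l x = (e_ (- l) x)^* by rewrite e_N conjCK.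
have fE : (fun x => s x * e_ l x) = (fun x => s x * (e_ (- l) x)^*).
  by apply: funext => x; rewrite eE.
split.
  have := in_Dmax_mulJe lt_alpha_beta lt_beta_alpha (- l) sD.
  rewrite fE; congr in_Dmax; apply: funext => x; rewrite -eE.
  by rewrite rmorphN/= -/s; ring.
have rE : right_vec (fun x => s x * e_ l x) = E_ (l%:C *: cvec alpha) *m c.
  apply/matrixP => i j; rewrite ord1 E_mulE mxE fE.
  have sr := cvg_right_step lt_alpha_beta lt_beta_alpha (fun i => c i 0) i.
  by rewrite (cvg_rightE (cvg_rightMJ sr (cvg_right_e (- l) _))) -eE mulrC.
have lE : left_vec (fun x => s x * e_ l x) = E_ (l%:C *: cvec beta) *m c.
  apply/matrixP => i j; rewrite ord1 E_mulE mxE fE.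
  have sl := cvg_left_step lt_alpha_beta lt_beta_alpha (fun i => c i 0) i.
  by rewrite (cvg_leftE (cvg_leftMJ sl (cvg_left_e (- l) _))) -eE mulrC.
rewrite boundary_solutionE in cB.
rewrite rE lE; exact: cB.
Qed.

(** Multiplication by [(e_ l x)^*], the inverse of [e_ l x], leaves derivative 0, so the quotient
    [p] is constant on each interval. *)
Lemma in_domain_eigen h l : in_domain h (fun x => twopii * l%:C * h x) ->
  exists2 c, boundary_solution l c &
  forall x, Om x -> h x = step alpha beta (fun i => c i 0) x * e_ l x.
Proof.
move=> [hD hB]; have pD := in_Dmax_mulJe lt_alpha_beta lt_beta_alpha l hD.
set p := (fun x => h x * (e_ l x)^*) in pD.
have {}pD : in_Dmax alpha beta p (fun=> 0).
  apply: (in_Dmax_ae_eq pD); first exact: in_L20.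
  by apply: ae_all => x _; rewrite subrr mul0r.
have p_const i x : alpha i < x < beta i -> p x = right_limit p (alpha i).
  move=> axb; have [_ _ _ /(_ x axb)] := in_Dmax_limits lt_alpha_beta i pD.
  rewrite (_ : cintegral _ _ = 0) => [/eqP|]; first by rewrite subr_eq0 => /eqP.
  by rewrite /cintegral/= /Rintegral integral0.
have hE x : h x = p x * e_ l x.
  by rewrite /p -mulrA [X in _ * X]mulrC e_conj_e mulr1.
have hs x : Om x -> h x = step alpha beta (fun i => right_vec p i 0) x * e_ l x.
  move=> [i axb]; rewrite hE (p_const i)// (stepE lt_beta_alpha _ axb) mxE//.
exists (right_vec p) => //.
have pl i : left_limit p (beta i) = right_limit p (alpha i).
  apply: cvg_leftE; apply: eq_cvg_left (lt_alpha_beta i) _ (cvg_left_cst _ _).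
  by move=> x /p_const.
have eE (q : R) : e_ l q = (e_ (- l) q)^* by rewrite e_N conjCK.
have hpE : h = (fun x => p x * (e_ (- l) x)^*) by apply: funext => x; rewrite hE -eE.
have rE : right_vec h = E_ (l%:C *: cvec alpha) *m right_vec p.
  apply/matrixP => i j; rewrite ord1 E_mulE !mxE hpE.
  have [pr _ _ _] := in_Dmax_limits lt_alpha_beta i pD.
  by rewrite (cvg_rightE (cvg_rightMJ pr (cvg_right_e (- l) _))) -eE mulrC.
have lE : left_vec h = E_ (l%:C *: cvec beta) *m right_vec p.
  apply/matrixP => i j; rewrite ord1 E_mulE !mxE hpE.
  have [_ pl' _ _] := in_Dmax_limits lt_alpha_beta i pD.
  by rewrite (cvg_leftE (cvg_leftMJ pl' (cvg_left_e (- l) _))) -eE mulrC pl.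
by rewrite boundary_solutionE; move: hB; rewrite rE lE.
Qed.

Lemma boundary_unitmx l : (forall c, boundary_solution l c -> c = 0) ->
  B *m E_ (l%:C *: cvec alpha) - E_ (l%:C *: cvec beta) \in unitmx.
Proof.
set M := _ - _ => H; rewrite -unitmx_tr -row_free_unit -kermx_eq0.
apply/negPn/negP => /rowV0Pn[u /sub_kermxP uM /eqP]; apply.
have : u^T = 0.
  apply: H; rewrite /boundary_solution; apply/eqP; rewrite -subr_eq0 -mulmxBl.
  by rewrite -/M -[M]trmxK -trmx_mul uM trmx0.
by move/(congr1 trmx); rewrite trmxK trmx0.
Qed.

(* Writing h = w e_l, the equation h' = 2 pi i (g + l h) becomes
   w' = 2 pi i g e_(-l), and the boundary condition a linear system for w(alpha). *)
Lemma in_domain_solve l : (forall c, boundary_solution l c -> c = 0) ->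
  exists2 C : R, 0 <= C & forall g, in_L2 Om g ->
  exists2 h, in_domain h (fun x => twopii * (g x + l%:C * h x)) &
    forall x, Om x -> normc (h x) <= C * L2norm Om g.
Proof.
move=> /boundary_unitmx; set M := _ - _ => uM.
pose K : R := \sum_i \sum_j normc ((invmx M *m E_ (l%:C *: cvec beta)) i j).
pose L : R := 2 * length Om * normc twopii.
have L0 : 0 <= L by rewrite !mulr_ge0 ?normc_ge0// ltW.
have K0 : 0 <= K by rewrite sumr_ge0// => i _; rewrite sumr_ge0// => j _; exact: normc_ge0.
(* Relative to the norm of [g], [K * L] bounds the initial value of [w] at each [alpha i], and [L]
   bounds its increment inside the interval. *)
exists ((K + 1) * L) => [|g L2g]; first by rewrite mulr_ge0// ltW// ltr_wpDl.
pose q x := twopii * (e_ (- l) x * g x).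
have L2eg : in_L2 Om (fun x => e_ (- l) x * g x).
  apply: in_L2_mul_le1 => //.
  - exact: measurable_Re_e.
  - exact: measurable_Im_e.
  - by move=> x _; rewrite normc_e.
have L2q : in_L2 Om q by exact: in_L2Z.
have Iq (X : set R) : measurable X -> X `<=` Om ->
    normc (cintegral X q) <= L * L2norm Om g.
  move=> mX XO; apply: (le_trans (normc_cintegral_le_L2norm mX mOm XO Ofin Opos L2q)).
  rewrite (L2normZ mOm Opos _ L2eg) mulrA.
  rewrite (_ : L2norm Om (fun x => e_ (- l) x * g x) = L2norm Om g)//.
  by congr (Num.sqrt (_ * _)); apply: eq_Rintegral => x _; rewrite normcM normc_e mul1r.
pose I : 'cV[R[i]]_n := \col_i cintegral (J i) q.
(* [I] collects the increments of [w] across the intervals, so the boundary condition reads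
   [B E(l alpha) v = E(l beta) (v + I)], that is, [M v = E(l beta) I]. *)
pose v := invmx M *m (E_ (l%:C *: cvec beta) *m I).
have [w wD wv] := in_Dmax_primitive lt_alpha_beta lt_beta_alpha (fun i => v i 0) L2q.
have eE (x : R) : e_ l x = (e_ (- l) x)^* by rewrite e_N conjCK.
pose h x := w x * e_ l x.
have fE : h = (fun x => w x * (e_ (- l) x)^*) by apply: funext => x; rewrite /h eE.
exists h; first split.
  have := in_Dmax_mulJe lt_alpha_beta lt_beta_alpha (- l) wD.
  rewrite fE; congr in_Dmax; apply: funext => x.
  rewrite -eE rmorphN/= /q e_N.
  have E1 : (e_ l x)^* * e_ l x = 1 by rewrite mulrC e_conj_e.
  transitivity (twopii * g x * ((e_ l x)^* * e_ l x) + twopii * l%:C * w x * e_ l x).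
    by ring.
  by rewrite E1; ring.
have rE : right_vec h = E_ (l%:C *: cvec alpha) *m v.
  apply/matrixP => i j; rewrite ord1 E_mulE mxE fE.
  have [wr _ _ _] := in_Dmax_limits lt_alpha_beta i wD; rewrite wv in wr.
  by rewrite (cvg_rightE (cvg_rightMJ wr (cvg_right_e (- l) _))) -eE mulrC.
have lE : left_vec h = E_ (l%:C *: cvec beta) *m (v + I).
  apply/matrixP => i j; rewrite ord1 E_mulE mxE [(v + I) i 0]mxE [I i 0]mxE fE.
  have [_ wl /eqP + _] := in_Dmax_limits lt_alpha_beta i wD.
  rewrite wv subr_eq addrC => /eqP wlE; rewrite wlE in wl.
  by rewrite (cvg_leftE (cvg_leftMJ wl (cvg_left_e (- l) _))) -eE mulrC addrC.
have Mv : M *m v = E_ (l%:C *: cvec beta) *m I by rewrite /v mulKVmx.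
rewrite rE lE mulmxDr mulmxA; move: Mv; rewrite /M mulmxBl => <-.
by rewrite addrC subrK.
move=> x [i axb]; rewrite /h normcM normc_e mulr1.
have [_ _ _ /(_ x axb) /eqP] := in_Dmax_limits lt_alpha_beta i wD.
rewrite wv subr_eq => /eqP ->; apply: (le_trans (le_normcD _ _)).
rewrite addrC (mulrDl K) mul1r (mulrDl (K * L)); apply: lerD.
  rewrite /v mulmxA mxE; apply: (le_trans (normc_sum_le _ _)).
  have N0 : 0 <= L * L2norm Om g by rewrite mulr_ge0 ?L2norm_ge0.
  apply: (@le_trans _ _ (\sum_j normc ((invmx M *m E_ (l%:C *: cvec beta)) i j) *
      (L * L2norm Om g))).
    apply: ler_sum => j _; rewrite normcM ler_wpM2l ?normc_ge0// mxE.
    by apply: Iq; [exact: measurable_itv|exact: itv_sub_Omega].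
  rewrite -mulr_suml -[K * L * _]mulrA ler_wpM2r// /K [leRHS](bigD1 i)//= lerDl.
  by rewrite sumr_ge0// => k _; rewrite sumr_ge0// => j _; exact: normc_ge0.
apply: Iq => [|y]; first exact: measurable_itv.
rewrite /= in_itv/= => /andP[ay yx]; exists i; rewrite ay/=.
by case/andP: axb => _; exact: le_lt_trans.
Qed.

End boundary_conditions.

(** * From a spectrum to its boundary matrix *)

Section spectrum_to_matrix.
Context {R : realType} {n : nat}.
Notation mu := (@lebesgue_measure R).
Variables alpha beta : 'I_n -> R.
Hypothesis n_gt0 : (0 < n)%N.
Hypothesis lt_alpha_beta : forall i : 'I_n, alpha i < beta i.
Hypothesis lt_beta_alpha : forall i j : 'I_n, (i < j)%N -> beta i < alpha j.
Implicit Types (f g h k dh dk : R -> R[i]).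
Local Notation Om := (Omega alpha beta).
Local Notation twopii := (two_pi_i R).
Local Notation left_vec := (left_vec beta).
Local Notation right_vec := (right_vec alpha).

Let mOm : measurable Om := measurable_Omega alpha beta.
Let Ofin : (mu Om < +oo)%E := Omega_finite lt_alpha_beta lt_beta_alpha.
Let Opos : 0 < length Om := length_Omega_gt0 n_gt0 lt_alpha_beta lt_beta_alpha.

(** The left side measures, up to the factor [2 pi i], how far [h] and [dh / (2 pi i)] are from the
    relation that characterizes [A_] in [A_P]; this defect is a pure boundary term. *)
Lemma Green_e h dh l : in_Dmax alpha beta h dh ->
  coef Om dh l - twopii * l%:C * coef Om h l = (length Om)^-1%:C *
  (cdot (left_vec h) (e_vec l beta) - cdot (right_vec h) (e_vec l alpha)).
Proof.
move=> hD; have eD := in_Dmax_e lt_alpha_beta lt_beta_alpha l.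
have L2h := in_Dmax_in_L2 lt_alpha_beta lt_beta_alpha hD.
have := Green_cdot lt_alpha_beta lt_beta_alpha hD eD.
rewrite left_vec_e right_vec_e => <-; rewrite innerZr//; last exact: in_L2_e.
by rewrite conj_mul conj_realC conj_two_pi_i mulNr mulNr.
Qed.

Lemma cdot_e_vec Lambda l m : orthogonal_exponentials Om Lambda ->
  Lambda l -> Lambda m ->
  cdot (e_vec l beta) (e_vec m beta) = cdot (e_vec l alpha) (e_vec m alpha).
Proof.
move=> oL Ll Lm; have := Green_e m (in_Dmax_e lt_alpha_beta lt_beta_alpha l).
rewrite left_vec_e right_vec_e /coef innerZl//; try exact: in_L2_e.
have -> : twopii * l%:C * inner Om (e_ l) (e_ m) -
    twopii * m%:C * inner Om (e_ l) (e_ m) = 0.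
  have [->|lm] := eqVneq l m; first by rewrite subrr.
  by rewrite (oL _ _ Ll Lm lm) !mulr0 subrr.
move/esym/eqP; rewrite mulf_eq0 (negPf (length_gt0C Opos))/= subr_eq0.
by move/eqP.
Qed.

(** Green's formula read backwards: the boundary term is 0 and the factor [l - m] is not. *)
Lemma orthogonal_of_cdot Lambda :
  (forall l m, Lambda l -> Lambda m ->
    cdot (e_vec l beta) (e_vec m beta) = cdot (e_vec l alpha) (e_vec m alpha)) ->
  orthogonal_exponentials Om Lambda.
Proof.
move=> H l m Ll Lm lm; have := Green_e m (in_Dmax_e lt_alpha_beta lt_beta_alpha l).
rewrite left_vec_e right_vec_e H// subrr mulr0 /coef innerZl//; try exact: in_L2_e.
rewrite -mulrBl -mulrBr => /eqP; rewrite mulf_eq0 => /orP[|/eqP//].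
by rewrite mulf_eq0 (negPf (@two_pi_i_neq0 R)) realCB_eq0 (negPf lm).
Qed.

Variable Lambda : set R.
Hypothesis sL : spectrum Om Lambda.
Local Notation A := (A_ Om Lambda).

Let AP f g := A_P mOm Ofin Opos f g sL.

Lemma in_Dmax_A h dh : in_Dmax alpha beta h dh ->
  (forall l, Lambda l ->
    cdot (left_vec h) (e_vec l beta) = cdot (right_vec h) (e_vec l alpha)) ->
  A h (fun x => twopii^-1 * dh x).
Proof.
move=> hD H; have [_ _ L2dh] := hD.
apply/AP; split; [exact: in_Dmax_in_L2 hD|exact: in_L2Z|] => l Ll.
have := Green_e l hD; rewrite H// subrr mulr0 => /eqP; rewrite subr_eq0 => /eqP E.
rewrite /coef innerZl//; last exact: in_L2_e.
by rewrite -/(coef Om dh l) E -mulrA mulKf// two_pi_i_neq0.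
Qed.

(** Symmetry of [A] tested on [h] against itself: since [2 pi i] is imaginary, it says that Green's
    boundary term vanishes. *)
Lemma A_cdot h dh : in_Dmax alpha beta h dh -> A h (fun x => twopii^-1 * dh x) ->
  cdot (left_vec h) (left_vec h) = cdot (right_vec h) (right_vec h).
Proof.
move=> hD Ah; have [_ _ L2dh] := hD.
have L2h := in_Dmax_in_L2 lt_alpha_beta lt_beta_alpha hD.
have := A_symmetric mOm Ofin Opos sL Ah Ah.
rewrite innerZl// innerZr// fmorphV/= conj_two_pi_i invrN mulNr => /eqP.
rewrite -subr_eq0 opprK -mulrDr mulf_eq0 invr_eq0 (negPf (@two_pi_i_neq0 R))/=.
rewrite (Green_cdot lt_alpha_beta lt_beta_alpha hD hD).
by rewrite mulf_eq0 (negPf (length_gt0C Opos))/= subr_eq0 => /eqP.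
Qed.

(* Interpolate v at the left endpoints and 0 at the right ones: the resulting
   function lies in the domain of the symmetric operator A, so |v|^2 = |0|^2. *)
Lemma e_vec_alpha_total v :
  (forall s, [set e_vec l alpha | l in Lambda] s -> cdot v s = 0) -> v = 0.
Proof.
move=> vL; have [h [dh [hD hr hl]]] :=
  in_Dmax_interpolate lt_alpha_beta lt_beta_alpha (fun i => v i 0) (fun=> 0).
have rE : right_vec h = v by apply/matrixP => i j; rewrite ord1 mxE hr.
have lE : left_vec h = 0 by apply/matrixP => i j; rewrite ord1 !mxE hl.
have c0 w : cdot 0 w = 0 :> R[i] by apply: big1 => i _; rewrite mxE mul0r.
apply: cdot_self_eq0; rewrite -rE -(A_cdot hD) ?lE ?c0//.
by apply: in_Dmax_A => // l Ll; rewrite rE lE c0 vL//; exists l.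
Qed.

(** The argument for [alpha] with the two kinds of endpoints exchanged. *)
Lemma e_vec_beta_total v :
  (forall s, [set e_vec l beta | l in Lambda] s -> cdot v s = 0) -> v = 0.
Proof.
move=> vL; have [h [dh [hD hr hl]]] :=
  in_Dmax_interpolate lt_alpha_beta lt_beta_alpha (fun=> 0) (fun i => v i 0).
have rE : right_vec h = 0 by apply/matrixP => i j; rewrite ord1 !mxE hr.
have lE : left_vec h = v by apply/matrixP => i j; rewrite ord1 mxE hl.
have c0 w : cdot 0 w = 0 :> R[i] by apply: big1 => i _; rewrite mxE mul0r.
apply: cdot_self_eq0; rewrite -lE (A_cdot hD) ?rE ?c0//.
by apply: in_Dmax_A => // l Ll; rewrite rE lE c0 vL//; exists l.
Qed.

(** Pick [n] frequencies whose vectors at [alpha] form a basis [P], let [Q] hold the corresponding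
    vectors at [beta], and put [B = Q P^-1]. Equal Gram matrices make [B] unitary, and the chosen
    columns already determine it. *)
Lemma exists_boundary_matrix : exists B : 'M[R[i]]_n, B \is unitarymx /\
  unique (fun M : 'M[R[i]]_n => forall l : R, Lambda l ->
    M *m e_vec l alpha = e_vec l beta) B.
Proof.
have col_mul (M N : 'M[R[i]]_n) j : col j (M *m N) = M *m col j N.
  by rewrite !colE mulmxA.
have [w [wS uP]] := exists_unit_columns e_vec_alpha_total.
have /choice[m Hm] j : exists l : R, Lambda l /\ e_vec l alpha = w j.
  by have [l Ll lw] := wS j; exists l.
set P := (\matrix_(i, j) _) in uP.
pose Q : 'M[R[i]]_n := \matrix_(i, j) e_ (m j) (beta i).
have PE j : col j P = e_vec (m j) alpha.
  by rewrite (Hm j).2; apply/matrixP => i k; rewrite !mxE ord1.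
have QE j : col j Q = e_vec (m j) beta by apply/matrixP => i k; rewrite !mxE.
have gram : map_mx Num.conj Q^T *m Q = map_mx Num.conj P^T *m P.
  apply/matrixP => j k; have := cdot_e_vec sL.1 (Hm k).1 (Hm j).1.
  rewrite -!PE -!QE => E; transitivity (cdot (col k Q) (col j Q)).
    by rewrite mxE; apply: eq_bigr => i _; rewrite !mxE mulrC.
  by rewrite E mxE; apply: eq_bigr => i _; rewrite !mxE mulrC.
pose B := Q *m invmx P; have BP : B *m P = Q by rewrite mulmxKV.
have uB : B \is unitarymx.
  apply/unitarymxP; apply: mulmx1C; rewrite /B trmx_mul map_mxM mulmxA.
  rewrite -[X in X *m _]mulmxA gram mulmxA -map_mxM -trmx_mul mulmxV//.
  by rewrite trmx1 map_mx1 mul1mx mulmxV.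
have Be j : B *m e_vec (m j) alpha = e_vec (m j) beta.
  by rewrite -PE -QE -BP col_mul.
exists B; split => //; split.
  (* For any other [l] both sides have the same products with the columns of [Q], by the Gram
     identity and unitarity, and these columns form a basis. *)
  move=> l Ll; apply/eqP; rewrite eq_sym -subr_eq0; apply/eqP.
  have uQ : map_mx Num.conj Q^T \in unitmx.
    rewrite map_unitmx unitmx_tr -BP unitmx_mul uP andbT.
    exact: unitarymx_unit.
  apply: (can_inj (mulKmx uQ)); rewrite mulmx0 mulmxBr.
  apply/matrixP => j k; rewrite ord1 mxE [RHS]mxE.
  have E1 (v : 'cV[R[i]]_n) : (map_mx Num.conj Q^T *m v) j 0 = cdot v (e_vec (m j) beta).
    by rewrite mxE; apply: eq_bigr => i _; rewrite !mxE mulrC.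
  rewrite E1 [X in _ + X]mxE E1 (cdot_e_vec sL.1 Ll (Hm j).1) -Be.
  by rewrite unitary_cdot// subrr.
move=> M HM; have MP : M *m P = Q.
  apply/matrixP => i j; have := HM (m j) (Hm j).1; rewrite -PE -QE => E.
  have := congr1 (fun W : 'cV_n => W i 0) E; rewrite [RHS]mxE => <-.
  by rewrite -col_mul [RHS]mxE.
by rewrite /B -MP mulmxK.
Qed.

Section fixed_matrix.
Variable B : 'M[R[i]]_n.
Hypothesis uB : B \is unitarymx.
Hypothesis Be : forall l, Lambda l -> B *m e_vec l alpha = e_vec l beta.

(** The first inclusion between the two operators: [B] carries the pair [right_vec h],
    [e_vec l alpha] to the pair at [beta] and preserves [cdot]. *)
Lemma in_domain_A h dh : in_domain alpha beta B h dh ->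
  A h (fun x => twopii^-1 * dh x).
Proof.
move=> [hD hB]; apply: in_Dmax_A => // l Ll.
by rewrite -hB -Be// unitary_cdot.
Qed.

(** The function with amplitudes [c] is an eigenfunction of [A] at [l]. For every [m] in [Lambda]
    its coefficient at [m] is killed by [l - m], which is nonzero, so the function vanishes. *)
Lemma boundary_solution_notin l c : ~ Lambda l ->
  boundary_solution alpha beta B l c -> c = 0.
Proof.
move=> nLl cB.
have sD := in_domain_step_e lt_alpha_beta lt_beta_alpha cB.
have L2s := in_Dmax_in_L2 lt_alpha_beta lt_beta_alpha sD.1.
have := in_domain_A sD => /AP[_ _ H].
set s := (fun x => step _ _ _ x * _) in sD L2s H.
have s0 m : Lambda m -> coef Om s m = 0.
  move=> Lm; have := H m Lm; rewrite (_ : (fun x => _) = (fun x => l%:C * s x)); last first.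
    by apply: funext => x; rewrite -mulrA mulKf// two_pi_i_neq0.
  rewrite /coef innerZl//; last exact: in_L2_e.
  move/eqP; rewrite -subr_eq0 -mulrBl mulf_eq0 realCB_eq0 => /orP[/eqP lm|/eqP//].
  by case: nLl; rewrite lm.
have := L2norm_eq0 mOm Opos L2s (spectrum_coef0 mOm Ofin Opos sL L2s s0).
move=> /(in_Dmax_ae0 sD.1) sz; apply/matrixP => i j; rewrite ord1 mxE.
have axb : alpha i < (alpha i + beta i) / 2 < beta i.
  by apply/andP; split; have := lt_alpha_beta i; lra.
have /eqP := sz _ (ex_intro _ i axb).
by rewrite /s (stepE lt_beta_alpha _ axb) mulf_eq0 (negPf (e_neq0 _ _)) orbF => /eqP.
Qed.

Lemma A_boundary_matrix : boundary_matrix alpha beta A B.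
Proof.
split => // f g; split; last first.
  move=> [L2f L2g [h [dh [hD hB fh gdh]]]].
  have /AP[L2h L2dh H] := in_domain_A (conj hD hB).
  apply/AP; split => // l Ll; have L2e := in_L2_e mOm Ofin l.
  rewrite /coef (ae_eq_inner mOm L2f L2h L2e fh) (ae_eq_inner mOm L2g L2dh L2e gdh).
  exact: H.
move=> /AP[L2f L2g fg]; split => //.
have [m nLm] := exists_notin_spectrum n_gt0 lt_alpha_beta lt_beta_alpha sL.1.
(* [k] solves the resolvent equation with right side [g - m f]. The coefficients of [f] and of [k]
   both satisfy [(l - m) coef = coef (g - m f)], and [l] differs from [m], so [f = k] almost
   everywhere. *)
have L2q : in_L2 Om (fun x => g x - m%:C * f x) by apply: in_L2B => //; exact: in_L2Z.
have [_ _ /(_ _ L2q)[k kD _]] := in_domain_solve n_gt0 lt_alpha_beta lt_beta_alpha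
  (fun c => @boundary_solution_notin m c nLm).
have L2k := in_Dmax_in_L2 lt_alpha_beta lt_beta_alpha kD.1.
have L2d : in_L2 Om (fun x => f x - k x) by exact: in_L2B.
have d0 l : Lambda l -> coef Om (fun x => f x - k x) l = 0.
  move=> Ll; have L2e := in_L2_e mOm Ofin l.
  have := in_domain_A kD => /AP[_ _ /(_ l Ll)].
  rewrite (_ : (fun x => _) = (fun x => (g x - m%:C * f x) + m%:C * k x)); last first.
    by apply: funext => x; rewrite mulKf// two_pi_i_neq0.
  have L2mf : in_L2 Om (fun x => m%:C * f x) by exact: in_L2Z.
  have L2mk : in_L2 Om (fun x => m%:C * k x) by exact: in_L2Z.
  have := fg l Ll; rewrite /coef => fgl.
  rewrite (innerDl mOm L2q L2mk L2e) (innerBl mOm L2g L2mf L2e) fgl.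
  rewrite !innerZl// => E.
  rewrite innerBl//; have : (l%:C - m%:C) * (inner Om f (e_ l) - inner Om k (e_ l)) = 0.
    by rewrite mulrBl !mulrBr -E; ring.
  move/eqP; rewrite mulf_eq0 realCB_eq0 => /orP[/eqP lm|/eqP//].
  by case: nLm; rewrite -lm.
have fk : eq_on_ae Om f k.
  have := L2norm_eq0 mOm Opos L2d (spectrum_coef0 mOm Ofin Opos sL L2d d0).
  by apply: ae_mono => x /[apply] /eqP; rewrite subr_eq0 => /eqP.
exists k, (fun x => twopii * (g x - m%:C * f x + m%:C * k x)); split => //.
- exact: kD.1.
- exact: kD.2.
- apply: ae_mono fk => x /[apply] ->.
  by rewrite mulKf ?two_pi_i_neq0// subrK.
Qed.

(** For [l] in [Lambda] the eigenfunction [s] with amplitudes [c] has no coefficient away from [l].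
    Subtracting [a * e_ l] with [a = coef s l] therefore leaves zero, and every amplitude equals
    [a]. *)
Lemma A_spectral_matrix : spectral_matrix alpha beta B.
Proof.
split => // l /=; have [Ll|nLl] := pselect (Lambda l); last first.
  by left => c; exact: boundary_solution_notin.
right => c cB; have sD := in_domain_step_e lt_alpha_beta lt_beta_alpha cB.
have L2s := in_Dmax_in_L2 lt_alpha_beta lt_beta_alpha sD.1.
have eD := in_Dmax_e lt_alpha_beta lt_beta_alpha l.
have := in_domain_A sD => /AP[_ _ H].
set s := (fun x => step _ _ _ x * _) in sD L2s H.
have L2e m := in_L2_e mOm Ofin m.
pose a := coef Om s l; exists a.
have L2d : in_L2 Om (fun x => s x + - a * e_ l x) by apply: in_L2D => //; exact: in_L2Z.
have d0 m : Lambda m -> coef Om (fun x => s x + - a * e_ l x) m = 0.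
  move=> Lm; rewrite /coef innerDl ?innerZl//; last exact: in_L2Z.
  have [->|ml] := eqVneq m l; first by rewrite inner_e_e// mulr1 subrr.
  rewrite (sL.1 l m)//; last by rewrite eq_sym.
  have := H m Lm; rewrite (_ : (fun x => _) = (fun x => l%:C * s x)); last first.
    by apply: funext => x; rewrite -mulrA mulKf// two_pi_i_neq0.
  rewrite /coef innerZl// mulr0 addr0.
  move/eqP; rewrite -subr_eq0 -mulrBl mulf_eq0 realCB_eq0 => /orP[/eqP lm|/eqP//].
  by rewrite lm eqxx in ml.
have := L2norm_eq0 mOm Opos L2d (spectrum_coef0 mOm Ofin Opos sL L2d d0).
move=> /(in_Dmax_ae0 (in_DmaxDZ (- a) sD.1 eD)) sz.
apply/matrixP => i j; rewrite ord1 mxE.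
have axb : alpha i < (alpha i + beta i) / 2 < beta i.
  by apply/andP; split; have := lt_alpha_beta i; lra.
have /eqP := sz _ (ex_intro _ i axb).
rewrite /s (stepE lt_beta_alpha _ axb) -mulrDl mulf_eq0 (negPf (e_neq0 _ _)) orbF.
by rewrite subr_eq0 => /eqP.
Qed.

End fixed_matrix.

(** [e_ l] lies in the domain of [A], so it equals almost everywhere some [h] that satisfies the
    boundary condition of [M]; two such representatives share their boundary values. *)
Lemma boundary_matrix_e M : boundary_matrix alpha beta A M ->
  forall l, Lambda l -> M *m e_vec l alpha = e_vec l beta.
Proof.
move=> [_ AM] l Ll; have [_ _ [h [dh [hD hM eh _]]]] := (AM _ _).1 (A_e mOm Ofin Opos sL Ll).
have eD := in_Dmax_e lt_alpha_beta lt_beta_alpha l.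
have [rE lE _] := ae_eq_limits lt_alpha_beta eD hD eh.
by rewrite -(right_vec_e alpha) -(left_vec_e beta) rE lE.
Qed.

End spectrum_to_matrix.

(** * Test functions lie in the domain of [A_] *)

Section minimal_operator.
Context {R : realType} {n : nat}.
Notation mu := (@lebesgue_measure R).
Variables alpha beta : 'I_n -> R.
Hypothesis n_gt0 : (0 < n)%N.
Hypothesis lt_alpha_beta : forall i : 'I_n, alpha i < beta i.
Hypothesis lt_beta_alpha : forall i j : 'I_n, (i < j)%N -> beta i < alpha j.
Local Notation Om := (Omega alpha beta).

Let mOm : measurable Om := measurable_Omega alpha beta.
Let Ofin : (mu Om < +oo)%E := Omega_finite lt_alpha_beta lt_beta_alpha.

Lemma smooth_is_derive (u : R -> R) (x : R) : smooth u -> is_derive x 1 u (derive1 u x).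
Proof. by move=> su; rewrite derive1E; apply: derivableP; exact: (su 0%N). Qed.

Lemma smooth_continuous_derive (u : R -> R) : smooth u ->
  continuous u /\ continuous (derive1 u).
Proof.
move=> su; split=> x; apply/differentiable_continuous/derivable1_diffP.
  exact: (su 0%N).
exact: (su 1%N).
Qed.

Lemma continuous_itv_bounded (u : R -> R) (a b : R) : continuous u ->
  exists2 M : R, 0 < M & forall x, a <= x <= b -> `|u x| <= M.
Proof.
move=> cu; have cab : {within `[a, b], continuous u} by exact: continuous_subspaceT.
have /compact_bounded[M [_ HM]] := continuous_compact cab (@segment_compact _ a b).
have M1 : M < `|M| + 1 by rewrite (le_lt_trans (ler_norm M))// ltrDl.
exists (`|M| + 1); first by rewrite ltr_wpDl.
by move=> x axb; apply: (HM _ M1); exists x; rewrite //= in_itv.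
Qed.

Lemma endpoint_notin_Omega i : ~ Om (alpha i) /\ ~ Om (beta i).
Proof.
have lt_ab := lt_alpha_beta i.
split=> -[j /andP[aj bj]]; have lt_abj := lt_alpha_beta j.
  have [ij|ji|/val_inj ij] := ltngtP i j.
  - by have := lt_beta_alpha ij; lra.
  - by have := lt_beta_alpha ji; lra.
  - by move: aj; rewrite ij ltxx.
have [ij|ji|/val_inj ij] := ltngtP i j.
- by have := lt_beta_alpha ij; lra.
- by have := lt_beta_alpha ji; lra.
- by move: bj; rewrite ij ltxx.
Qed.

Lemma Cc_infty_in_Dmax f : Cc_infty Om f -> [/\ in_Dmax alpha beta f (cderive f),
  right_vec alpha f = 0 & left_vec beta f = 0].
Proof.
move=> [sr si [K [_ KO f0]]].
have [cr cr'] := smooth_continuous_derive sr.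
have [ci ci'] := smooth_continuous_derive si.
(* An endpoint is outside Omega, hence outside [K], so [f] vanishes there; as [f] is continuous on
   the whole line, both one-sided limits vanish. *)
have limE a : ~ Om a -> cvg_right f a 0 /\ cvg_left f a 0.
  move=> nOa; have fa : f a = 0 by apply: f0 => /KO.
  rewrite -fa; split; split.
  - exact/cvg_at_right_filter/cr.
  - exact/cvg_at_right_filter/ci.
  - exact/cvg_at_left_filter/cr.
  - exact/cvg_at_left_filter/ci.
split.
- split.
  + move=> i; apply/abs_continuousP; split.
      have [M M0 HM] := continuous_itv_bounded (alpha i) (beta i) cr'.
      apply: (real_abs_continuous_lipschitz M0 (fun x _ => smooth_is_derive x sr)).
      by move=> x /andP[ax xb]; apply: HM; rewrite !ltW.
    have [M M0 HM] := continuous_itv_bounded (alpha i) (beta i) ci'.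
    apply: (real_abs_continuous_lipschitz M0 (fun x _ => smooth_is_derive x si)).
    by move=> x /andP[ax xb]; apply: HM; rewrite !ltW.
  + by apply: ae_all => x _; split; exact: smooth_is_derive.
  + have [M M0 HM] := @Omega_bounded R n alpha beta.
    have [Mr Mr0 HMr] := continuous_itv_bounded (- M) M cr'.
    have [Mi Mi0 HMi] := continuous_itv_bounded (- M) M ci'.
    apply: (in_L2_bounded mOm Ofin (M := Mr + Mi)).
    * by apply: measurable_funTS; exact: continuous_measurable_fun.
    * by apply: measurable_funTS; exact: continuous_measurable_fun.
    * move=> x /HM; rewrite ler_norml => xM; apply: (le_trans (normc_le_ReIm _)).
      by rewrite lerD//; [exact: HMr|exact: HMi].
- apply/matrixP => i j; rewrite !mxE; apply: cvg_rightE.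
  exact: (limE _ (endpoint_notin_Omega i).1).1.
- apply/matrixP => i j; rewrite !mxE; apply: cvg_leftE.
  exact: (limE _ (endpoint_notin_Omega i).2).2.
Qed.

Lemma A_extends_minimal Lambda f g : spectrum Om Lambda ->
  minimal_operator Om f g -> A_ Om Lambda f g.
Proof.
move=> sL [/Cc_infty_in_Dmax[fD rE lE] ->].
apply: (in_Dmax_A n_gt0 lt_alpha_beta lt_beta_alpha sL fD) => l Ll.
rewrite rE lE.
have c0 w : cdot 0 w = 0 :> R[i] by apply: big1 => i _; rewrite mxE mul0r.
by rewrite !c0.
Qed.

End minimal_operator.

(** * From a spectral matrix to a spectrum *)

Section riesz_fischer.
Context {R : realType}.
Notation mu := (@lebesgue_measure R).

Lemma geometric_increments_cvg (u : R ^nat) (c : R) :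
  (forall k, `|u k.+1 - u k| <= c * (1 / 2) ^+ k) ->
  exists2 l : R, u @ \oo --> l & forall k, `|l - u k| <= 2 * c * (1 / 2) ^+ k.
Proof.
move=> uc; have c0 : 0 <= c.
  by have := uc 0%N; rewrite expr0 mulr1; apply: le_trans.
have q0 k : 0 <= (1 / 2 : R) ^+ k by rewrite exprn_ge0// divr_ge0.
have /cvg_ex[l ul] : cvgn u.
  have -> : u = (fun n => u 0%N + series (telescope u) n).
    by apply: funext => n; rewrite -eq_sum_telescope.
  apply: is_cvgD; first exact: is_cvg_cst.
  apply: normed_cvg.
  apply: (@series_le_cvg _ _ (geometric c (1 / 2))) => [n|n|n|] /=.
  - by [].
  - by rewrite mulr_ge0.
  - exact: uc.
  - by apply: is_cvg_geometric_series; rewrite ger0_norm ?divr_ge0//; lra.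
exists l => // k.
(* The right side is the exact partial geometric sum; without the subtracted power the induction
   would not close. *)
have H m : `|u (k + m)%N - u k| <= 2 * c * ((1 / 2) ^+ k - (1 / 2) ^+ (k + m)).
  elim: m => [|m IH]; first by rewrite addn0 !subrr normr0 mulr0.
  have := uc (k + m)%N; rewrite addnS exprS.
  have := ler_normD (u (k + m).+1 - u (k + m)%N) (u (k + m)%N - u k).
  by rewrite addrA subrK; lra.
apply/ler_addgt0Pl => e e0.
have /cvgrPdist_lt/(_ _ e0)[N _ HN] := ul.
have /= := HN (k + N)%N (leq_addl _ _) => lN.
have := ler_normD (l - u (k + N)%N) (u (k + N)%N - u k); rewrite addrA subrK.
have := H N; have := mulr_ge0 c0 (q0 (k + N)%N); lra.
Qed.

Variable D : set R.
Hypothesis mD : measurable D.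
Hypothesis Dpos : 0 < length D.

Let mD' : @measurable _ (measurableTypeR R) D := mD.

(* The weighted sum V = sum_k 4^k |g_(k+1) - g_k|^2 is integrable, and
   |g - g_k|^2 <= 16 V / 4^k wherever V is finite. *)
Lemma riesz_fischer (g : nat -> R -> R[i]) : (forall k, in_L2 D (g k)) ->
  (forall k, L2norm D (fun x => g k.+1 x - g k x) ^+ 2 <= (1 / 8) ^+ k) ->
  exists f, in_L2 D f /\
    forall e, 0 < e -> exists N, forall k, (N <= k)%N ->
      L2norm D (fun x => f x - g k x) < e.
Proof.
move=> L2g gc.
have q0 k : 0 <= (1 / 2 : R) ^+ k by rewrite exprn_ge0// divr_ge0.
have q40 k : 0 <= (1 / 4 : R) ^+ k by rewrite exprn_ge0// divr_ge0.
pose d k x := g k.+1 x - g k x.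
have L2d k : in_L2 D (d k) by exact: in_L2B.
(* The squared norms of the increments are at most [8^-k], so the weight [4^k] leaves the summable
   [2^-k], and pointwise it still gives [|d k x| <= sqrt (V x) / 2^k], again summable. *)
pose v k x := 4 ^+ k * normc (d k x) ^+ 2.
have v0 k x : 0 <= v k x by rewrite mulr_ge0 ?sqr_ge0 ?exprn_ge0.
have mn f : in_L2 D f -> measurable_fun D (fun x => normc (f x) ^+ 2).
  move=> [mr mi _]; under eq_fun do rewrite normc_sqr.
  by apply: measurable_funD; apply: measurable_funX.
have mv k : measurable_fun D (v k) by apply: measurable_funM => //; exact: mn.
have in2 f : in_L2 D f -> mu.-integrable D (EFin \o (fun x => normc (f x) ^+ 2)).
  move=> hf; apply/integrable_ge0P; [exact: mn|by move=> x _; exact: sqr_ge0|].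
  by have [] := hf.
have Iv k : (\int[mu]_(x in D) (v k x)%:E <= (2 * length D / (2 ^ k.+1)%:R)%:E)%E.
  have iv : mu.-integrable D (EFin \o v k).
    exact: (@integrable_scale _ _ _ mu _ mD' _ _ (in2 _ (L2d k))).
  rewrite -[leLHS]fineK; last exact: (@integrable_fin_num _ _ _ mu _ mD' _ iv).
  rewrite lee_fin -[fine _]/(\int[mu]_(x in D) v k x)%R RintegralZl//; last exact: in2.
  have := gc k; rewrite L2norm_sqrE// ler_pdivrMl// => H.
  apply: (@le_trans _ _ (4 ^+ k * (length D * (1 / 8) ^+ k))).
    by rewrite ler_wpM2l// exprn_ge0.
  rewrite le_eqVlt; apply/orP; left; apply/eqP.
  rewrite natrX exprS mulrCA -exprMn [4 * _](_ : _ = 2^-1); last by field.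
  by rewrite exprVn; field; rewrite expf_neq0.
pose V x := (\sum_(k <oo) (v k x)%:E)%E.
have V0 x : (0 <= V x)%E by apply: nneseries_ge0 => k _ _; rewrite lee_fin.
have mV : measurable_fun D V.
  apply: (@ge0_emeasurable_sum _ _ _ _ (fun k x => (v k x)%:E) xpredT).
    by move=> k x _ _; rewrite lee_fin.
  by move=> k _; apply/measurable_EFinP.
have IV : (\int[mu]_(x in D) V x < +oo)%E.
  rewrite (@integral_nneseries _ _ _ mu D mD' (fun k x => (v k x)%:E)); first last.
  - by move=> k x _; rewrite lee_fin.
  - by move=> k; apply/measurable_EFinP; exact: mv.
  apply: (@le_lt_trans _ _ (2 * length D)%:E); last exact: ltry.
  apply: (le_trans _ (epsilon_trick0 xpredT _)); last by rewrite mulr_ge0// ltW.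
  apply: lee_nneseries => k _; last exact: Iv.
  by move=> _; apply: integral_ge0 => x _; rewrite lee_fin.
have iV : mu.-integrable D V.
  apply/integrableP; split => //.
  by under eq_integral do rewrite gee0_abs//.
have [N0 [mN0 N00 subN]] := integrable_ae mD' iV.
pose N : set R := N0 `&` D.
have mN : measurable N by exact: measurableI.
have goodV x : D x -> ~ N x -> V x \is a fin_num.
  move=> Dx nNx; apply: contrapT => nV; apply: nNx; split => //.
  by apply: subN => /= /(_ Dx).
pose w x := fine (V x).
have vw k x : D x -> ~ N x -> v k x <= w x.
  move=> Dx nNx; rewrite -lee_fin fineK ?goodV//.
  rewrite /V (@nneseriesD1 _ _ k xpredT)//; last by move=> j _; rewrite lee_fin.
  by rewrite leeDl//; apply: nneseries_ge0 => j _ _; rewrite lee_fin.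
have w0 x : 0 <= w x by exact: fine_ge0.
have dw k x : D x -> ~ N x -> normc (d k x) <= Num.sqrt (w x) * (1 / 2) ^+ k.
  move=> Dx nNx; rewrite -(@ler_pXn2r _ 2)// ?nnegrE ?normc_ge0 ?mulr_ge0 ?sqrtr_ge0//.
  rewrite exprMn sqr_sqrtr// -exprM mulnC exprM.
  have := vw k x Dx nNx; rewrite /v => H.
  have -> : ((1 / 2) ^+ 2 : R) = 4^-1 by field.
  by rewrite exprVn -ler_pdivrMr ?invr_gt0 ?exprn_gt0// invrK mulrC.
have limE x : D x -> ~ N x -> exists l : R[i],
    [/\ (fun k => complex.Re (g k x)) @ \oo --> complex.Re l,
        (fun k => complex.Im (g k x)) @ \oo --> complex.Im l &
        forall k, normc (l - g k x) <= 4 * Num.sqrt (w x) * (1 / 2) ^+ k].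
  move=> Dx nNx.
  have [|lr gr Hr] := @geometric_increments_cvg (fun k => complex.Re (g k x)) (Num.sqrt (w x)).
    move=> k; apply: le_trans (dw k x Dx nNx).
    by rewrite -ReN -ReD; exact: normc_Re.
  have [|li gi Hi] := @geometric_increments_cvg (fun k => complex.Im (g k x)) (Num.sqrt (w x)).
    move=> k; apply: le_trans (dw k x Dx nNx).
    by rewrite -ImN -ImD; exact: normc_Im.
  exists (lr +i* li); split => // k; apply: (le_trans (normc_le_ReIm _)).
  by rewrite ReD ImD ReN ImN; have := Hr k; have := Hi k; lra.
have /choice[f0 Hf0] (x : R) : exists l : R[i], D x -> ~ N x ->
    [/\ (fun k => complex.Re (g k x)) @ \oo --> complex.Re l,
        (fun k => complex.Im (g k x)) @ \oo --> complex.Im l &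
        forall k, normc (l - g k x) <= 4 * Num.sqrt (w x) * (1 / 2) ^+ k].
  have [Dx|nDx] := pselect (D x); last by exists 0.
  have [Nx|nNx] := pselect (N x); first by exists 0.
  by have [l Hl] := limE x Dx nNx; exists l.
(* [f] is 0 on the null set [N], outside which [V] is finite. It is then a limit, at every point of
   [D], of the [g k] cut off on [N], hence measurable. *)
pose f (x : R) := if x \in N then 0 else f0 x.
have mf (p : R[i] -> R) : p 0 = 0 -> (forall k, measurable_fun D (fun x => p (g k x))) ->
    (forall x, D x -> ~ N x -> (fun k => p (g k x)) @ \oo --> p (f0 x)) ->
    measurable_fun D (fun x : R => p (f x)).
  move=> p0 mp cp; pose h k x := \1_(~` N) x * p (g k x).
  apply: (@measurable_fun_cvg _ _ _ D h) => [k|x Dx].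
    apply: measurable_funM => //; apply: measurable_funTS.
    by apply: measurable_indic; exact: measurableC.
  rewrite /h /f; case: ifPn => [/set_mem Nx|/negP nNx].
    rewrite p0 indicE memNset ?mul0r; last by move=> /(_ Nx).
    by under eq_fun do rewrite mul0r; exact: cvg_cst.
  have {}nNx : ~ N x by move=> Nx; apply: nNx; rewrite inE.
  by under eq_fun do rewrite indicE mem_set// mul1r; exact: cp.
have mfr : measurable_fun D (fun x => complex.Re (f x)).
  apply: (mf (@complex.Re R)) => // [k|x Dx nNx]; first by have [] := L2g k.
  by have [] := Hf0 x Dx nNx.
have mfi : measurable_fun D (fun x => complex.Im (f x)).
  apply: (mf (@complex.Im R)) => // [k|x Dx nNx]; first by have [] := L2g k.
  by have [] := Hf0 x Dx nNx.
have fg k x : D x -> ~ N x -> normc (f x - g k x) ^+ 2 <= 16 * (1 / 4) ^+ k * w x.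
  move=> Dx nNx; rewrite /f ifN; last by apply/negP; rewrite inE.
  have [_ _ /(_ k) H] := Hf0 x Dx nNx.
  apply: (@le_trans _ _ ((4 * Num.sqrt (w x) * (1 / 2) ^+ k) ^+ 2)).
    by rewrite lerXn2r ?nnegrE ?normc_ge0// !mulr_ge0 ?sqrtr_ge0.
  rewrite (exprMn 2 (4 * Num.sqrt (w x))) (exprMn 2 4) sqr_sqrtr//.
  rewrite -exprM mulnC exprM (_ : (1 / 2) ^+ 2 = 1 / 4); last by field.
  by rewrite le_eqVlt; apply/orP; left; apply/eqP; ring.
have iw : mu.-integrable D (EFin \o w).
  apply: le_integrable iV => //.
    by apply/measurable_EFinP; apply: (measurableT_comp _ mV); exact: fine_measurable.
  move=> x Dx /=; rewrite ger0_norm// gee0_abs// /w.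
  by have := V0 x; case: (V x) => //= _; rewrite leey.
have msub k : measurable_fun D (fun x => normc (f x - g k x) ^+ 2).
  have [mgr mgi _] := L2g k.
  under eq_fun do rewrite normc_sqr ReD ImD ReN ImN.
  by apply: measurable_funD; apply: measurable_funX; apply: measurable_funB.
have aeN k : {ae mu, forall x, D x -> normc (f x - g k x) ^+ 2 <= 16 * (1 / 4) ^+ k * w x}.
  exists N; split => //.
    apply/eqP; rewrite -measure_le0; rewrite -N00; apply: le_lebesgue => //.
    exact: subIsetl.
  move=> x /= H; apply: contrapT => nNx; apply: H => Dx; exact: fg.
have Ifg k : (\int[mu]_(x in D) (normc (f x - g k x) ^+ 2)%:E <=
    (16 * (1 / 4) ^+ k * \int[mu]_(x in D) w x)%:E)%E.
  rewrite -RintegralZl// fineK; last first.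
    apply: (@integrable_fin_num _ _ _ mu _ mD').
    exact: (@integrable_scale _ _ _ mu _ mD' _ _ iw).
  apply: (@ae_ge0_le_integral _ _ _ mu D mD' (fun x => (normc (f x - g k x) ^+ 2)%:E)
      (fun x => (16 * (1 / 4) ^+ k * w x)%:E)).
  - by move=> x _; rewrite lee_fin sqr_ge0.
  - by apply/measurable_EFinP; exact: msub.
  - by move=> x _; rewrite lee_fin !mulr_ge0.
  - exact: (measurable_int _ (@integrable_scale _ _ _ mu _ mD' _ _ iw)).
  - by have := aeN k; apply: ae_mono => x H Dx; rewrite lee_fin; exact: H.
have L2fg k : in_L2 D (fun x => f x - g k x).
  have [mgr mgi _] := L2g k; split.
  - by under eq_fun do rewrite ReD ReN; exact: measurable_funB.
  - by under eq_fun do rewrite ImD ImN; exact: measurable_funB.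
  - exact: le_lt_trans (Ifg k) (ltry _).
have L2f : in_L2 D f.
  have := in_L2D mD (L2fg 0%N) (L2g 0%N).
  by under eq_fun do rewrite subrK.
exists f; split => // e e0.
set C := (length D)^-1 * (16 * \int[mu]_(x in D) w x).
have C0 : 0 <= C.
  by rewrite mulr_ge0 ?invr_ge0 ?(ltW Dpos)// mulr_ge0// Rintegral_ge0.
have bound k : L2norm D (fun x => f x - g k x) ^+ 2 <= C * (1 / 4) ^+ k.
  rewrite L2norm_sqrE// /C -!mulrA ler_wpM2l ?invr_ge0 ?(ltW Dpos)//.
  have := Ifg k; rewrite -[leLHS]fineK; last first.
    exact: (@integrable_fin_num _ _ _ mu _ mD' _ (in2 _ (L2fg k))).
  rewrite lee_fin => /le_trans; apply.
  by rewrite le_eqVlt; apply/orP; left; apply/eqP; ring.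
have : (fun k => C * (1 / 4) ^+ k) @ \oo --> (0 : R).
  by apply: cvg_geometric; rewrite ger0_norm ?divr_ge0//; lra.
have e20 : 0 < e ^+ 2 by rewrite exprn_gt0.
move=> /cvgrPdist_lt/(_ _ e20)[N1 _ HN1]; exists N1 => k /HN1 /=.
rewrite sub0r normrN ger0_norm; last by rewrite mulr_ge0.
move=> /(le_lt_trans (bound k)); rewrite ltr_pXn2r// ?nnegrE ?L2norm_ge0//.
exact: ltW.
Qed.

End riesz_fischer.

(** * Compactness for functions with L^2-bounded derivatives *)

Section equicontinuity.
Context {R : realType} {n : nat}.
Notation mu := (@lebesgue_measure R).
Variables alpha beta : 'I_n -> R.
Hypothesis n_gt0 : (0 < n)%N.
Hypothesis lt_alpha_beta : forall i : 'I_n, alpha i < beta i.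
Hypothesis lt_beta_alpha : forall i j : 'I_n, (i < j)%N -> beta i < alpha j.
Local Notation Om := (Omega alpha beta).
Local Notation J i := `]alpha i, beta i[%classic.

Let mOm : measurable Om := measurable_Omega alpha beta.
Let Ofin : (mu Om < +oo)%E := Omega_finite lt_alpha_beta lt_beta_alpha.
Let Opos : 0 < length Om := length_Omega_gt0 n_gt0 lt_alpha_beta lt_beta_alpha.

Lemma normc_triangle (a b c : R[i]) : normc (a - c) <= normc (a - b) + normc (b - c).
Proof. by rewrite -[a - c](subrKA b); exact: le_normcD. Qed.

(** A bounded sequence clusters by compactness of the segment, and along an ultrafilter a cluster
    point is a limit. *)
Lemma ultra_bounded_cvg (U : set_system nat) (v : nat -> R) (M : R) :
  UltraFilter U -> (forall k, `|v k| <= M) -> exists p : R, v @ U --> p.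
Proof.
move=> UU vM.
have [p [_ cp]] : `[- M, M] `&` cluster (v @ U) !=set0.
  apply: (@segment_compact _ (- M) M (v @ U) (fmap_proper_filter _ _)).
  apply: (@filterS _ U _ setT (v @^-1` `[- M, M])); last exact: filterT.
  by move=> k _; rewrite /= in_itv/= -ler_norml.
exists p => X nX; have [//|UX] := in_ultra_setVsetC (v @^-1` X) UU.
by have [y []] := cp (~` X) X UX nX.
Qed.

(* Arzela-Ascoli: a pointwise limit along a free ultrafilter is uniform, because
   finitely many points control an equicontinuous family. *)
Lemma equicontinuous_cluster (h : nat -> R -> R[i]) (M : R) :
  (forall k x, Om x -> normc (h k x) <= M) ->
  (forall e, 0 < e -> exists2 d : R, 0 < d & forall k i x y, J i x -> J i y ->
     `|x - y| < d -> normc (h k x - h k y) <= e) ->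
  exists u : R -> R[i], forall e, 0 < e -> forall N, exists2 k, (N <= k)%N &
    forall x, Om x -> normc (h k x - u x) <= e.
Proof.
move=> hM heq.
(* [U] refines the eventual filter, so each of its sets contains arbitrarily large indices. *)
have [U [UU sU]] := ultraFilterLemma eventually_filter.
have /choice[u Hu] (x : R) : exists z : R[i], Om x ->
    forall e, 0 < e -> U [set k | normc (h k x - z) < e].
  have [Ox|nOx] := pselect (Om x); last by exists 0.
  have [k|p Hp] := @ultra_bounded_cvg U (fun k => complex.Re (h k x)) M UU.
    by apply: le_trans (hM k x Ox); exact: normc_Re.
  have [k|q Hq] := @ultra_bounded_cvg U (fun k => complex.Im (h k x)) M UU.
    by apply: le_trans (hM k x Ox); exact: normc_Im.
  exists (p +i* q) => _ e e0; have e2 : 0 < e / 2 by rewrite divr_gt0.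
  move/cvgrPdist_lt: Hp => /(_ _ e2) Hp; move/cvgrPdist_lt: Hq => /(_ _ e2) Hq.
  apply: filterS (filterI Hp Hq) => k [/= H1 H2].
  apply: (le_lt_trans (normc_le_ReIm _)).
  by rewrite ReD ImD ReN ImN /= distrC [X in _ + X]distrC; lra.
exists u => e e0 N.
pose r := e / 5; have r0 : 0 < r by rewrite divr_gt0.
have [d d0 Hd] := heq r r0.
have [L L0 HL] := Omega_bounded alpha beta.
pose cell (x : R) := Num.truncn ((x + L) / d).
have cell_dist x y : Om x -> Om y -> cell x = cell y -> `|x - y| < d.
  move=> Ox Oy cE.
  have ge0 z : Om z -> 0 <= (z + L) / d.
    by move=> /HL; rewrite ler_norml => /andP[zL _]; rewrite divr_ge0 ?(ltW d0)//; lra.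
  have /andP[x1 x2] := truncn_itv (ge0 x Ox).
  have /andP[] := truncn_itv (ge0 y Oy); rewrite -/(cell y) -cE => y1 y2.
  rewrite -/(cell x) in x1 x2.
  have : `|(x + L) / d - (y + L) / d| < 1.
    by move: x2 y2; rewrite -natr1 ltr_norml => x2 y2; apply/andP; split; lra.
  rewrite -mulrBl (_ : x + L - (y + L) = x - y); last by ring.
  by rewrite normrM normfV (gtr0_norm d0) ltr_pdivrMr// mul1r.
pose K := (Num.truncn ((2 * L) / d)).+1.
have cellK x : Om x -> (cell x < K)%N.
  move=> /HL; rewrite ler_norml => /andP[xL Lx]; rewrite ltnS /cell.
  rewrite truncn_le_nat; apply: (@le_lt_trans _ _ ((2 * L) / d)).
    by rewrite ler_pM2r ?invr_gt0//; lra.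
  exact: truncnS_gt.
(* One sample point for each nonempty intersection of an interval with a cell of width [d]; for
   empty intersections the value is arbitrary. *)
have /choice[y Hy] (p : 'I_n * 'I_K) : exists y, forall x,
    J p.1 x -> cell x = p.2 -> J p.1 y /\ cell y = p.2.
  have [[x [Jx cx]]|H] := pselect (exists x, J p.1 x /\ cell x = p.2).
    by exists x.
  by exists 0 => x Jx cx; exfalso; apply: H; exists x.
have UN : U [set k | (N <= k)%N].
  by apply: sU; exists N.
have Uy : U [set k | forall p : 'I_n * 'I_K,
    J p.1 (y p) -> normc (h k (y p) - u (y p)) < r].
  apply: filter_forall => p.
  have [Jy|nJy] := pselect (J p.1 (y p)); last first.
    by apply: (@filterS _ U _ setT); [move=> k _ /nJy|exact: filterT].
  have Oy : Om (y p) by exists p.1; move: Jy; rewrite /= in_itv.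
  by apply: filterS (Hu (y p) Oy r r0) => k.
have [k [Nk Hk]] := filter_ex (filterI UN Uy).
exists k => // x [i axb]; have Ox : Om x by exists i.
have Jx : J i x by rewrite /= in_itv.
pose p := (i, Ordinal (cellK x Ox)).
have [Jy cy] := Hy p x Jx erefl.
have Oy : Om (y p) by exists i; move: Jy; rewrite /= in_itv.
have xy : `|x - y p| < d by apply: cell_dist.
(* [u] is not known to be equicontinuous. An index [k'], which may depend on [x], brings [h k']
   close to [u] at both [x] and [y p], and equicontinuity of [h k'] bridges the two points. Together
   with the two steps for [h k] this makes five errors of size [r]. *)
have [k' [Hx' Hy']] := filter_ex (filterI (Hu x Ox r r0) (Hu (y p) Oy r r0)).
rewrite /= in Hx' Hy'.
have H1 := normc_triangle (h k x) (h k (y p)) (u x).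
have H2 := normc_triangle (h k (y p)) (u (y p)) (u x).
have H3 := normc_triangle (u (y p)) (h k' (y p)) (u x).
have H4 := normc_triangle (h k' (y p)) (h k' x) (u x).
have H5 := Hd k i x (y p) Jx Jy xy.
have H6 : normc (h k' (y p) - h k' x) <= r by apply: (Hd k' i) => //; rewrite distrC.
have H7 := Hk p Jy.
have H8 : normc (u (y p) - h k' (y p)) < r by rewrite -normcN opprB.
have -> : e = r + r + r + r + r by rewrite /r; field.
apply: (le_trans H1); rewrite -!addrA; apply: lerD => //.
apply: (le_trans H2); apply: lerD; first exact: ltW.
apply: (le_trans H3); apply: lerD; first exact: ltW.
by apply: (le_trans H4); apply: lerD => //; exact: ltW.
Qed.

Lemma Dmax_increment h dh i x y : in_Dmax alpha beta h dh ->
  alpha i < y -> y <= x -> x < beta i -> h x - h y = cintegral `]y, x] dh.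
Proof.
move=> hD ay yx xb.
have [_ _ _ [iRe iIm]] := in_Dmax_itv i hD.
have [_ _ _ H] := in_Dmax_limits lt_alpha_beta i hD.
have Hx := H x _; have Hy := H y _.
have -> : h x - h y = (h x - right_limit h (alpha i)) - (h y - right_limit h (alpha i)).
  by rewrite opprB addrA subrK.
rewrite Hx ?Hy; last 2 first.
- by rewrite ay (le_lt_trans yx).
- by rewrite (lt_le_trans ay).
have sub : `]alpha i, x]%classic `<=` J i.
  by apply: subset_itvl; rewrite bnd_simp.
have mJ : @measurable _ (measurableTypeR R) (J i) by exact: measurable_itv.
have mI : @measurable _ (measurableTypeR R) `]alpha i, x]%classic by exact: measurable_itv.
apply: complex_eq; rewrite ?ReD ?ImD ?ReN ?ImN /cintegral/=; apply: Rintegral_itvB.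
- exact: (integrableS mJ mI sub iRe).
- by rewrite bnd_simp ltW.
- by rewrite bnd_simp.
- exact: (integrableS mJ mI sub iIm).
- by rewrite bnd_simp ltW.
- by rewrite bnd_simp.
Qed.

Lemma Dmax_equicontinuous (h dh : nat -> R -> R[i]) (C : R) :
  (forall k, in_Dmax alpha beta (h k) (dh k)) ->
  (forall k, L2norm Om (dh k) <= C) ->
  forall e, 0 < e -> exists2 d : R, 0 < d & forall k i x y, J i x -> J i y ->
     `|x - y| < d -> normc (h k x - h k y) <= e.
Proof.
move=> hD dhC e e0.
have C0 : 0 <= C by apply: le_trans (dhC 0%N); exact: L2norm_ge0.
pose L := length Om * C ^+ 2.
have L0 : 0 <= L by rewrite mulr_ge0 ?sqr_ge0// ltW.
(* [t] makes the term [t^-1 * L] at most [e / 2], the added 1 keeping it positive when [L = 0]; [d]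
   is then chosen so that [t * d = e / 2]. *)
pose t := 2 * L / e + 1.
have t0 : 0 < t by rewrite ltr_wpDl// divr_ge0 ?(ltW e0)// mulr_ge0.
have tL : t^-1 * L <= e / 2.
  rewrite ler_pdivrMl// /t mulrDl mul1r (_ : 2 * L / e * (e / 2) = L); last first.
    by field; rewrite gt_eqF.
  by rewrite lerDl divr_ge0// ltW.
pose d := e / (2 * t); have d0 : 0 < d by rewrite divr_gt0// mulr_gt0.
exists d => //.
have main k i x y : alpha i < y -> y <= x -> x < beta i -> x - y < d ->
    normc (h k x - h k y) <= e.
  move=> ay yx xb xyd; rewrite (Dmax_increment (hD k) ay yx xb).
  have sub : `]y, x]%classic `<=` Om.
    move=> z; rewrite /= in_itv/= => /andP[yz zx]; exists i.
    by rewrite (lt_trans ay yz) (le_lt_trans zx xb).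
  have [_ _ L2d] := hD k.
  apply: (le_trans (normc_cintegral_AMGM (measurable_itv _) mOm sub Ofin Opos L2d t0)).
  have -> : length `]y, x]%classic = x - y.
    rewrite /length lebesgue_measure_itv/= lte_fin; case: ltP => // xy.
    by apply/eqP; rewrite eq_sym subr_eq0 eq_le yx xy.
  have H1 : t * (x - y) <= e / 2.
    apply: (@le_trans _ _ (t * d)); first by rewrite ler_wpM2l// ltW.
    by rewrite le_eqVlt; apply/orP; left; apply/eqP; rewrite /d; field; rewrite gt_eqF.
  have H2 : t^-1 * (length Om * L2norm Om (dh k) ^+ 2) <= e / 2.
    apply: le_trans tL; rewrite ler_wpM2l ?invr_ge0 ?(ltW t0)// ler_wpM2l ?(ltW Opos)//.
    by rewrite lerXn2r ?nnegrE ?L2norm_ge0.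
  by have := lerD H1 H2; rewrite -splitr.
move=> k i x y; rewrite /= !in_itv/= => /andP[ax xb] /andP[ay yb] xyd.
have [yx|xy] := leP y x.
  by apply: (main k i) => //; apply: le_lt_trans xyd; exact: ler_norm.
rewrite -normcN opprB; apply: (main k i) => //; first exact: ltW.
by apply: le_lt_trans xyd; rewrite distrC; exact: ler_norm.
Qed.

Lemma Dmax_cluster (h dh : nat -> R -> R[i]) (C : R) :
  (forall k, in_Dmax alpha beta (h k) (dh k)) ->
  (forall k x, Om x -> normc (h k x) <= C) ->
  (forall k, L2norm Om (dh k) <= C) ->
  exists2 u, in_L2 Om u & forall e, 0 < e -> forall N, exists2 k, (N <= k)%N &
    L2norm Om (fun x => h k x - u x) < e.
Proof.
move=> hD hC dhC.
have [u Hu] := equicontinuous_cluster hC (Dmax_equicontinuous hD dhC).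
have L2h k : in_L2 Om (h k) by exact: in_Dmax_in_L2 (hD k).
have q0 m : 0 < (m.+1%:R : R)^-1 by rewrite invr_gt0.
(* [Hu] gives an index for each tolerance; the tolerances [1/(m+1)] make of them a sequence
   converging to [u] on Omega, so [u] is measurable. *)
have /choice[k_ Hk] (m : nat) : exists k, forall x, Om x -> normc (h k x - u x) <= m.+1%:R^-1.
  by have [k _ Hk] := Hu _ (q0 m) 0%N; exists k.
have mu_ (p : R[i] -> R) : (forall z w, `|p z - p w| <= normc (z - w)) ->
    (forall k, measurable_fun Om (fun x => p (h k x))) -> measurable_fun Om (fun x => p (u x)).
  move=> p1 mp; apply: (@measurable_fun_cvg _ _ _ Om (fun m x => p (h (k_ m) x))) => [m|x Ox].
    exact: mp.
  apply/cvgrPdist_le => e e0.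
  have := @cvg_harmonic R; move=> /cvgrPdist_le/(_ _ e0); apply: filterS => m /=.
  rewrite sub0r normrN ger0_norm ?invr_ge0// => me; rewrite distrC.
  by apply: (le_trans (p1 _ _)); apply: le_trans me; exact: Hk.
have L2u : in_L2 Om u.
  have L2hu : in_L2 Om (fun x => h (k_ 0%N) x - u x).
    apply: (in_L2_bounded mOm Ofin (M := 1)).
    - under eq_fun do rewrite ReD ReN; apply: measurable_funB.
        by have [] := L2h (k_ 0%N).
      apply: (mu_ (@complex.Re R)) => [z w|k]; last by have [] := L2h k.
      by rewrite -ReN -ReD; exact: normc_Re.
    - under eq_fun do rewrite ImD ImN; apply: measurable_funB.
        by have [] := L2h (k_ 0%N).
      apply: (mu_ (@complex.Im R)) => [z w|k]; last by have [] := L2h k.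
      by rewrite -ImN -ImD; exact: normc_Im.
    - by move=> x Ox; have := Hk 0%N x Ox; rewrite invr1.
  have := in_L2B mOm (L2h (k_ 0%N)) L2hu.
  by under [X in in_L2 _ X -> _]eq_fun do rewrite opprB addrC subrK.
exists u => // e e0 N; have e2 : 0 < e / 2 by rewrite divr_gt0.
have [k Nk Hkk] := Hu _ e2 N; exists k => //.
apply: (@le_lt_trans _ _ (e / 2)); last by lra.
by apply: (L2norm_le_bound mOm Ofin Opos) => //; [exact: ltW|exact: in_L2B].
Qed.

End equicontinuity.

(** * Eigenvectors of a compact symmetric operator on a closed subspace *)

Section compact_symmetric.
Context {R : realType}.
Notation mu := (@lebesgue_measure R).
Variable D : set R.
Hypothesis mD : measurable D.
Hypothesis Dpos : 0 < length D.
Local Notation N := (L2norm D).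

Lemma eq_L2norm (f g : R -> R[i]) : (forall x, D x -> f x = g x) -> N f = N g.
Proof.
move=> fg; congr (Num.sqrt (_ * _)); apply: eq_Rintegral => x /set_mem Dx.
by rewrite fg.
Qed.

(** [P] stands for a closed subspace invariant under [T], later the orthogonal complement of the
    exponentials. [T] returns representatives: linearity is pointwise on [D], while closedness and
    compactness are phrased through the norm, with a cluster point in place of a subsequence. *)
Variables (P : (R -> R[i]) -> Prop) (T : (R -> R[i]) -> R -> R[i]) (C : R).
Hypothesis C0 : 0 <= C.
Hypothesis L2P : forall f, P f -> in_L2 D f.
Hypothesis PDZ : forall f g z, P f -> P g -> P (fun x => f x + z * g x).
Hypothesis P_closed : forall w, in_L2 D w ->
  (forall e, 0 < e -> exists2 f, P f & N (fun x => f x - w x) < e) -> P w.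
Hypothesis PT : forall f, P f -> P (T f).
Hypothesis L2T : forall f, in_L2 D f -> in_L2 D (T f).
Hypothesis T_linear : forall f g z, in_L2 D f -> in_L2 D g -> forall x, D x ->
  T (fun y => f y + z * g y) x = T f x + z * T g x.
Hypothesis T_bounded : forall f, in_L2 D f -> N (T f) <= C * N f.
Hypothesis T_symmetric : forall f g, in_L2 D f -> in_L2 D g ->
  inner D (T f) g = inner D f (T g).
Hypothesis T_compact : forall f : nat -> R -> R[i], (forall k, P (f k)) ->
  (forall k, N (f k) <= 1) ->
  exists2 u, in_L2 D u & forall e, 0 < e -> forall k0, exists2 k, (k0 <= k)%N &
    N (fun x => T (f k) x - u x) < e.

Let TZ c f x : in_L2 D f -> D x -> T (fun y => c * f y) x = c * T f x.
Proof.
move=> L2f Dx; have -> : (fun y => c * f y) = (fun y => f y + (c - 1) * f y).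
  by apply: funext => y; rewrite mulrBl mul1r addrC subrK.
by rewrite T_linear// mulrBl mul1r addrC subrK.
Qed.

Let TB f g x : in_L2 D f -> in_L2 D g -> D x ->
  T (fun y => f y - g y) x = T f x - T g x.
Proof.
move=> L2f L2g Dx; have -> : (fun y => f y - g y) = (fun y => f y + -1 * g y).
  by apply: funext => y; rewrite mulN1r.
by rewrite T_linear// mulN1r.
Qed.

Let PZ c f : P f -> P (fun x => c * f x).
Proof.
move=> Pf; have -> : (fun y => c * f y) = (fun y => f y + (c - 1) * f y).
  by apply: funext => y; rewrite mulrBl mul1r addrC subrK.
exact: PDZ.
Qed.

Let N_TB f g : in_L2 D f -> in_L2 D g ->
  N (fun x => T f x - T g x) <= C * N (fun x => f x - g x).
Proof.
move=> L2f L2g; rewrite -(@eq_L2norm (T (fun y => f y - g y))); last first.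
  by move=> x; exact: TB.
by apply: T_bounded; exact: in_L2B.
Qed.

(* If m is the norm of T on P and |T f| is close to m for a unit vector f, then
   |T (T f) - m^2 f|^2 <= m^2 (m^2 - |T f|^2) is small; T (T w) = m^2 w for the
   limit w, and then w or T w - m w is an eigenvector. *)
Lemma compact_symmetric_eigenvector f0 : P f0 -> 0 < N (T f0) ->
  exists w (m : R), [/\ P w, 0 < N w, m != 0 &
    N (fun x => T w x - m%:C * w x) = 0].
Proof.
move=> Pf0 Tf0.
pose S := [set r : R | exists f, [/\ P f, N f <= 1 & r = N (T f)]].
have NZ c f : in_L2 D f -> N (fun x => c * f x) = normc c * N f.
  by move=> L2f; exact: L2normZ.
have S0 : S !=set0.
  exists (N (T (fun x => 0 * f0 x))), (fun x => 0 * f0 x); split => //.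
    exact: PZ.
  by rewrite NZ ?normc0 ?mul0r//; exact: L2P.
have Sub : ubound S C.
  move=> _ [f [Pf Nf ->]]; apply: (le_trans (T_bounded (L2P Pf))).
  by rewrite -[leRHS]mulr1 ler_wpM2l.
have hS : has_sup S by split => //; exists C.
pose m := sup S.
have Tm f : P f -> N (T f) <= m * N f.
  move=> Pf; have L2f := L2P Pf; have := L2norm_ge0 D f; rewrite le_eqVlt.
  move=> /orP[/eqP N0|Npos].
    by have := T_bounded L2f; rewrite -N0 !mulr0.
  pose c : R[i] := (N f)^-1%:C.
  have cE : normc c = (N f)^-1 by rewrite normc_real ger0_norm// invr_ge0 ltW.
  have : S (N (T (fun x => c * f x))).
    exists (fun x => c * f x); split => //; first exact: PZ.
    by rewrite NZ// cE mulVf// gt_eqF.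
  move=> /(sup_upper_bound hS); rewrite -/m.
  rewrite (@eq_L2norm (T (fun x => c * f x)) (fun x => c * T f x)); last first.
    by move=> x; exact: TZ.
  by rewrite NZ ?cE; [rewrite ler_pdivrMl// mulrC|exact: L2T].
have m0 : 0 < m.
  have H := Tm f0 Pf0; have N0 := L2norm_ge0 D f0.
  rewrite ltNge; apply/negP => m0.
  by have := lt_le_trans Tf0 H; rewrite ltNge mulr_le0_ge0.
have q0 k : 0 < (k.+1%:R : R)^-1 by rewrite invr_gt0.
have /choice[f Hf] (k : nat) : exists f, [/\ P f, N f <= 1 & m - k.+1%:R^-1 < N (T f)].
  have [_ [f [Pf Nf ->]] H] := sup_adherent (q0 k) hS.
  by exists f.
have [u L2u Hu] := T_compact (fun k => let: And3 h _ _ := Hf k in h)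
  (fun k => let: And3 _ h _ := Hf k in h).
have near_max e : 0 < e -> exists g, [/\ P g, N g <= 1, m - e < N (T g),
    N (fun x => T g x - u x) < e & N (fun x => T (T g) x - (m ^+ 2)%:C * g x) <= e].
  (* With [t = N (T f)] between [m - d] and [m], the defect satisfies [m^2 (m^2 - t^2) <= 2 m^3 d],
     and the second entry of the minimum brings this below [e^2]. *)
  move=> e0; pose d := Num.min e (e ^+ 2 / (2 * m ^+ 3)).
  have d0 : 0 < d by rewrite lt_min e0/= divr_gt0 ?mulr_gt0 ?exprn_gt0.
  have [k0 _ Hk0] := near_infty_natSinv_lt (PosNum d0).
  have [k /Hk0/= kd Hk] := Hu _ d0 k0.
  have [Pf Nf Tf] := Hf k; have L2f := L2P Pf.
  have L2Tf := L2T L2f; have L2TTf := L2T L2Tf.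
  have de : d <= e by rewrite ge_min lexx.
  have Tfd : m - d < N (T (f k)) by apply: le_lt_trans Tf; rewrite lerD2l lerN2 ltW.
  exists (f k); split => //.
  - by apply: le_lt_trans Tfd; rewrite lerD2l lerN2.
  - exact: lt_le_trans Hk de.
  - rewrite -(@ler_pXn2r _ 2)// ?nnegrE ?L2norm_ge0 ?(ltW e0)//.
    rewrite (L2norm_sub_sqr mD Dpos _ L2TTf L2f) conj_realC normc_real.
    rewrite T_symmetric// -(L2norm_sqr Dpos (T (f k))) -realCM /=.
    rewrite ger0_norm ?sqr_ge0//.
    have T1 : N (T (T (f k))) ^+ 2 <= m ^+ 2 * N (T (f k)) ^+ 2.
      rewrite -exprMn lerXn2r ?nnegrE ?L2norm_ge0 ?mulr_ge0 ?L2norm_ge0 ?(ltW m0)//.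
      by apply: Tm; exact: PT.
    have T2 : (m ^+ 2) ^+ 2 * N (f k) ^+ 2 <= (m ^+ 2) ^+ 2.
      by rewrite -[leRHS]mulr1 ler_wpM2l ?sqr_ge0// expr_le1// L2norm_ge0.
    have T3 : m ^+ 2 * (m ^+ 2 - N (T (f k)) ^+ 2) <= e ^+ 2.
      have dm : d * (2 * m ^+ 3) <= e ^+ 2.
        by rewrite -ler_pdivlMr ?mulr_gt0 ?exprn_gt0// ge_min lexx orbT.
      apply: le_trans dm; rewrite (_ : d * _ = m ^+ 2 * (2 * m * d)); last by ring.
      rewrite ler_wpM2l ?sqr_ge0//.
      have Nm : N (T (f k)) <= m.
        by apply: (le_trans (Tm _ Pf)); rewrite -[leRHS]mulr1 ler_wpM2l// ltW.
      have := L2norm_ge0 D (T (f k)); set t := N _ in Tfd Nm *; move: m0; nra.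
    move: T1 T2 T3; set a := N _ ^+ 2; set b := N _ ^+ 2; set c := N _ ^+ 2; nra.
(* The near-maximizers [g] have no limit yet; but [T g] is close to [u] and [T (T g)] is close to
   [m^2 g], so [m^2 g] is close to [T u]. *)
pose w := T u; have L2w : in_L2 D w by exact: L2T.
pose c : R[i] := (m ^+ 2)%:C.
have cE : normc c = m ^+ 2 by rewrite normc_real ger0_norm ?sqr_ge0.
have near_w e : 0 < e -> exists g, [/\ P g, m - e < m * N g,
    N (fun x => T g x - u x) < e & N (fun x => c * g x - w x) <= (1 + C) * e].
  move=> /near_max[g [Pg Ng Tg gu TTg]]; exists g; split => //.
    exact: lt_le_trans Tg (Tm g Pg).
  have L2g := L2P Pg; have L2cg : in_L2 D (fun x => c * g x) by exact: in_L2Z.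
  have L2TTg := L2T (L2T L2g).
  apply: (le_trans (L2norm_le_sub mD Dpos L2cg L2TTg L2w)).
  rewrite mulrDl mul1r; apply: lerD; first by rewrite L2normBC.
  apply: (le_trans (N_TB (L2T L2g) L2u)); rewrite ler_wpM2l//; exact: ltW.
have C1 : 0 < 1 + C by rewrite ltr_wpDr.
have Pw : P w.
  apply: P_closed => // e e0; pose d := e / (2 * (1 + C)).
  have [|g [Pg _ _ H]] := near_w d; first by rewrite divr_gt0 ?mulr_gt0.
  exists (fun x => c * g x); first exact: PZ.
  apply: (le_lt_trans H); rewrite (_ : _ * d = e / 2); first by lra.
  by rewrite /d; field; rewrite gt_eqF.
have Nw : 0 < N w.
  (* The estimates leave [N w > m^2 - K e]; with [e = m^2 / (2 K)] this is [m^2 / 2]. *)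
  pose K := m + (1 + C); have K0 : 0 < K by rewrite addr_gt0.
  have [|g [Pg mg _ H]] := near_w (m ^+ 2 / (2 * K)).
    by rewrite divr_gt0 ?exprn_gt0 ?mulr_gt0.
  have L2cg : in_L2 D (fun x => c * g x) by apply: in_L2Z => //; exact: L2P.
  have := L2norm_le_add mD Dpos (in_L2B mD L2cg L2w) L2w.
  under [X in L2norm D X <= _]eq_fun do rewrite subrK.
  rewrite NZ ?cE; last exact: L2P.
  have E1 : m * (m - m ^+ 2 / (2 * K)) < m ^+ 2 * N g.
    rewrite [X in _ < X](_ : _ = m * (m * N g)) ?ltr_pM2l//.
    by rewrite mulrA -expr2.
  have E2 : m * (m - m ^+ 2 / (2 * K)) - (1 + C) * (m ^+ 2 / (2 * K)) = m ^+ 2 / 2.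
    by rewrite /K; field; rewrite gt_eqF.
  have m2 : 0 < m ^+ 2 by rewrite exprn_gt0.
  lra.
have TTw : N (fun x => T w x - c * u x) = 0.
  apply/eqP; rewrite eq_le L2norm_ge0 andbT; apply/ler_addgt0Pl => e e0.
  rewrite addr0; pose K := C * (1 + C) + m ^+ 2.
  have K0 : 0 < K by rewrite ltr_wpDl ?exprn_gt0// mulr_ge0// ltW.
  have [|g [Pg _ gu gw]] := near_w (e / K); first by rewrite divr_gt0.
  have L2g := L2P Pg; have L2cg : in_L2 D (fun x => c * g x) by exact: in_L2Z.
  have L2cu : in_L2 D (fun x => c * u x) by exact: in_L2Z.
  apply: (le_trans (L2norm_le_sub mD Dpos (L2T L2w) (L2T L2cg) L2cu)).
  rewrite (_ : e = C * ((1 + C) * (e / K)) + m ^+ 2 * (e / K)); last first.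
    by rewrite mulrA -mulrDl -/K mulrC divfK// gt_eqF.
  apply: lerD.
    by apply: (le_trans (N_TB L2w L2cg)); rewrite ler_wpM2l// L2normBC.
  rewrite (@eq_L2norm _ (fun x => c * (T g x - u x))); last first.
    by move=> x Dx; rewrite TZ// mulrBr.
  rewrite NZ ?cE; last by apply: in_L2B => //; exact: L2T.
  by rewrite ler_wpM2l ?sqr_ge0// ltW.
have {}TTw : N (fun x => T (T w) x - c * w x) = 0.
  have L2cu : in_L2 D (fun x => c * u x) by exact: in_L2Z.
  apply/eqP; rewrite eq_le L2norm_ge0 andbT.
  have := N_TB (L2T L2w) L2cu; rewrite TTw mulr0; apply: le_trans.
  rewrite le_eqVlt; apply/orP; left; apply/eqP; apply: eq_L2norm => x Dx.
  by rewrite TZ.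
(* From [T (T w) = m^2 w] follows [T v = - m v], so [v] is either zero or an eigenvector for
   [- m]. *)
pose v x := T w x - m%:C * w x.
have L2mw : in_L2 D (fun x => m%:C * w x) by exact: in_L2Z.
have [v0|vpos] := leP (N v) 0.
  exists w, m; split => //; first by rewrite gt_eqF.
  by apply/eqP; rewrite eq_le v0 L2norm_ge0.
exists v, (- m); split => //.
- have -> : v = (fun x => T w x + (- m%:C) * w x) by apply: funext => x; rewrite /v mulNr.
  by apply: PDZ => //; exact: PT.
- by rewrite oppr_eq0 gt_eqF.
- rewrite -TTw; apply: eq_L2norm => x Dx; rewrite TB ?TZ//; last exact: L2T.
  by rewrite /c /v rmorphN/= [(m ^+ 2)%:C]rmorphXn/=; ring.
Qed.

End compact_symmetric.

(** * A trivial orthogonal complement gives convergent Fourier expansions *)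

Section completeness.
Context {R : realType}.
Notation mu := (@lebesgue_measure R).
Variable D : set R.
Hypothesis mD : measurable D.
Hypothesis Dfin : (mu D < +oo)%E.
Hypothesis Dpos : 0 < length D.
Variable Lambda : set R.
Hypothesis oL : orthogonal_exponentials D Lambda.
Local Notation N := (L2norm D).

(** Bessel's identity for the larger partial sum itself: subtracting all of [F] evaluates its norm,
    subtracting [G] gives the difference. *)
Lemma psum_sub_sqr f (F G : {fset R}) : in_L2 D f -> [set` F] `<=` Lambda ->
  (G `<=` F)%fset ->
  N (fun x => \sum_(l <- F) coef D f l * e_ l x - \sum_(l <- G) coef D f l * e_ l x) ^+ 2 =
  \sum_(l <- F) normc (coef D f l) ^+ 2 - \sum_(l <- G) normc (coef D f l) ^+ 2.
Proof.
move=> L2f FL GF; pose g x := \sum_(l <- F) coef D f l * e_ l x.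
have L2g : in_L2 D g by exact: in_L2_psum.
have GL : [set` G] `<=` Lambda by move=> l /(fsubsetP GF); exact: FL.
have gE l : Lambda l -> coef D g l = if l \in F then coef D f l else 0.
  by move=> Ll; rewrite (coef_psum mD Dfin Dpos _ oL (fset_uniq F)).
have eE (H : {fset R}) : (H `<=` F)%fset ->
    N (fun x => g x - \sum_(l <- H) coef D f l * e_ l x) ^+ 2 =
    N g ^+ 2 - \sum_(l <- H) normc (coef D f l) ^+ 2.
  move=> HF; have HL : [set` H] `<=` Lambda by move=> l /(fsubsetP HF); exact: FL.
  rewrite (bessel_identity mD Dfin Dpos (coef D f) oL (fset_uniq H) HL L2g).
  have gH l : l \in H -> coef D g l = coef D f l.
    by move=> lH; rewrite gE ?(fsubsetP HF)//; exact: HL.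
  rewrite [X in _ + X]big_seq [X in _ + X]big1 ?addr0; last first.
    by move=> l lH; rewrite gH// subrr normc0 expr0n.
  by congr (_ - _); apply: eq_big_seq => l lH; rewrite gH.
have := eE F (fsubset_refl F).
rewrite (ae_eq_L2normB mD Dpos L2g L2g); last exact: ae_all.
rewrite expr0n/= => /eqP; rewrite eq_sym subr_eq0 => /eqP gF.
by rewrite (eE G GF) gF.
Qed.

Lemma L2norm_e l : N (e_ l) = 1.
Proof.
have := inner_e_e mD Dpos l; rewrite -(L2norm_sqr Dpos).
move=> /(congr1 (@complex.Re R))/= /eqP; rewrite sqrf_eq1 => /orP[/eqP//|/eqP H].
by have := L2norm_ge0 D (e_ l); rewrite H oppr_ge0 ler10.
Qed.

(** Finite sets whose coefficient sums approach the supremum give a Cauchy sequence of partial sums.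
    Its limit [h] has the coefficients of [f], so the hypothesis for [f - h] identifies the two in
    L^2. By Bessel's identity a larger finite set never increases the error, hence convergence along
    all finite sets. *)
Lemma complete_spectrum :
  (forall f, in_L2 D f -> (forall l, Lambda l -> coef D f l = 0) -> N f = 0) ->
  spectrum D Lambda.
Proof.
move=> complete; split => [|f L2f]; first exact: oL.
pose s (F : {fset R}) := \sum_(l <- F) normc (coef D f l) ^+ 2.
pose g (F : {fset R}) x := \sum_(l <- F) coef D f l * e_ l x.
have L2g F : in_L2 D (g F) by exact: in_L2_psum.
pose S := [set r | exists2 F : {fset R}, [set` F] `<=` Lambda & r = s F].
have hS : has_sup S.
  split; first by exists (s fset0), fset0 => // l.
  by exists (N f ^+ 2) => _ [F FL ->]; apply: bessel_inequality (fset_uniq F) FL L2f.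
have sS F : [set` F] `<=` Lambda -> s F <= sup S.
  by move=> FL; apply: (sup_upper_bound hS); exists F.
have mono F G : [set` F] `<=` Lambda -> (G `<=` F)%fset -> s G <= s F.
  by move=> FL GF; rewrite -subr_ge0 -psum_sub_sqr// sqr_ge0.
have q0 k : 0 < (1 / 8 : R) ^+ k by rewrite exprn_gt0// divr_gt0.
have /choice[F0 HF0] (k : nat) : exists F : {fset R},
    [set` F] `<=` Lambda /\ sup S - (1 / 8) ^+ k < s F.
  by have [_ [F FL ->] H] := sup_adherent (q0 k) hS; exists F.
(* Unions make the sets increase, and the tolerance [(1/8)^k] is the rate of squared increments that
   [riesz_fischer] asks for. *)
pose F := fix F k := if k is k'.+1 then (F0 k `|` F k')%fset else F0 0%N.
have FL k : [set` F k] `<=` Lambda.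
  elim: k => [|k IH]; first exact: (HF0 0%N).1.
  by move=> l /=; rewrite in_fsetU => /orP[/(HF0 k.+1).1|/IH].
have sF k : sup S - s (F k) <= (1 / 8) ^+ k.
  have [_ H] := HF0 k; rewrite lerBlDr addrC -lerBlDr.
  apply: (le_trans (ltW H)); apply: mono; first exact: FL.
  by case: k {H} => [|k]; [exact: fsubset_refl|exact: fsubsetUl].
have [k|k|h [L2h Hh]] := @riesz_fischer _ D mD Dpos (fun k => g (F k)) => //.
  have FF : (F k `<=` F k.+1)%fset by exact: fsubsetUr.
  rewrite /g (psum_sub_sqr L2f (FL k.+1) FF); apply: le_trans (sF k).
  by rewrite lerD2r; apply: sS; exact: FL.
have L2fh : in_L2 D (fun x => f x - h x) by exact: in_L2B.
have fh0 : N (fun x => f x - h x) = 0.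
  apply: complete => // l Ll; apply/eqP; rewrite -normc_eq0 eq_le normc_ge0 andbT.
  apply/ler_addgt0Pl => e e0; rewrite addr0; have e2 : 0 < e / 2 by rewrite divr_gt0.
  have [k1 Hk1] := Hh _ e2.
  have [k2 _ Hk2] : \forall k \near \oo, (1 / 8) ^+ k < (e / 2) ^+ 2.
    have : (fun k => 1 * (1 / 8) ^+ k) @ \oo --> (0 : R).
      by apply: cvg_geometric; rewrite ger0_norm ?divr_ge0//; lra.
    move=> /cvgrPdist_lt/(_ ((e / 2) ^+ 2)); rewrite exprn_gt0// => /(_ isT).
    by apply: filterS => k; rewrite sub0r normrN mul1r gtr0_norm.
  pose k := maxn k1 k2.
  have L2e := in_L2_e mD Dfin l.
  have L2fg : in_L2 D (fun x => f x - g (F k) x) by exact: in_L2B.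
  have L2hg : in_L2 D (fun x => h x - g (F k) x) by exact: in_L2B.
  have -> : coef D (fun x => f x - h x) l =
      coef D (fun x => f x - g (F k) x) l - coef D (fun x => h x - g (F k) x) l.
    rewrite /coef (innerBl mD L2f L2h L2e) (innerBl mD L2f (L2g _) L2e).
    by rewrite (innerBl mD L2h (L2g _) L2e) opprB addrA subrK.
  apply: (le_trans (le_normcD _ _)); rewrite [e]splitr normcN; apply: lerD.
    have -> : coef D (fun x => f x - g (F k) x) l =
        if l \in F k then 0 else coef D f l.
      rewrite /coef (innerBl mD L2f (L2g _) L2e).
      rewrite -/(coef D f l) -/(coef D (g (F k)) l).
      rewrite (coef_psum mD Dfin Dpos _ oL (fset_uniq (F k)) (FL k) Ll).
      by case: ifP; rewrite ?subrr ?subr0.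
    (* Outside [F k] the coefficient itself is small: with [l] added, the sum is still at most
       [sup S], which exceeds [s (F k)] by at most [(1/8)^k]. *)
    case: ifPn => [_|lF]; first by rewrite normc0 ltW.
    rewrite -(@ler_pXn2r _ 2)// ?nnegrE ?normc_ge0 ?(ltW e2)//.
    apply: (@le_trans _ _ ((1 / 8) ^+ k)); last first.
      by apply/ltW/Hk2; rewrite /= leq_maxr.
    apply: le_trans (sF k); rewrite lerBrDr.
    have := sS (l |` F k)%fset; rewrite /s big_fsetU1//=; apply.
    by move=> j /=; rewrite in_fset1U => /orP[/eqP->//|]; exact: FL.
  apply: (le_trans (CauchySchwarz mD Dpos L2hg L2e)); rewrite L2norm_e mulr1.
  by apply/ltW/Hk1; rewrite leq_maxl.
exists (coef D f) => e e0; have [k Hk] := Hh e e0.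
exists (F k); first exact: FL.
move=> G FG GL; apply: le_lt_trans (Hk k (leqnn k)).
have L2hg : in_L2 D (fun x => h x - g (F k) x) by exact: in_L2B.
apply: (@le_trans _ _ (N (fun x => f x - g (F k) x))); last first.
  have := L2norm_le_sub mD Dpos L2f L2h (L2g (F k)).
  by rewrite fh0 add0r.
rewrite -(@ler_pXn2r _ 2)// ?nnegrE ?L2norm_ge0//.
have NE (H : {fset R}) : [set` H] `<=` Lambda ->
    N (fun x => f x - \sum_(l <- H) coef D f l * e_ l x) ^+ 2 = N f ^+ 2 - s H.
  move=> HL; rewrite (bessel_identity mD Dfin Dpos _ oL (fset_uniq H) HL L2f).
  by rewrite [X in _ + X]big1 ?addr0// => l _; rewrite subrr normc0 expr0n.
by rewrite NE// NE ?lerD2l ?lerN2; [exact: mono|exact: FL].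
Qed.

End completeness.

(** * Completeness of the exponentials selected by a spectral matrix *)

Section matrix_to_spectrum.
Context {R : realType} {n : nat}.
Notation mu := (@lebesgue_measure R).
Variables alpha beta : 'I_n -> R.
Hypothesis n_gt0 : (0 < n)%N.
Hypothesis lt_alpha_beta : forall i : 'I_n, alpha i < beta i.
Hypothesis lt_beta_alpha : forall i j : 'I_n, (i < j)%N -> beta i < alpha j.
Local Notation Om := (Omega alpha beta).
Local Notation twopii := (two_pi_i R).
Local Notation N := (L2norm Om).

Let mOm : measurable Om := measurable_Omega alpha beta.
Let Ofin : (mu Om < +oo)%E := Omega_finite lt_alpha_beta lt_beta_alpha.
Let Opos : 0 < length Om := length_Omega_gt0 n_gt0 lt_alpha_beta lt_beta_alpha.

Lemma in_Dmax_zero_derivative h dh : in_Dmax alpha beta h dh ->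
  (forall x, Om x -> h x = 0) -> eq_on_ae Om dh (fun=> 0).
Proof.
move=> [_ dhP _] h0; apply: ae_mono dhP => x + Ox => /(_ Ox)[dRe dIm].
have nO : \near x, h x = 0.
  have /open_Omega : Om x by [].
  by apply: filterS => y; exact: h0.
have zero (u : R -> R) (v : R) : (\near x, u x = 0) -> is_derive x 1 u v -> v = 0.
  move=> u0 du; have := near_eq_is_derive u0 du.
  by move=> [_ <-]; rewrite derive_cst.
apply: complex_eq; [apply: (zero _ _ _ dRe)|apply: (zero _ _ _ dIm)];
  by apply: filterS nO => y ->.
Qed.

Variable B : 'M[R[i]]_n.
Hypothesis sB : spectral_matrix alpha beta B.
Local Notation Lambda := [set l : R | B *m e_vec l alpha = e_vec l beta].

Lemma spectral_matrix_orthogonal : orthogonal_exponentials Om Lambda.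
Proof.
apply: orthogonal_of_cdot => // l m /= <- <-.
by rewrite unitary_cdot//; exact: sB.1.
Qed.

(** On a constant vector with entries [a] the equation is [a] times [B e_l(alpha) = e_l(beta)], so a
    nonzero constant solution puts [l] in [Lambda]. *)
Lemma spectral_matrix_solution l c : boundary_solution alpha beta B l c ->
  exists2 a : R[i], c = const_mx a & a = 0 \/ Lambda l.
Proof.
move=> cS; have [H|H] := sB.2 l.
  by exists 0; [rewrite (H c cS); apply/matrixP => i j; rewrite !mxE|left].
have [a cE] := H c cS; exists a => //.
have [->|a0] := eqVneq a 0; [by left|right].
have EE (u : 'I_n -> R) : E_ (l%:C *: cvec u) *m const_mx a = a *: e_vec l u.
  by apply/matrixP => i j; rewrite ord1 E_mulE !mxE mulrC.
move: cS; rewrite boundary_solutionE cE !EE -scalemxAr.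
exact: scalerI.
Qed.

(** Pairing with [e_ l] shows that the solution operator divides the coefficient at [l] by [l - m];
    in particular it preserves orthogonality to [e_ l] when [l] differs from [m]. *)
Lemma spectral_matrix_coef h g l m :
  in_domain alpha beta B h (fun x => twopii * (g x + m%:C * h x)) -> in_L2 Om g ->
  Lambda l -> coef Om g l + (m%:C - l%:C) * coef Om h l = 0.
Proof.
move=> hD L2g Ll.
have L2h := in_Dmax_in_L2 lt_alpha_beta lt_beta_alpha hD.1.
have eD : in_domain alpha beta B (e_ l) (fun x => twopii * l%:C * e_ l x).
  by split; [exact: in_Dmax_e|rewrite right_vec_e left_vec_e].
have L2e := in_L2_e mOm Ofin l.
have L2mh : in_L2 Om (fun x => m%:C * h x) by exact: in_L2Z.
have := in_domain_symmetric lt_alpha_beta lt_beta_alpha sB.1 hD eD.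
rewrite (innerZl mOm _ (in_L2D mOm L2g L2mh) L2e).
rewrite (innerDl mOm L2g L2mh L2e) (innerZl mOm _ L2h L2e).
rewrite (innerZr mOm _ L2e L2h) conj_mul conj_two_pi_i conj_realC.
rewrite -/(coef Om g l) -/(coef Om h l).
set p := coef Om g l; set q := coef Om h l => H.
apply: (mulfI (two_pi_i_neq0 (R := R))); rewrite mulr0 -[RHS]H; ring.
Qed.

Lemma spectral_matrix_complete f : in_L2 Om f ->
  (forall l, Lambda l -> coef Om f l = 0) -> N f = 0.
Proof.
move=> L2f f0; apply: contrapT => /eqP Nf.
have oL := spectral_matrix_orthogonal.
have [m nLm] := exists_notin_spectrum n_gt0 lt_alpha_beta lt_beta_alpha oL.
have m_sol c : boundary_solution alpha beta B m c -> c = 0.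
  move=> /spectral_matrix_solution[a -> [->|//]].
  by apply/matrixP => i j; rewrite !mxE.
have [C C0 solve] := in_domain_solve n_gt0 lt_alpha_beta lt_beta_alpha m_sol.
have /choice[T HT] (g : R -> R[i]) : exists h, in_L2 Om g ->
    in_domain alpha beta B h (fun x => twopii * (g x + m%:C * h x)) /\
    forall x, Om x -> normc (h x) <= C * N g.
  have [L2g|nL2g] := pselect (in_L2 Om g); last by exists 0.
  by have [h hD hC] := solve g L2g; exists h.
have L2T g : in_L2 Om g -> in_L2 Om (T g).
  by move=> /HT[hD _]; exact: in_Dmax_in_L2 hD.1.
have NT g : in_L2 Om g -> N (T g) <= C * N g.
  move=> L2g; apply: (L2norm_le_bound mOm Ofin Opos).
  - by rewrite mulr_ge0 ?L2norm_ge0.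
  - exact: L2T.
  - exact: (HT g L2g).2.
pose P g := in_L2 Om g /\ forall l, Lambda l -> coef Om g l = 0.
have P2 g : P g -> in_L2 Om g by case.
have PDZ g h z : P g -> P h -> P (fun x => g x + z * h x).
  move=> [L2g g0] [L2h h0]; have L2zh : in_L2 Om (fun x => z * h x) by exact: in_L2Z.
  split => [|l Ll]; first exact: in_L2D.
  have L2e := in_L2_e mOm Ofin l.
  rewrite /coef (innerDl mOm L2g L2zh L2e) (innerZl mOm _ L2h L2e).
  by rewrite -/(coef Om g l) -/(coef Om h l) g0// h0// mulr0 addr0.
have Pcl w : in_L2 Om w ->
    (forall e, 0 < e -> exists2 g, P g & N (fun x => g x - w x) < e) -> P w.
  move=> L2w wcl; split => // l Ll; have L2e := in_L2_e mOm Ofin l.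
  apply/eqP; rewrite -normc_eq0 eq_le normc_ge0 andbT.
  apply/ler_addgt0Pl => e e0; rewrite addr0.
  have [g [L2g g0] H] := wcl e e0; apply: le_trans (ltW H).
  have L2gw : in_L2 Om (fun x => g x - w x) by exact: in_L2B.
  have -> : normc (coef Om w l) = normc (inner Om (fun x => g x - w x) (e_ l)).
    rewrite (innerBl mOm L2g L2w L2e) -/(coef Om g l) -/(coef Om w l) g0//.
    by rewrite sub0r normcN.
  apply: (le_trans (CauchySchwarz mOm Opos L2gw L2e)).
  by rewrite (L2norm_e mOm Opos) mulr1.
have PT g : P g -> P (T g).
  move=> [L2g g0]; split => [|l Ll]; first exact: L2T.
  have := spectral_matrix_coef (HT g L2g).1 L2g Ll; rewrite g0// add0r => /eqP.
  rewrite mulf_eq0 => /orP[|/eqP//]; rewrite realCB_eq0 => /eqP ml.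
  by case: nLm; rewrite ml.
(* Linearity comes from uniqueness: the difference of the two candidates is an eigenfunction at [m],
   and its amplitudes vanish by [m_sol]. *)
have Tlin g h z : in_L2 Om g -> in_L2 Om h -> forall x, Om x ->
    T (fun y => g y + z * h y) x = T g x + z * T h x.
  move=> L2g L2h x Ox; pose q y := g y + z * h y.
  have L2q : in_L2 Om q by apply: in_L2D => //; exact: in_L2Z.
  have := in_domainDZ lt_alpha_beta (-1) (HT q L2q).1
    (in_domainDZ lt_alpha_beta z (HT g L2g).1 (HT h L2h).1).
  set k := (fun y => T q y + _).
  rewrite (_ : (fun y => twopii * _ + _) = (fun y => twopii * m%:C * k y)); last first.
    by apply: funext => y; rewrite /k /q; ring.
  move=> /(in_domain_eigen lt_alpha_beta lt_beta_alpha)[c /m_sol -> H].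
  have [i axb] := Ox; have := H x Ox; rewrite (stepE lt_beta_alpha _ axb) mxE mul0r.
  by rewrite /k mulN1r => /eqP; rewrite subr_eq0 => /eqP.
have Tsym g h : in_L2 Om g -> in_L2 Om h -> inner Om (T g) h = inner Om g (T h).
  move=> L2g L2h; have L2Tg := L2T g L2g; have L2Th := L2T h L2h.
  have L2mg : in_L2 Om (fun x => m%:C * T g x) by exact: in_L2Z.
  have L2mh : in_L2 Om (fun x => m%:C * T h x) by exact: in_L2Z.
  have L2s1 := in_L2D mOm L2g L2mg; have L2s2 := in_L2D mOm L2h L2mh.
  have := in_domain_symmetric lt_alpha_beta lt_beta_alpha sB.1 (HT g L2g).1 (HT h L2h).1.
  rewrite (innerZl mOm _ L2s1 L2Th) (innerDl mOm L2g L2mg L2Th).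
  rewrite (innerZl mOm _ L2Tg L2Th) (innerZr mOm _ L2s2 L2Tg).
  rewrite (innerDr mOm L2h L2mh L2Tg) (innerZr mOm _ L2Th L2Tg).
  rewrite conj_two_pi_i conj_realC.
  set p := inner Om g (T h); set q := inner Om (T g) h; set r := inner Om (T g) (T h) => H.
  apply: (mulfI (two_pi_i_neq0 (R := R))); apply/eqP; rewrite eq_sym -subr_eq0.
  by apply/eqP; rewrite -[RHS]H; ring.
have Tcomp (g : nat -> R -> R[i]) : (forall k, P (g k)) -> (forall k, N (g k) <= 1) ->
    exists2 u, in_L2 Om u & forall e, 0 < e -> forall k0, exists2 k, (k0 <= k)%N &
      N (fun x => T (g k) x - u x) < e.
  move=> Pg Ng; have L2g k : in_L2 Om (g k) by have [] := Pg k.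
  have gD k := (HT (g k) (L2g k)).1.
  (* [K] bounds the derivative [2 pi i (g + m T g)] when [N g <= 1]; [C + K] then serves both for
     the functions and for their derivatives. *)
  pose K := normc twopii * (1 + `|m| * C).
  have K0 : 0 <= K.
    by rewrite mulr_ge0 ?normc_ge0// addr_ge0// mulr_ge0.
  apply: (Dmax_cluster n_gt0 lt_alpha_beta lt_beta_alpha (C := C + K)
    (fun k => (gD k).1)) => [k x Ox|k].
    apply: (le_trans ((HT (g k) (L2g k)).2 x Ox)).
    by rewrite ler_wpDr// -[leRHS]mulr1 ler_wpM2l.
  have L2mg : in_L2 Om (fun x => m%:C * T (g k) x) by apply: in_L2Z => //; exact: L2T.
  rewrite (L2normZ mOm Opos _ (in_L2D mOm (L2g k) L2mg)).
  apply: (@le_trans _ _ K); last by rewrite lerDr.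
  rewrite ler_wpM2l ?normc_ge0//.
  apply: (le_trans (L2norm_le_add mOm Opos (L2g k) L2mg)); apply: lerD => //.
  rewrite (L2normZ mOm Opos _ (L2T _ (L2g k))) normc_real ler_wpM2l//.
  by apply: (le_trans (NT _ (L2g k))); rewrite -[leRHS]mulr1 ler_wpM2l.
have [fD _] := HT f L2f.
have Pf : P f by [].
(* [T] is injective: if [T f] vanishes on Omega, so does its derivative almost everywhere, and the
   equation leaves [f = 0]. *)
have NTf : 0 < N (T f).
  rewrite lt_neqAle L2norm_ge0 andbT eq_sym; apply/eqP => Tf0.
  have Tf_ae := L2norm_eq0 mOm Opos (L2T f L2f) Tf0.
  have Tf_0 := in_Dmax_ae0 fD.1 Tf_ae.
  have := in_Dmax_zero_derivative fD.1 Tf_0 => dTf.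
  have f_0 : eq_on_ae Om f (fun=> 0).
    apply: ae_mono dTf => x + Ox => /(_ Ox)/eqP.
    by rewrite Tf_0// mulr0 addr0 mulf_eq0 (negbTE (two_pi_i_neq0 (R := R))) => /eqP.
  have := ae_eq_L2normB mOm Opos L2f (in_L20 mOm) f_0.
  under [X in L2norm Om X = _ -> _]eq_fun do rewrite subr0.
  by move=> Nf0; rewrite Nf0 eqxx in Nf.
have [w [r [Pw Nw r0 eig]]] := compact_symmetric_eigenvector mOm Opos C0 P2 PDZ Pcl PT
  L2T Tlin NT Tsym Tcomp Pf NTf.
have L2w := P2 w Pw; have [wD _] := HT w L2w; have L2Tw := L2T w L2w.
have L2rw : in_L2 Om (fun x => r%:C * w x) by exact: in_L2Z.
have eig_ae := L2norm_eq0 mOm Opos (in_L2B mOm L2Tw L2rw) eig.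
(* [T w = r w] almost everywhere, so [(T w)' = 2 pi i (w + m T w)] becomes
   [2 pi i (m + 1/r) T w]. *)
pose l := m + r^-1.
have rC : r%:C != 0 :> R[i] by rewrite -(inj_eq (@complexI R)) in r0.
have hD : in_domain alpha beta B (T w) (fun x => twopii * l%:C * T w x).
  split; last exact: wD.2.
  apply: (in_Dmax_ae_eq wD.1); first exact: in_L2Z.
  apply: ae_mono eig_ae => x + Ox => /(_ Ox)/eqP; rewrite subr_eq0 => /eqP TE.
  rewrite /l rmorphD/= fmorphV/= TE; field; exact: rC.
have [c /spectral_matrix_solution[a cE aL] TwE] := in_domain_eigen lt_alpha_beta lt_beta_alpha hD.
have {}TwE x : Om x -> T w x = a * e_ l x.
  by move=> Ox; have [i axb] := Ox; rewrite TwE// (stepE lt_beta_alpha _ axb) cE mxE.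
(* Either [a = 0] already, or [l] is in [Lambda] and [a] is the coefficient at [l] of [T w], which
   lies in the orthogonal complement [P]. *)
have a0 : a = 0.
  case: aL => // Ll; have [_ /(_ l Ll)] := PT w Pw.
  have L2e := in_L2_e mOm Ofin l.
  have L2ae : in_L2 Om (fun x => a * e_ l x) by exact: in_L2Z.
  rewrite /coef (ae_eq_inner mOm L2Tw L2ae L2e (ae_all TwE)).
  by rewrite (innerZl mOm _ L2e L2e) (inner_e_e mOm Opos) mulr1.
have rw0 : eq_on_ae Om w (fun=> 0).
  apply: ae_mono eig_ae => x + Ox => /(_ Ox)/eqP.
  by rewrite TwE// a0 mul0r sub0r oppr_eq0 mulf_eq0 (negbTE rC) => /eqP.
have := ae_eq_L2normB mOm Opos L2w (in_L20 mOm) rw0.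
under [X in L2norm Om X = _ -> _]eq_fun do rewrite subr0.
by move=> Nw0; rewrite Nw0 ltxx in Nw.
Qed.

Lemma spectral_matrix_spectrum : spectrum Om Lambda.
Proof.
apply: (complete_spectrum mOm Ofin Opos spectral_matrix_orthogonal).
exact: spectral_matrix_complete.
Qed.

End matrix_to_spectrum.

Theorem theorem6p7 (R : realType) (n : nat) (alpha beta : 'I_n -> R)
    (n_gt0 : (0 < n)%N)
    (lt_alpha_beta : forall i : 'I_n, alpha i < beta i)
    (lt_beta_alpha : forall i j : 'I_n, (i < j)%N -> beta i < alpha j) :
  (forall Lambda : set R, spectrum (Omega alpha beta) Lambda ->
     selfadjoint_extension (Omega alpha beta) (A_ (Omega alpha beta) Lambda) /\
     exists B : 'M[R[i]]_n,
       [/\ unique (boundary_matrix alpha beta (A_ (Omega alpha beta) Lambda)) B,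
           spectral_matrix alpha beta B,
           unique (fun M : 'M[R[i]]_n => forall lambda : R, Lambda lambda ->
                     M *m e_vec lambda alpha = e_vec lambda beta) B,
           lin_span [set e_vec lambda alpha | lambda in Lambda] = setT &
           lin_span [set e_vec lambda beta | lambda in Lambda] = setT]) /\
  (forall B : 'M[R[i]]_n, spectral_matrix alpha beta B ->
     spectrum (Omega alpha beta)
       [set lambda : R | B *m e_vec lambda alpha = e_vec lambda beta]).
Proof.
split=> [Lambda sL|B sB]; last exact: spectral_matrix_spectrum.
have mOm := measurable_Omega alpha beta.
have Ofin := Omega_finite lt_alpha_beta lt_beta_alpha.
have Opos := length_Omega_gt0 n_gt0 lt_alpha_beta lt_beta_alpha.
split.
  split; first exact: A_selfadjoint.
  by move=> f g; exact: A_extends_minimal.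
have [B [uB [Be Buniq]]] :=
  exists_boundary_matrix n_gt0 lt_alpha_beta lt_beta_alpha sL.
exists B; split.
- split; first exact: A_boundary_matrix.
  by move=> M /(boundary_matrix_e n_gt0 lt_alpha_beta lt_beta_alpha sL); exact: Buniq.
- exact: A_spectral_matrix Be.
- by [].
- have [w [Sw uw]] := exists_unit_columns
    (e_vec_alpha_total n_gt0 lt_alpha_beta lt_beta_alpha sL).
  exact: lin_span_full Sw uw.
- have [w [Sw uw]] := exists_unit_columns
    (e_vec_beta_total n_gt0 lt_alpha_beta lt_beta_alpha sL).
  exact: lin_span_full Sw uw.
Qed.
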